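(* Let $X$ satisfy (P1) and (P2) and let $\alpha,\beta$ be two saddle connections on $X$. Then \[ \frac{|\alpha\cap\beta|+1}{l(\alpha)\,l(\beta)} \le \frac{1}{l_0^2}. \] Moreover, if all interior angles of the polygons are strictly obtuse, equality holds if and only if $\alpha$ and $\beta$ are both sides of polygons of length $l_0$. If some angles are right, equality holds if and only if one of the following holds: (a) $\alpha$ and $\beta$ are each a side or a diagonal of a polygon, both of length $l_0$; (b) $\alpha$ and $\beta$ are both diagonals of length $\sqrt2\,l_0$ and $|\alpha\cap\beta|=1$; (c) up to exchanging $\alpha$ and $\beta$, $\alpha$ is a side or a diagonal of length $l_0$, $\beta$ is a saddle connection of length $2l_0$ contained in the union of exactly two polygons, and $|\alpha\cap\beta|=1$.
   Context: $X$ is a translation surface obtained from a finite collection of Euclidean polygons $(P_i)_{i\in I}$ by identifying their sides in pairs, each pair consisting of two parallel sides of equal length glued by a translation. (P1): each polygon is convex with all interior angles obtuse or right. (P2): no two sides of the same polygon are identified with each other. $l_0$ is the smallest side length among all polygons. Singularities are the points of $X$ that are images of polygon vertices. A saddle connection is a straight-line segment on $X$ joining singularities with no singularity in its interior; sides of the polygons and diagonals (segments inside a polygon joining two non-adjacent vertices) are saddle connections. For saddle connections $\alpha\neq\beta$, $|\alpha\cap\beta|$ is the number of intersection points of $\alpha$ and $\beta$ which are not singularities; if $\alpha=\beta$, $|\alpha\cap\beta|:=0$. $l(\cdot)$ denotes length. *)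

(* Defs.v *)
From Stdlib Require Import Reals Lra List Relations.
Import ListNotations.
Open Scope R_scope.

Definition pt := (R * R)%type.
Definition vadd (p q : pt) : pt := (fst p + fst q, snd p + snd q).
Definition vsub (p q : pt) : pt := (fst p - fst q, snd p - snd q).
Definition vscale (s : R) (p : pt) : pt := (s * fst p, s * snd p).
Definition cross (u v : pt) : R := fst u * snd v - snd u * fst v.
Definition dot (u v : pt) : R := fst u * fst v + snd u * snd v.
Definition norm (u : pt) : R := sqrt (dot u u).
Definition seg_pt (p q : pt) (s : R) : pt := vadd p (vscale s (vsub q p)).

(** * Polygons: list of vertices, in counterclockwise order (indices mod n) *)
Definition polygon := list pt.
Definition vtx (P : polygon) (k : nat) : pt := nth (Nat.modulo k (length P)) P (0, 0).
Definition side_vec (P : polygon) (k : nat) : pt := vsub (vtx P (S k)) (vtx P k).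

Definition convex_polygon (P : polygon) : Prop :=
  (3 <= length P)%nat /\
  forall k j, (k < length P)%nat -> (j < length P)%nat -> j <> k ->
    j <> Nat.modulo (S k) (length P) ->
    cross (side_vec P k) (vsub (vtx P j) (vtx P k)) > 0.

Definition in_poly (P : polygon) (p : pt) : Prop :=
  forall k, (k < length P)%nat -> cross (side_vec P k) (vsub p (vtx P k)) >= 0.

(** interior angle at vertex k is >= 90 degrees iff this is <= 0,
    > 90 iff < 0, = 90 iff = 0 *)
Definition angle_dot (P : polygon) (k : nat) : R :=
  dot (vsub (vtx P (k + length P - 1)) (vtx P k)) (vsub (vtx P (S k)) (vtx P k)).

Record surface := mkSurface {
  polys : list polygon;
  (** side k of polygon i is glued to side (glue i k).2 of polygon (glue i k).1 *)
  glue : nat -> nat -> nat * nat }.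

Definition polyg (X : surface) (i : nat) : polygon := nth i (polys X) [].
Definition npoly (X : surface) : nat := length (polys X).
Definition valid_side (X : surface) (i k : nat) : Prop :=
  (i < npoly X)%nat /\ (k < length (polyg X i))%nat.

Definition transl (X : surface) (i k : nat) : pt :=
  vsub (vtx (polyg X (fst (glue X i k))) (snd (glue X i k))) (vtx (polyg X i) (S k)).

(** well-formed translation surface data: convex polygons, sides glued in pairs
    (an involution without fixed points) by translations, sides of a pair being
    parallel, of equal length and with opposite boundary orientation *)
Definition wf_surface (X : surface) : Prop :=
  (forall i, (i < npoly X)%nat -> convex_polygon (polyg X i)) /\
  (forall i k, valid_side X i k ->
     valid_side X (fst (glue X i k)) (snd (glue X i k)) /\
     glue X (fst (glue X i k)) (snd (glue X i k)) = (i, k) /\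
     side_vec (polyg X (fst (glue X i k))) (snd (glue X i k))
       = vscale (-1) (side_vec (polyg X i) k)).

Definition P1 (X : surface) : Prop :=
  forall i k, valid_side X i k -> angle_dot (polyg X i) k <= 0.
Definition P2 (X : surface) : Prop :=
  forall i k, valid_side X i k -> fst (glue X i k) <> i.

Definition all_strictly_obtuse (X : surface) : Prop :=
  forall i k, valid_side X i k -> angle_dot (polyg X i) k < 0.
Definition some_right (X : surface) : Prop :=
  exists i k, valid_side X i k /\ angle_dot (polyg X i) k = 0.

Definition is_min_side_length (X : surface) (l0 : R) : Prop :=
  (exists i k, valid_side X i k /\ norm (side_vec (polyg X i) k) = l0) /\
  (forall i k, valid_side X i k -> l0 <= norm (side_vec (polyg X i) k)).

(** * Points of X: pairs (i,p) with p in polygon i, modulo the gluing *)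
Definition xpt := (nat * pt)%type.

Definition on_side (X : surface) (i k : nat) (p : pt) : Prop :=
  exists s, 0 <= s <= 1 /\ p = seg_pt (vtx (polyg X i) k) (vtx (polyg X i) (S k)) s.
Definition on_open_side (X : surface) (i k : nat) (p : pt) : Prop :=
  exists s, 0 < s < 1 /\ p = seg_pt (vtx (polyg X i) k) (vtx (polyg X i) (S k)) s.

Definition glue_step (X : surface) (x y : xpt) : Prop :=
  exists k, valid_side X (fst x) k /\ on_side X (fst x) k (snd x) /\
    fst y = fst (glue X (fst x) k) /\ snd y = vadd (snd x) (transl X (fst x) k).

Definition same_pt (X : surface) : relation xpt := clos_refl_sym_trans xpt (glue_step X).

Definition is_vertex (X : surface) (i : nat) (p : pt) : Prop :=
  exists k, (k < length (polyg X i))%nat /\ p = vtx (polyg X i) k.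

Definition singular (X : surface) (x : xpt) : Prop :=
  exists y, same_pt X x y /\ is_vertex X (fst y) (snd y).

(** * Saddle connections, described by the successive straight pieces
      [pc_a, pc_b] they cut in the polygons *)
Record piece := mkPiece { pc_poly : nat; pc_a : pt; pc_b : pt }.
Definition dpiece : piece := mkPiece 0 (0, 0) (0, 0).
Definition pc (L : list piece) (t : nat) : piece := nth t L dpiece.
Definition pc_dir (c : piece) : pt := vsub (pc_b c) (pc_a c).

Definition is_saddle_connection (X : surface) (L : list piece) : Prop :=
  L <> [] /\
  (forall t, (t < length L)%nat ->
     (pc_poly (pc L t) < npoly X)%nat /\
     pc_a (pc L t) <> pc_b (pc L t) /\
     in_poly (polyg X (pc_poly (pc L t))) (pc_a (pc L t)) /\
     in_poly (polyg X (pc_poly (pc L t))) (pc_b (pc L t)) /\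
     cross (pc_dir (pc L t)) (pc_dir (pc L 0)) = 0 /\
     dot (pc_dir (pc L t)) (pc_dir (pc L 0)) > 0 /\
     (forall s, 0 < s < 1 ->
        ~ is_vertex X (pc_poly (pc L t)) (seg_pt (pc_a (pc L t)) (pc_b (pc L t)) s))) /\
  is_vertex X (pc_poly (pc L 0)) (pc_a (pc L 0)) /\
  is_vertex X (pc_poly (pc L (length L - 1))) (pc_b (pc L (length L - 1))) /\
  (forall t, (S t < length L)%nat ->
     exists k, valid_side X (pc_poly (pc L t)) k /\
       on_open_side X (pc_poly (pc L t)) k (pc_b (pc L t)) /\
       pc_poly (pc L (S t)) = fst (glue X (pc_poly (pc L t)) k) /\
       pc_a (pc L (S t)) = vadd (pc_b (pc L t)) (transl X (pc_poly (pc L t)) k)).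

Definition sc_length (L : list piece) : R :=
  fold_right (fun c acc => norm (pc_dir c) + acc) 0 L.

Definition sc_mem (X : surface) (L : list piece) (x : xpt) : Prop :=
  exists t s, (t < length L)%nat /\ 0 <= s <= 1 /\
    same_pt X x (pc_poly (pc L t), seg_pt (pc_a (pc L t)) (pc_b (pc L t)) s).

Definition sc_eq (X : surface) (L1 L2 : list piece) : Prop :=
  forall x, sc_mem X L1 x <-> sc_mem X L2 x.

(** |alpha cap beta| = n : number of non-singular intersection points,
    with the convention |alpha cap alpha| = 0 *)
Definition inter_count (X : surface) (L1 L2 : list piece) (n : nat) : Prop :=
  (sc_eq X L1 L2 /\ n = 0%nat) \/
  (~ sc_eq X L1 L2 /\
   exists ps : list xpt, length ps = n /\
     (forall x, In x ps -> sc_mem X L1 x /\ sc_mem X L2 x /\ ~ singular X x) /\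
     (forall t u, (t < n)%nat -> (u < n)%nat -> t <> u ->
        ~ same_pt X (nth t ps (0%nat, (0, 0))) (nth u ps (0%nat, (0, 0)))) /\
     (forall x, sc_mem X L1 x -> sc_mem X L2 x -> ~ singular X x ->
        exists y, In y ps /\ same_pt X x y)).

Definition is_side (X : surface) (L : list piece) : Prop :=
  exists i k, valid_side X i k /\
    forall x, sc_mem X L x <->
      exists s, 0 <= s <= 1 /\
        same_pt X x (i, seg_pt (vtx (polyg X i) k) (vtx (polyg X i) (S k)) s).

Definition is_diagonal (X : surface) (L : list piece) : Prop :=
  exists i a b, (i < npoly X)%nat /\
    (a < length (polyg X i))%nat /\ (b < length (polyg X i))%nat /\ a <> b /\
    b <> Nat.modulo (S a) (length (polyg X i)) /\
    a <> Nat.modulo (S b) (length (polyg X i)) /\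
    forall x, sc_mem X L x <->
      exists s, 0 <= s <= 1 /\
        same_pt X x (i, seg_pt (vtx (polyg X i) a) (vtx (polyg X i) b) s).

Definition poly_img (X : surface) (i : nat) (x : xpt) : Prop :=
  exists p, in_poly (polyg X i) p /\ same_pt X x (i, p).

Definition in_exactly_two_polys (X : surface) (L : list piece) : Prop :=
  (exists i j, (i < npoly X)%nat /\ (j < npoly X)%nat /\ i <> j /\
     forall x, sc_mem X L x -> poly_img X i x \/ poly_img X j x) /\
  ~ (exists k, (k < npoly X)%nat /\ forall x, sc_mem X L x -> poly_img X k x).

(* Main.v *)
(** Take [l0 = 1]. A saddle connection that does not run along a side is cut by the polygons into
    pieces. A piece has length at least [1], except for corner pieces, which join two adjacent sides.
    Consecutive corner pieces turn around opposite ends of their common side, so any two consecutive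
    pieces have total length greater than [1]. Hence the pieces of [a] that are not corners, together
    with one of any two consecutive ones, form a set [T] with at most [l(a)] elements.

    A common point on the piece [t] of [a] and the piece [u] of [b] is charged to [(t, u)] if [t] is in
    [T]. Otherwise [t] is a corner piece, and [b] leaves the corner through one of its two sides, or ends
    at its vertex; the point is then charged to the pair of pieces in the neighbouring polygon, or to an
    extra pair. As lines that are not parallel meet once, unfolding shows that no pair is charged twice. By
    (P2) the pieces of [b] in a given polygon are never consecutive, so their number is less than [l(b)].
    Strictness comes from a gap in [T] or among these pieces; if there is none, then [a] and [b] both
    return to one polygon at every second step, and a path that goes back and forth like this gains
    [sqrt 2 - 1] in length.

    This last estimate fails for a connection that is a diagonal shorter than [sqrt 2]. Every
    other vertex of the polygon then spans with the diagonal a parallelogram of area greater than [1], and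
    the crossings of [b] with it can be counted along [b]. Finally, a side is met by [b] exactly where
    [b] passes from one polygon to the next through it, which does not happen twice in a row. *)

Require Import Defs.
From Stdlib Require Import Reals List Lra Lia Arith Relations ClassicalEpsilon FinFun.
Import ListNotations.
Open Scope R_scope.

(** The inequality asks for one more than a product of two counts, so strictness alone is not
    enough: a whole unit must be gained. The case that resists is a pair of connections with
    [2 * h + 1] and [2 * h' + 1] pieces that both return to one polygon at every second step: up to
    [(h + 1) * (h' + 1)] crossings are possible, and the counts leave no room. Here lengths
    [h + sqrt 2] and [h' + sqrt 2] are just what is needed: their product exceeds
    [(h + 1) * (h' + 1) + 1], except for [h = h' = 0], where it equals 2 and case (b) appears. The
    [sqrt 2] is the hypotenuse over two legs of length 1. Case (c) comes from a connection of two
    pieces of length 1 that crosses a side.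

    Inside a polygon everything rests on heights of vertices over a line. By convexity a local
    minimum is global, so the heights rise and then fall; and as no angle is acute, a chain of edges
    that turns back over its first edge climbs by more than 1. *)

Ltac vunf := unfold norm, dot, cross, seg_pt, vadd, vsub, vscale in *; cbn [fst snd] in *.
Ltac vring := vunf; ring.

(** * Plane vectors: norms and the Cauchy-Schwarz inequality *)

Lemma pt_eq (p q : pt) : fst p = fst q -> snd p = snd q -> p = q.
Proof. destruct p, q; simpl; congruence. Qed.

Ltac veq := apply pt_eq; vunf; try ring.

Lemma dot_nonneg (u : pt) : 0 <= dot u u.
Proof. vunf; nra. Qed.

Lemma norm_nonneg (u : pt) : 0 <= norm u.
Proof. apply sqrt_pos. Qed.

Lemma norm_sqr (u : pt) : norm u * norm u = dot u u.
Proof. apply sqrt_sqrt, dot_nonneg. Qed.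

Lemma norm_ge (u : pt) (c : R) : c * c <= dot u u -> c <= norm u.
Proof.
  intros H; rewrite <- norm_sqr in H; pose proof (norm_nonneg u).
  destruct (Rle_lt_dec c (norm u)); trivial; nra.
Qed.

Lemma norm_gt (u : pt) (c : R) : 0 <= c -> c * c < dot u u -> c < norm u.
Proof.
  intros Hc H; rewrite <- norm_sqr in H; pose proof (norm_nonneg u).
  destruct (Rlt_le_dec c (norm u)); trivial; nra.
Qed.

Lemma norm_le_sqr (u : pt) (c : R) : 0 <= c -> c <= norm u -> c * c <= dot u u.
Proof. intros Hc H; rewrite <- norm_sqr; nra. Qed.

Lemma norm_scale (s : R) (u : pt) : 0 <= s -> norm (vscale s u) = s * norm u.
Proof.
  intros Hs; unfold norm.
  replace (dot (vscale s u) (vscale s u)) with ((s * s) * dot u u) by vring.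
  rewrite sqrt_mult; [| nra | apply dot_nonneg].
  now rewrite sqrt_square.
Qed.

Lemma dot_le_norms (u v : pt) : dot u v <= norm u * norm v.
Proof.
  pose proof (norm_nonneg u); pose proof (norm_nonneg v).
  assert (Hc : dot u v * dot u v <= (norm u * norm v) * (norm u * norm v)).
  { replace ((norm u * norm v) * (norm u * norm v)) with (dot u u * dot v v)
      by (rewrite <- !norm_sqr; ring).
    assert (0 <= cross u v * cross u v) by nra.
    replace (dot u u * dot v v) with (dot u v * dot u v + cross u v * cross u v) by vring.
    lra. }
  destruct (Rle_lt_dec (dot u v) (norm u * norm v)); trivial.
  assert (0 <= norm u * norm v) by nra; nra.
Qed.

Lemma cross_le_norms (u v : pt) : cross u v <= norm u * norm v.
Proof.
  replace (cross u v) with (dot (- snd u, fst u) v) by vring.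
  replace (norm u) with (norm (- snd u, fst u)) by (unfold norm; f_equal; vring).
  apply dot_le_norms.
Qed.

(** * Cyclic sequences of vertices with right or obtuse angles *)

Definition edge (V : nat -> pt) (i : nat) : pt := vsub (V (S i)) (V i).
Definition orient (p q r : pt) : R := cross (vsub q p) (vsub r p).

(** The vertices are indexed by all of [nat], periodically, so that any vertex can be
    taken as the origin. *)
Record obtuse_cycle (n : nat) (l : R) (V : nat -> pt) : Prop := {
  oc_size : (3 <= n)%nat;
  oc_period : forall i, V (i + n)%nat = V i;
  oc_convex : forall i r, (2 <= r < n)%nat -> 0 < cross (edge V i) (vsub (V (i + r)%nat) (V i));
  oc_dot : forall i, 0 <= dot (edge V i) (edge V (S i));
  oc_pos : 0 < l;
  oc_len : forall i, l * l <= dot (edge V i) (edge V i) }.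

Definition strictly_obtuse_cycle (V : nat -> pt) : Prop :=
  forall i, 0 < dot (edge V i) (edge V (S i)).

Lemma oc_shift n l V k : obtuse_cycle n l V -> obtuse_cycle n l (fun i => V (k + i)%nat).
Proof.
  intros [H1 H2 H3 H4 H5 H6].
  assert (He : forall i, edge (fun i => V (k + i)%nat) i = edge V (k + i)).
  { intros i; unfold edge; f_equal; f_equal; lia. }
  constructor; trivial.
  - intros i; rewrite Nat.add_assoc; apply H2.
  - intros i r Hr; rewrite He, Nat.add_assoc; now apply H3.
  - intros i; rewrite !He; rewrite Nat.add_succ_r; apply H4.
  - intros i; rewrite He; apply H6.
Qed.

Lemma oc_period_mul n l V : obtuse_cycle n l V -> forall k i, V (i + k * n)%nat = V i.
Proof.
  intros H k; induction k as [|k IH]; intros i; simpl.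
  - f_equal; lia.
  - replace (i + (n + k * n))%nat with ((i + k * n) + n)%nat by lia.
    rewrite (oc_period _ _ _ H); apply IH.
Qed.

Lemma oc_repr n l V : obtuse_cycle n l V ->
  forall i j, exists r, (r < n)%nat /\ V j = V (i + r)%nat /\ V (S j) = V (S (i + r)).
Proof.
  intros H i j; pose proof (oc_size _ _ _ H) as Hn.
  (* Adding [n * i] keeps the subtraction of [i] from being truncated at zero. *)
  exists ((j + n * i - i) mod n)%nat; split; [apply Nat.mod_upper_bound; lia|].
  pose proof (Nat.div_mod (j + n * i - i) n ltac:(lia)); split.
  - rewrite <- (oc_period_mul _ _ _ H i j).
    rewrite <- (oc_period_mul _ _ _ H ((j + n * i - i) / n)%nat (i + _)%nat); f_equal; nia.
  - rewrite <- (oc_period_mul _ _ _ H i (S j)).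
    rewrite <- (oc_period_mul _ _ _ H ((j + n * i - i) / n)%nat (S (i + _))); f_equal; nia.
Qed.

Section Cycle.
Variables (n : nat) (l : R) (V : nat -> pt).
Hypothesis HV : obtuse_cycle n l V.
Notation E := (edge V).

Let Hn := oc_size _ _ _ HV.
Let Hper := oc_period _ _ _ HV.
Let Hconv := oc_convex _ _ _ HV.
Let Hdot := oc_dot _ _ _ HV.
Let Hl := oc_pos _ _ _ HV.
Let Hlen := oc_len _ _ _ HV.

Lemma edge_period i : E (i + n) = E i.
Proof. unfold edge; rewrite <- (Hper i), <- (Hper (S i)); f_equal. Qed.

Lemma turn_left i : 0 < cross (E i) (E (S i)).
Proof.
  pose proof (Hconv i 2 ltac:(lia)) as H.
  replace (i + 2)%nat with (S (S i)) in H by lia.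
  unfold edge in *; vunf; lra.
Qed.

Lemma convex_ge i j : 0 <= cross (E i) (vsub (V j) (V i)).
Proof.
  destruct (oc_repr _ _ _ HV i j) as (r & Hr & -> & _).
  destruct (le_lt_dec 2 r); [left; apply Hconv; lia|right].
  assert (r = 0 \/ r = 1)%nat as [->| ->] by lia;
    [rewrite Nat.add_0_r|rewrite Nat.add_1_r]; unfold edge; vring.
Qed.

Lemma convex_ge_succ i j : 0 <= cross (E i) (vsub (V j) (V (S i))).
Proof. pose proof (convex_ge i j); unfold edge in *; vunf; lra. Qed.

Lemma convex_lt i j : (i < j)%nat -> (j < i + n)%nat -> (j <> S i)%nat ->
  0 < cross (E i) (vsub (V j) (V i)).
Proof.
  intros H1 H2 H3; replace j with (i + (j - i))%nat by lia; apply Hconv; lia.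
Qed.

(** At a vertex, the polygon lies in the cone spanned by the outgoing edge and the reversed
    incoming edge. *)
Lemma local_min_global (w : pt) i j :
  cross w (E i) <= 0 -> 0 <= cross w (E (S i)) -> 0 <= cross w (vsub (V j) (V (S i))).
Proof.
  intros H1 H2.
  set (q := vsub (V j) (V (S i))).
  pose proof (turn_left i) as Hk.
  assert (Ha : 0 <= cross (E i) q) by apply convex_ge_succ.
  assert (Hb : 0 <= cross (E (S i)) q) by apply convex_ge.
  assert (Hid : cross (E i) (E (S i)) * cross w q
                = cross (E i) q * cross w (E (S i)) - cross (E (S i)) q * cross w (E i)) by vring.
  destruct (Rle_lt_dec 0 (cross w q)); trivial; nra.
Qed.

(** If edge [i] did not climb, the height over edge 0 would have a local minimum at [V (S i)], hence
    a global one; but [V 0] lies strictly lower. *)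
Lemma cross_first_pos i : (1 <= i)%nat -> (S i < n)%nat ->
  0 <= cross (E 0) (E (S i)) -> 0 < cross (E 0) (E i).
Proof.
  intros H1 H2 H3; destruct (Rlt_le_dec 0 (cross (E 0) (E i))) as [|Hle]; trivial.
  pose proof (local_min_global (E 0) i 0 Hle H3) as Hm.
  pose proof (Hconv 0 (S i) ltac:(lia)) as Hc; simpl in Hc.
  vunf; lra.
Qed.

Lemma cross_first_range r : (r < n)%nat -> 0 <= cross (E 0) (E r) ->
  forall i, (0 < i)%nat -> (i < r)%nat -> 0 < cross (E 0) (E i).
Proof.
  intros Hr H i H0 Hi.
  (* Descending induction from [r], with [d] counting the steps back. *)
  assert (Hd : forall d, (d < r - i)%nat -> 0 < cross (E 0) (E (r - 1 - d))).
  { induction d as [|d IH]; intros Hd.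
    - apply cross_first_pos; try lia. now replace (S (r - 1 - 0)) with r by lia.
    - apply cross_first_pos; try lia.
      replace (S (r - 1 - S d)) with (r - 1 - d)%nat by lia. left; apply IH; lia. }
  replace i with (r - 1 - (r - 1 - i))%nat by lia; apply Hd; lia.
Qed.

(** The same argument for the height over edge [r], now with increasing [i]: a local minimum at
    [V (S i)] would not be higher than [V r], against convexity. *)
Lemma cross_last_range r : (r < n)%nat -> 0 <= cross (E 0) (E r) ->
  forall i, (0 < i)%nat -> (i < r)%nat -> 0 < cross (E i) (E r).
Proof.
  intros Hr H; induction i as [|i IH]; intros H0 Hi; [lia|].
  assert (Hi0 : 0 <= cross (E i) (E r)).
  { destruct i; [trivial|left; apply IH; lia]. }
  destruct (Rlt_le_dec 0 (cross (E (S i)) (E r))) as [|Hle]; trivial.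
  pose proof (local_min_global (E r) i r ltac:(vunf; lra) ltac:(vunf; lra)) as Hm.
  pose proof (convex_lt r (S i + n) ltac:(lia) ltac:(lia) ltac:(lia)) as Hc.
  rewrite Hper in Hc; vunf; lra.
Qed.

(** Seen from [V i], consecutive vertices turn to the left and all of them lie in the half-plane of
    edge [i]. Within a half-plane left turns compose, by the three-term relation between cross
    products. *)
Lemma orient_pos i j k : (i < j)%nat -> (j < k)%nat -> (k < i + n)%nat ->
  0 < orient (V i) (V j) (V k).
Proof.
  intros Hij Hjk Hk; unfold orient.
  assert (Hhalf : forall m, (S i < m)%nat -> (m < i + n)%nat -> 0 < cross (E i) (vsub (V m) (V i))).
  { intros; apply convex_lt; lia. }
  destruct (Nat.eq_dec j (S i)) as [->|Hj]; [apply Hhalf; lia|].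
  remember (k - j)%nat as d eqn:Hd.
  revert k Hjk Hk Hd; induction d as [|d IH]; intros k Hjk Hk Hd; [lia|].
  assert (Hstep : forall m, (i < m)%nat -> (S m < i + n)%nat ->
            0 < cross (vsub (V m) (V i)) (vsub (V (S m)) (V i))).
  { intros m H1 H2. pose proof (convex_lt m (i + n) ltac:(lia) ltac:(lia) ltac:(lia)) as Hc.
    rewrite Hper in Hc; unfold edge in Hc; vunf; lra. }
  destruct d as [|d].
  - replace k with (S j) by lia; apply Hstep; lia.
  - destruct k as [|k]; [lia|].
    pose proof (IH k ltac:(lia) ltac:(lia) ltac:(lia)) as H1.
    pose proof (Hstep k ltac:(lia) ltac:(lia)) as H2.
    pose proof (Hhalf j ltac:(lia) ltac:(lia)) as Hj'.
    pose proof (Hhalf k ltac:(lia) ltac:(lia)) as Hk'.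
    pose proof (Hhalf (S k) ltac:(lia) ltac:(lia)) as Hs'.
    set (u := vsub (V j) (V i)) in *; set (v := vsub (V k) (V i)) in *;
      set (w := vsub (V (S k)) (V i)) in *; set (e := E i) in *.
    assert (Hid : cross e v * cross u w = cross e u * cross v w + cross e w * cross u v) by vring.
    destruct (Rlt_le_dec 0 (cross u w)); trivial; nra.
Qed.

(** The edges of a triangle sum to zero, so [edge V 0] cannot have nonnegative products with both
    other edges. *)
Lemma four_sides : (4 <= n)%nat.
Proof.
  destruct (le_lt_dec 4 n); trivial.
  assert (n = 3)%nat as H3 by lia.
  pose proof (Hdot 0) as H0; pose proof (Hdot 2) as H2; pose proof (Hlen 0) as HL.
  pose proof (Hper 0) as P0; pose proof (Hper 1) as P1; rewrite H3 in P0, P1; simpl in P0, P1.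
  unfold edge in *; rewrite P0, P1 in *; vunf; nra.
Qed.

End Cycle.

(** * Lengths of chords *)

(** The vectors [(x, y)] and [(x', y')] are two edges that climb, one leaning forward and the next
    backward, with at most a right angle between them. Multiplying the two length bounds and using
    [(x * x') ^ 2 <= (y * y') ^ 2] gives [m * m <= y * y + y' * y'], which is impossible for
    [y + y' <= m]. *)
Lemma switch_height (m x y x' y' : R) : 0 < m -> 0 <= x -> 0 < y -> x' < 0 -> 0 < y' ->
  m * m <= x * x + y * y -> m * m <= x' * x' + y' * y' -> 0 <= x * x' + y * y' -> m < y + y'.
Proof.
  intros Hm Hx Hy Hx' Hy' H1 H2 H3.
  destruct (Rlt_le_dec m (y + y')) as [|Hle]; trivial; exfalso.
  assert (Ha : 0 <= m * m - y * y) by nra.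
  assert (Hq : (x * - x') * (x * - x') <= (y * y') * (y * y')).
  { assert (0 <= x * - x') by nra. apply Rmult_le_compat; lra. }
  assert (m * m <= y * y + y' * y') by (apply Rmult_le_reg_l with (m * m); nra).
  nra.
Qed.

Lemma quadrant_dot (e u v : pt) : 0 < dot e e -> 0 <= dot e u -> 0 <= cross e u ->
  0 <= dot e v -> 0 <= cross e v -> 0 <= dot u v.
Proof.
  intros He H1 H2 H3 H4.
  assert (Hid : dot e e * dot u v = dot e u * dot e v + cross e u * cross e v) by vring.
  destruct (Rle_lt_dec 0 (dot u v)); trivial; nra.
Qed.

Section CycleChains.
Variables (n : nat) (l : R) (V : nat -> pt).
Hypothesis HV : obtuse_cycle n l V.
Notation E := (edge V).

Let Hn := oc_size _ _ _ HV.
Let Hper := oc_period _ _ _ HV.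
Let Hconv := oc_convex _ _ _ HV.
Let Hdot := oc_dot _ _ _ HV.
Let Hl := oc_pos _ _ _ HV.
Let Hlen := oc_len _ _ _ HV.

Lemma edge_sqr_pos i : 0 < dot (E i) (E i).
Proof. pose proof (Hlen i); nra. Qed.

Lemma edge_norm_ge i : l <= norm (E i).
Proof. apply norm_ge, Hlen. Qed.

(** Either the edges never turn by more than a right angle from the first one, or two
    consecutive edges around the right angle together climb more than [l]. *)
Lemma chain_dichotomy r : (2 <= r)%nat ->
  (forall i, (0 < i)%nat -> (i < r)%nat -> 0 < cross (E 0) (E i)) ->
  (forall i, (0 < i)%nat -> (i < r)%nat -> 0 <= dot (E 0) (E i)) \/
  l * norm (E 0) < cross (E 0) (vsub (V r) (V 1)).
Proof.
  intros Hr Hy; induction r as [|r IH]; [lia|].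
  destruct (Nat.eq_dec r 1) as [->|Hr1].
  { left; intros i H0 H1; replace i with 1%nat by lia; apply Hdot. }
  assert (Hup : forall j, (1 <= j)%nat -> (j < S r)%nat -> 0 <= cross (E 0) (vsub (V j) (V 1))).
  { induction j as [|j IHj]; intros H0 H1; [lia|].
    destruct j; [right; vring|].
    pose proof (IHj ltac:(lia) ltac:(lia)); pose proof (Hy (S j) ltac:(lia) ltac:(lia)).
    unfold edge in *; vunf; lra. }
  pose proof (Hy r ltac:(lia) ltac:(lia)) as Hyr.
  destruct (IH ltac:(lia) ltac:(intros; apply Hy; lia)) as [Hx|Hh].
  - destruct (Rle_lt_dec 0 (dot (E 0) (E r))) as [Hxr|Hxr].
    + left; intros i H0 H1; destruct (Nat.eq_dec i r) as [->|]; [trivial|apply Hx; lia].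
    (* The chain first leans backward here, between the edges [r] and [S r]. Coordinates along and
       across [E 0] carry a factor [norm (E 0)], hence the threshold [l * norm (E 0)]. *)
    + right. destruct r as [|r]; [lia|].
      pose proof (Hx r ltac:(lia) ltac:(lia)) as Hx'.
      pose proof (Hy r ltac:(lia) ltac:(lia)) as Hy'.
      assert (Hs : l * norm (E 0) < cross (E 0) (E r) + cross (E 0) (E (S r))).
      { apply switch_height with (dot (E 0) (E r)) (dot (E 0) (E (S r))); trivial.
        - pose proof (edge_norm_ge 0); nra.
        - replace (_ + _) with (dot (E 0) (E 0) * dot (E r) (E r)) by vring.
          replace (l * norm (E 0) * (l * norm (E 0)))
            with (norm (E 0) * norm (E 0) * (l * l)) by ring.
          rewrite norm_sqr; apply Rmult_le_compat_l; [apply dot_nonneg|apply Hlen].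
        - replace (_ + _) with (dot (E 0) (E 0) * dot (E (S r)) (E (S r))) by vring.
          replace (l * norm (E 0) * (l * norm (E 0)))
            with (norm (E 0) * norm (E 0) * (l * l)) by ring.
          rewrite norm_sqr; apply Rmult_le_compat_l; [apply dot_nonneg|apply Hlen].
        - replace (_ + _) with (dot (E 0) (E 0) * dot (E r) (E (S r))) by vring.
          apply Rmult_le_pos; [apply dot_nonneg|apply Hdot]. }
      pose proof (Hup r ltac:(lia) ltac:(lia)) as Hu.
      unfold edge in *; vunf; lra.
  - right; unfold edge in *; vunf; lra.
Qed.

Lemma chain_quadrant r :
  (forall i, (0 < i)%nat -> (i < r)%nat -> 0 < cross (E 0) (E i)) ->
  (forall i, (0 < i)%nat -> (i < r)%nat -> 0 <= dot (E 0) (E i)) ->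
  forall j k, (1 <= j)%nat -> (j <= k)%nat -> (k <= r)%nat ->
    0 <= dot (E 0) (vsub (V k) (V j)) /\ 0 <= cross (E 0) (vsub (V k) (V j)).
Proof.
  intros Hy Hx j k Hj Hjk Hk; induction k as [|k IH]; [lia|].
  destruct (Nat.eq_dec j (S k)) as [->|]; [split; right; vring|].
  destruct (IH ltac:(lia) ltac:(lia)) as [H1 H2].
  pose proof (Hx k ltac:(lia) ltac:(lia)); pose proof (Hy k ltac:(lia) ltac:(lia)).
  unfold edge in *; vunf; split; lra.
Qed.

(** The arc from [V 1] to [V r] climbs over edge 0 throughout. If it never leans backward, the chord
    projects onto the last edge of the arc with at least the length of that edge; otherwise the
    climb alone exceeds [l]. The strict version leaves out the chord from [V 1] to [V r], which may
    be an edge. *)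
Lemma chord_far_half r s s' : (2 <= r)%nat -> (r < n)%nat -> 0 <= cross (E 0) (E r) ->
  0 <= s <= 1 -> 0 <= s' <= 1 ->
  let w := vsub (seg_pt (V r) (V (S r)) s') (seg_pt (V 0%nat) (V 1%nat) s) in
  l <= norm w /\ (strictly_obtuse_cycle V -> s < 1 \/ 0 < s' -> l < norm w).
Proof.
  intros Hr Hrn Hc Hs Hs' w.
  assert (Hy := cross_first_range n l V HV r Hrn Hc).
  pose proof (edge_norm_ge 0) as HE0.
  destruct (chain_dichotomy r Hr Hy) as [Hx|Hh].
  - assert (Hq := chain_quadrant r Hy Hx).
    destruct (Hq 1%nat (r - 1)%nat ltac:(lia) ltac:(lia) ltac:(lia)) as [Hq1 Hq2].
    destruct r as [|r]; [lia|]; replace (S r - 1)%nat with r in * by lia.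
    set (D := vsub (V r) (V 1%nat)) in *.
    assert (Hw : w = vadd (vadd (vscale (1 - s) (E 0)) D) (vadd (E r) (vscale s' (E (S r)))))
      by (subst w D; unfold edge; veq).
    pose proof (Hx r ltac:(lia) ltac:(lia)) as Hxr.
    pose proof (Hy r ltac:(lia) ltac:(lia)) as Hyr.
    assert (HDr : 0 <= dot D (E r)) by (apply quadrant_dot with (E 0); trivial;
      [apply edge_sqr_pos | lra]).
    pose proof (Hdot r) as Hd1.
    assert (Hwd : dot w (E r) = (1 - s) * dot (E 0) (E r) + dot D (E r)
              + dot (E r) (E r) + s' * dot (E r) (E (S r))) by (rewrite Hw; vring).
    pose proof (dot_le_norms w (E r)) as Hcs.
    pose proof (norm_sqr (E r)) as Hns; pose proof (edge_norm_ge r) as HEr.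
    assert (0 <= (1 - s) * dot (E 0) (E r)) by (apply Rmult_le_pos; lra).
    assert (0 <= s' * dot (E r) (E (S r))) by (apply Rmult_le_pos; lra).
    split.
    + destruct (Rle_lt_dec l (norm w)); trivial; nra.
    + intros Hob Hor.
      assert (Hgt : dot (E r) (E r) < dot w (E r)).
      { destruct Hor as [Hs1|Hs1].
        - assert (0 < (1 - s) * dot (E 0) (E r) + dot D (E r)); [|lra].
          destruct (Nat.eq_dec r 1) as [->|Hr1].
          + pose proof (Hob 0%nat). assert (0 < (1 - s) * dot (E 0) (E 1)) by
              (apply Rmult_lt_0_compat; lra). lra.
          + assert (0 < dot D (E r)); [|lra].
            destruct r as [|r]; [lia|].
            destruct (Hq 1%nat r ltac:(lia) ltac:(lia) ltac:(lia)) as [Ha Hb].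
            assert (0 <= dot (vsub (V r) (V 1%nat)) (E (S r))) by
              (apply quadrant_dot with (E 0); trivial; [apply edge_sqr_pos|lra]).
            pose proof (Hob r). subst D; unfold edge in *; vunf; lra.
        - pose proof (Hob r). assert (0 < s' * dot (E r) (E (S r))) by
            (apply Rmult_lt_0_compat; lra). lra. }
      destruct (Rlt_le_dec l (norm w)); trivial; nra.
  - assert (Hcw : l * norm (E 0) < cross (E 0) w).
    { assert (Hid : cross (E 0) w = cross (E 0) (vsub (V r) (V 1%nat)) + s' * cross (E 0) (E r))
        by (subst w; unfold edge; vring).
      assert (0 <= s' * cross (E 0) (E r)) by (apply Rmult_le_pos; lra). lra. }
    pose proof (cross_le_norms (E 0) w).
    assert (l < norm w) by (apply Rmult_lt_reg_r with (norm (E 0)); lra).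
    split; intros; lra.
Qed.

(** The bound [2 * l * l] fails for diagonals that have at least three edges on either side. *)
Lemma diagonal_far_half r : (2 <= r)%nat -> (r < n)%nat -> 0 <= cross (E 0) (E r) ->
  l < norm (vsub (V r) (V 0%nat)).
Proof.
  intros Hr Hrn Hc.
  assert (Hy := cross_first_range n l V HV r Hrn Hc).
  pose proof (edge_norm_ge 0) as HE0.
  set (w := vsub (V r) (V 0%nat)).
  destruct (chain_dichotomy r Hr Hy) as [Hx|Hh].
  - destruct (chain_quadrant r Hy Hx 1%nat r ltac:(lia) ltac:(lia) ltac:(lia)) as [H1 H2].
    destruct (chain_quadrant r Hy Hx 2%nat r ltac:(lia) ltac:(lia) ltac:(lia)) as [H3 H4].
    pose proof (Hy 1%nat ltac:(lia) ltac:(lia)) as Hy1.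
    assert (Hyw : 0 < cross (E 0) w) by (subst w; unfold edge in *; vunf; lra).
    assert (Hxw : dot (E 0) (E 0) <= dot (E 0) w) by (subst w; unfold edge in *; vunf; lra).
    assert (Hid : dot (E 0) (E 0) * dot w w = dot (E 0) w * dot (E 0) w + cross (E 0) w * cross (E 0) w)
      by vring.
    apply norm_gt; [lra|].
    pose proof (edge_sqr_pos 0) as Hp; pose proof (Hlen 0).
    apply Rmult_lt_reg_l with (dot (E 0) (E 0)); trivial. rewrite Hid; nra.
  - assert (Hcw : cross (E 0) w = cross (E 0) (vsub (V r) (V 1%nat))) by (subst w; unfold edge; vring).
    pose proof (cross_le_norms (E 0) w).
    apply Rmult_lt_reg_r with (norm (E 0)); lra.
Qed.

End CycleChains.

Section CycleDistances.
Variables (n : nat) (l : R) (V : nat -> pt).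
Hypothesis HV : obtuse_cycle n l V.

Lemma edge_shift k i : edge (fun i => V (k + i)%nat) i = edge V (k + i).
Proof. unfold edge; now rewrite Nat.add_succ_r. Qed.

Lemma seg_period k s : seg_pt (V (k + n)%nat) (V (S (k + n))) s = seg_pt (V k) (V (S k)) s.
Proof. change (S (k + n)) with (S k + n)%nat; now rewrite !(oc_period _ _ _ HV). Qed.

Lemma norm_vsub_sym p q : norm (vsub p q) = norm (vsub q p).
Proof. unfold norm; f_equal; vring. Qed.

(** The edges make one full turn, so between two sides one of the two arcs turns by at most a
    half-turn. The estimate is taken along that arc, starting from the one or the other side. *)
Lemma chord_far k r s s' : (2 <= r)%nat -> (r + 2 <= n)%nat -> 0 <= s <= 1 -> 0 <= s' <= 1 ->
  let w := vsub (seg_pt (V (k + r)%nat) (V (S (k + r))) s') (seg_pt (V k) (V (S k)) s) in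
  l <= norm w /\ (strictly_obtuse_cycle V -> 0 < s < 1 \/ 0 < s' < 1 -> l < norm w).
Proof.
  intros Hr Hrn Hs Hs'.
  destruct (Rle_lt_dec 0 (cross (edge V k) (edge V (k + r)))) as [Hc|Hc].
  - pose proof (chord_far_half n l _ (oc_shift n l V k HV) r s s' Hr ltac:(lia)) as H.
    rewrite !edge_shift, !Nat.add_0_r, !Nat.add_1_r, Nat.add_succ_r in H.
    destruct (H Hc Hs Hs') as [H1 H2]; split; trivial.
    intros Hob Hor; apply H2; [|lra].
    intros i; rewrite !edge_shift, Nat.add_succ_r; apply Hob.
  - pose proof (chord_far_half n l _ (oc_shift n l V (k + r) HV) (n - r) s' s
                  ltac:(lia) ltac:(lia)) as H.
    rewrite !edge_shift, !Nat.add_0_r, !Nat.add_1_r, Nat.add_succ_r in H.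
    replace (k + r + (n - r))%nat with (k + n)%nat in H by lia.
    rewrite (edge_period n l V HV), seg_period in H.
    destruct (H ltac:(vunf; lra) Hs' Hs) as [H1 H2].
    rewrite norm_vsub_sym in H1, H2; split; trivial.
    intros Hob Hor; apply H2; [|lra].
    intros i; rewrite !edge_shift, Nat.add_succ_r; apply Hob.
Qed.

Lemma diagonal_far k r : (2 <= r)%nat -> (r + 2 <= n)%nat -> l < norm (vsub (V (k + r)%nat) (V k)).
Proof.
  intros Hr Hrn.
  destruct (Rle_lt_dec 0 (cross (edge V k) (edge V (k + r)))) as [Hc|Hc].
  - pose proof (diagonal_far_half n l _ (oc_shift n l V k HV) r Hr ltac:(lia)) as H.
    rewrite !edge_shift, !Nat.add_0_r in H. now apply H.
  - pose proof (diagonal_far_half n l _ (oc_shift n l V (k + r) HV) (n - r)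
                  ltac:(lia) ltac:(lia)) as H.
    rewrite !edge_shift, !Nat.add_0_r in H.
    replace (k + r + (n - r))%nat with (k + n)%nat in H by lia.
    rewrite (edge_period n l V HV), (oc_period _ _ _ HV) in H.
    rewrite norm_vsub_sym; apply H; vunf; lra.
Qed.

End CycleDistances.

(** * Mirror images, to run through a cycle in the opposite direction *)

Section Reflection.
Variables (n : nat) (l : R) (V : nat -> pt).
Hypothesis HV : obtuse_cycle n l V.

Definition mirror (p : pt) : pt := (fst p, - snd p).

Lemma dot_mirror u v : dot (mirror u) (mirror v) = dot u v.
Proof. unfold mirror; vring. Qed.

Lemma norm_mirror u : norm (mirror u) = norm u.
Proof. unfold norm; now rewrite dot_mirror. Qed.

Lemma mirror_vsub p q : mirror (vsub p q) = vsub (mirror p) (mirror q).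
Proof. unfold mirror; veq. Qed.

Lemma mirror_vscale s p : mirror (vscale s p) = vscale s (mirror p).
Proof. unfold mirror; veq. Qed.

Lemma mirror_vadd p q : mirror (vadd p q) = vadd (mirror p) (mirror q).
Proof. unfold mirror; veq. Qed.

(** The vertices in clockwise order, reflected: index [k + (n - 1) * i] stands for [k - i]. *)
Definition reversed (k : nat) : nat -> pt := fun i => mirror (V (k + (n - 1) * i)%nat).

(** The hypothesis is the congruence [j = k - i] modulo [n], written with a quotient [m] to avoid
    subtraction. *)
Lemma reversed_eq k i j m : (i + j = k + m * n)%nat -> reversed k i = mirror (V j).
Proof.
  intros H; unfold reversed; f_equal; pose proof (oc_size _ _ _ HV).
  destruct (le_lt_dec m i) as [Hm|Hm].
  - rewrite <- (oc_period_mul _ _ _ HV (i - m) j); f_equal; nia.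
  - rewrite <- (oc_period_mul _ _ _ HV (m - i) (k + _)); f_equal; nia.
Qed.

Lemma edge_reversed k i j m : (S i + j = k + m * n)%nat ->
  edge (reversed k) i = vscale (-1) (mirror (edge V j)).
Proof.
  intros H; unfold edge at 1.
  rewrite (reversed_eq k (S i) j m), (reversed_eq k i (S j) m) by lia.
  unfold edge, mirror; veq.
Qed.

Lemma oc_reversed k : obtuse_cycle n l (reversed k).
Proof.
  pose proof (oc_size _ _ _ HV) as Hn.
  assert (Hex : forall i, exists j m, (i + j = k + m * n)%nat).
  { intros i; exists (k + i * n - i)%nat, i; nia. }
  constructor; trivial.
  - intros i; unfold reversed; f_equal.
    rewrite <- (oc_period_mul _ _ _ HV (n - 1) (k + (n - 1) * i)); f_equal; nia.
  - intros i r Hr.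
    destruct (Hex (i + r)%nat) as (j & m & Hj).
    rewrite (edge_reversed k i (j + (r - 1)) m) by lia.
    rewrite (reversed_eq k (i + r) j m), (reversed_eq k i (j + r) m) by lia.
    pose proof (convex_lt n l V HV (j + (r - 1)) (j + n) ltac:(lia) ltac:(lia) ltac:(lia)) as Hc.
    rewrite (oc_period _ _ _ HV) in Hc.
    replace (j + r)%nat with (S (j + (r - 1))) by lia.
    unfold edge, mirror in *; vunf; lra.
  - intros i; destruct (Hex (S (S i))) as (j & m & Hj).
    rewrite (edge_reversed k (S i) j m), (edge_reversed k i (S j) m) by lia.
    pose proof (oc_dot _ _ _ HV j); unfold mirror; vunf; lra.
  - apply (oc_pos _ _ _ HV).
  - intros i; destruct (Hex (S i)) as (j & m & Hj).
    rewrite (edge_reversed k i j m) by lia.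
    pose proof (oc_len _ _ _ HV j); unfold mirror; vunf; lra.
Qed.

Lemma reversed_strict k : strictly_obtuse_cycle V -> strictly_obtuse_cycle (reversed k).
Proof.
  intros H i; pose proof (oc_size _ _ _ HV).
  assert (exists j m, (S (S i) + j = k + m * n)%nat) as (j & m & Hj).
  { exists (k + (S (S i)) * n - S (S i))%nat, (S (S i)); nia. }
  rewrite (edge_reversed k (S i) j m), (edge_reversed k i (S j) m) by lia.
  pose proof (H j); unfold mirror; vunf; lra.
Qed.

End Reflection.

(** * The vertices of a polygon with a diagonal of length at most [sqrt 2 * l] *)

Section Thin.
Variables (n : nat) (l : R) (V : nat -> pt).
Hypothesis HV : obtuse_cycle n l V.
Notation E := (edge V).

(** The second alternative admits the length [sqrt 2 * l] itself when no angle is right. It is what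
    confines equality in case (b) to surfaces with a right angle. *)
Definition short_sqr (S : nat -> pt) (w : pt) : Prop :=
  dot w w < 2 * (l * l) \/ (dot w w <= 2 * (l * l) /\ strictly_obtuse_cycle S).

(** The edges 0 and 1 and the remaining chain [D] have nonnegative products with each other, so the
    square of the chord is at least the sum of the squares of two edges. *)
Lemma quadrant_chain_from0 r : (2 <= r)%nat ->
  (forall i, (0 < i)%nat -> (i < r)%nat -> 0 < cross (E 0) (E i)) ->
  (forall i, (0 < i)%nat -> (i < r)%nat -> 0 <= dot (E 0) (E i)) ->
  ~ short_sqr V (vsub (V r) (V 0%nat)).
Proof.
  intros Hr Hy Hx.
  destruct (chain_quadrant n l V HV r Hy Hx 2%nat r ltac:(lia) ltac:(lia) ltac:(lia)) as [H1 H2].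
  set (D := vsub (V r) (V 2%nat)) in *.
  assert (Hw : vsub (V r) (V 0%nat) = vadd (E 0) (vadd (E 1) D)) by (subst D; unfold edge; veq).
  rewrite Hw.
  pose proof (oc_len _ _ _ HV 0%nat); pose proof (oc_len _ _ _ HV 1%nat).
  pose proof (oc_dot _ _ _ HV 0%nat) as Hd.
  pose proof (Hy 1%nat ltac:(lia) ltac:(lia)).
  assert (0 <= dot (E 1) D) by (apply quadrant_dot with (E 0); trivial;
    [apply (edge_sqr_pos n l V HV)|lra]).
  pose proof (dot_nonneg D).
  assert (Hid : dot (vadd (E 0) (vadd (E 1) D)) (vadd (E 0) (vadd (E 1) D)) =
     dot (E 0) (E 0) + dot (E 1) (E 1) + dot D D + 2 * dot (E 0) (E 1) + 2 * dot (E 0) D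
     + 2 * dot (E 1) D) by vring.
  intros [Hs|[Hs Ho]]; [lra|]. pose proof (Ho 0%nat); lra.
Qed.

(** The variant for an arc that is preceded by edge 0 instead of starting with it; it serves for the
    arc that goes the other way round in the mirror image. *)
Lemma quadrant_chain_from1 r : (3 <= r)%nat ->
  (forall i, (0 < i)%nat -> (i < r)%nat -> 0 < cross (E 0) (E i)) ->
  (forall i, (0 < i)%nat -> (i < r)%nat -> 0 <= dot (E 0) (E i)) ->
  ~ short_sqr V (vsub (V r) (V 1%nat)).
Proof.
  intros Hr Hy Hx.
  destruct (chain_quadrant n l V HV r Hy Hx 3%nat r ltac:(lia) ltac:(lia) ltac:(lia)) as [H1 H2].
  set (D := vsub (V r) (V 3%nat)) in *.
  assert (Hw : vsub (V r) (V 1%nat) = vadd (E 1) (vadd (E 2) D)) by (subst D; unfold edge; veq).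
  rewrite Hw.
  pose proof (oc_len _ _ _ HV 1%nat); pose proof (oc_len _ _ _ HV 2%nat).
  pose proof (oc_dot _ _ _ HV 1%nat) as Hd.
  pose proof (Hy 1%nat ltac:(lia) ltac:(lia)); pose proof (Hy 2%nat ltac:(lia) ltac:(lia)).
  pose proof (Hx 1%nat ltac:(lia) ltac:(lia)); pose proof (Hx 2%nat ltac:(lia) ltac:(lia)).
  pose proof (edge_sqr_pos n l V HV 0%nat) as HE0.
  assert (0 <= dot (E 1) D) by (apply quadrant_dot with (E 0); trivial; lra).
  assert (0 <= dot (E 2) D) by (apply quadrant_dot with (E 0); trivial; lra).
  pose proof (dot_nonneg D).
  assert (Hid : dot (vadd (E 1) (vadd (E 2) D)) (vadd (E 1) (vadd (E 2) D)) =
     dot (E 1) (E 1) + dot (E 2) (E 2) + dot D D + 2 * dot (E 1) (E 2) + 2 * dot (E 1) D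
     + 2 * dot (E 2) D) by vring.
  intros [Hs|[Hs Ho]]; [lra|]. pose proof (Ho 1%nat); lra.
Qed.

End Thin.

Section ThinDiagonals.
Variables (n : nat) (l : R) (V : nat -> pt).
Hypothesis HV : obtuse_cycle n l V.

(** The cross product is read as the height of [V r] over edge 0, times the length of that edge. On
    the arc that climbs, a chain that never leans backward would have too long a chord, so it does
    lean backward, and the climb is then more than [l]. *)
Lemma thin_next_half r : (2 <= r)%nat -> (r + 2 <= n)%nat ->
  short_sqr l V (vsub (V r) (V 0%nat)) -> l * l < cross (edge V 0) (vsub (V r) (V 0%nat)).
Proof.
  intros Hr Hrn Hs; pose proof (oc_pos _ _ _ HV) as Hl.
  pose proof (edge_norm_ge n l V HV 0) as HE0.
  assert (Hend : l * norm (edge V 0) < cross (edge V 0) (vsub (V r) (V 0%nat)) ->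
                 l * l < cross (edge V 0) (vsub (V r) (V 0%nat))) by (intros; nra).
  apply Hend.
  destruct (Rle_lt_dec 0 (cross (edge V 0) (edge V r))) as [Hc|Hc].
  - assert (Hy := cross_first_range n l V HV r ltac:(lia) Hc).
    destruct (chain_dichotomy n l V HV r Hr Hy) as [Hx|Hh].
    + exfalso; exact (quadrant_chain_from0 n l V HV r Hr Hy Hx Hs).
    + unfold edge in *; vunf; lra.
  - (* the other way round from the first vertex, against the orientation *)
    assert (Hy : forall j, (r <= j)%nat -> (j < n)%nat -> 0 < cross (edge V j) (edge V 0)).
    { intros j H1 H2. destruct (Nat.eq_dec j r) as [->|]; [vunf; lra|].
      pose proof (cross_last_range n l _ (oc_shift n l V r HV) (n - r) ltac:(lia)) as H.
      rewrite !edge_shift in H; replace (r + (n - r))%nat with (0 + n)%nat in H by lia.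
      rewrite (edge_period n l V HV), Nat.add_0_r in H.
      specialize (H ltac:(vunf; lra) (j - r)%nat ltac:(lia) ltac:(lia)).
      rewrite edge_shift in H; now replace (r + (j - r))%nat with j in H by lia. }
    set (W := reversed n V 1).
    assert (HW : obtuse_cycle n l W) by apply (oc_reversed n l V HV).
    assert (He0 : edge W 0 = vscale (-1) (mirror (edge V 0)))
      by (apply (edge_reversed n l V HV 1 0 0 0); lia).
    assert (HyW : forall i, (0 < i)%nat -> (i < 1 + (n - r))%nat -> 0 < cross (edge W 0) (edge W i)).
    { intros i H1 H2. unfold W at 2; rewrite (edge_reversed n l V HV 1 i (n - i) 1), He0 by lia.
      pose proof (Hy (n - i)%nat ltac:(lia) ltac:(lia)); unfold mirror; vunf; lra. }
    assert (HWr : W (1 + (n - r))%nat = mirror (V r))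
      by (apply (reversed_eq n l V HV 1 _ r 1); lia).
    assert (HW1 : W 1%nat = mirror (V 0%nat)) by (apply (reversed_eq n l V HV 1 1 0 0); lia).
    destruct (chain_dichotomy n l W HW (1 + (n - r)) ltac:(lia) HyW) as [Hx|Hh].
    + exfalso. refine (quadrant_chain_from1 n l W HW (1 + (n - r)) ltac:(lia) HyW Hx _).
      rewrite HWr, HW1, <- mirror_vsub; unfold short_sqr; rewrite dot_mirror.
      destruct Hs as [Hs|[Hs Ho]]; [now left|right; split; trivial].
      now apply (reversed_strict n l V HV).
    + rewrite HWr, HW1, He0 in Hh.
      replace (norm (vscale (-1) (mirror (edge V 0)))) with (norm (edge V 0)) in Hh
        by (unfold norm, mirror; f_equal; vring).
      unfold mirror, edge in *; vunf; lra.
Qed.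

End ThinDiagonals.

Lemma short_shift l V k w : short_sqr l V w -> short_sqr l (fun i => V (k + i)%nat) w.
Proof.
  intros [Hs|[Hs Ho]]; [now left|right; split; trivial].
  intros i; rewrite !edge_shift, Nat.add_succ_r; apply Ho.
Qed.

Lemma thin_next n l V (HV : obtuse_cycle n l V) k r : (2 <= r)%nat -> (r + 2 <= n)%nat ->
  short_sqr l V (vsub (V (k + r)%nat) (V k)) ->
  l * l < cross (edge V k) (vsub (V (k + r)%nat) (V k)).
Proof.
  intros Hr Hrn Hs.
  pose proof (thin_next_half n l _ (oc_shift n l V k HV) r Hr Hrn) as H.
  rewrite edge_shift, Nat.add_0_r in H; apply H, short_shift, Hs.
Qed.

Lemma thin_prev n l V (HV : obtuse_cycle n l V) k r : (2 <= r)%nat -> (r + 2 <= n)%nat ->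
  short_sqr l V (vsub (V (S k + r)%nat) (V (S k))) ->
  l * l < cross (edge V k) (vsub (V (S k + r)%nat) (V (S k))).
Proof.
  intros Hr Hrn Hs.
  pose proof (thin_next_half n l _ (oc_reversed n l V HV (S k)) (n - r)
                ltac:(lia) ltac:(lia)) as H.
  rewrite (edge_reversed n l V HV (S k) 0 k 0) in H by lia.
  rewrite (reversed_eq n l V HV (S k) 0 (S k) 0) in H by lia.
  rewrite (reversed_eq n l V HV (S k) (n - r) (S k + r) 1) in H by lia.
  rewrite <- mirror_vsub in H.
  assert (Hc : cross (vscale (-1) (mirror (edge V k))) (mirror (vsub (V (S k + r)%nat) (V (S k))))
     = cross (edge V k) (vsub (V (S k + r)%nat) (V (S k)))) by (unfold mirror; vring).
  rewrite Hc in H; apply H.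
  destruct Hs as [Hs|[Hs Ho]]; unfold short_sqr; rewrite dot_mirror; [now left|right].
  split; trivial; now apply (reversed_strict n l V HV).
Qed.

(** The height over a diagonal increases and then decreases along an arc, so it suffices to
    look at the two ends of the arc. *)
Lemma thin_between n l V (HV : obtuse_cycle n l V) r : (2 <= r)%nat -> (r + 2 <= n)%nat ->
  short_sqr l V (vsub (V r) (V 0%nat)) ->
  forall j, (0 < j)%nat -> (j < r)%nat -> l * l < orient (V 0%nat) (V j) (V r).
Proof.
  intros Hr Hrn Hs.
  set (D := vsub (V r) (V 0%nat)).
  assert (Hfirst : l * l < cross (vsub (V 1%nat) (V 0%nat)) D).
  { apply (thin_next n l V HV 0 r Hr Hrn Hs). }
  assert (Hlast : l * l < cross (vsub (V (r - 1)%nat) (V 0%nat)) D).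
  { pose proof (thin_prev n l V HV (r - 1) (n - r) ltac:(lia) ltac:(lia)) as H.
    replace (S (r - 1)) with r in H by lia.
    replace (r + (n - r))%nat with (0 + n)%nat in H by lia.
    rewrite (oc_period _ _ _ HV) in H.
    assert (Hs' : short_sqr l V (vsub (V 0%nat) (V r))).
    { unfold short_sqr in *.
      replace (dot (vsub (V 0%nat) (V r)) (vsub (V 0%nat) (V r))) with (dot D D)
        by (unfold D; vring); exact Hs. }
    specialize (H Hs'); unfold edge in H; replace (S (r - 1)) with r in H by lia.
    subst D; vunf; lra. }
  (* Once the height over the diagonal stops increasing, it decreases: otherwise it would have a
     local and hence global minimum at [V (S i)], which lies strictly above [V 0]. *)
  assert (Hdesc : forall i, (1 <= i)%nat -> (S i < r)%nat -> cross (edge V i) D <= 0 ->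
                    cross (edge V (S i)) D < 0).
  { intros i H1 H2 Hi; destruct (Rlt_le_dec (cross (edge V (S i)) D) 0) as [|Hle]; trivial.
    pose proof (local_min_global n l V HV (vscale (-1) D) i 0 ltac:(vunf; lra) ltac:(vunf; lra)) as Hm.
    pose proof (orient_pos n l V HV 0 (S i) r ltac:(lia) ltac:(lia) ltac:(lia)) as Ho.
    unfold orient in Ho; subst D; vunf; lra. }
  assert (Hd2 : forall d i, (1 <= i)%nat -> (i + d < r)%nat -> cross (edge V i) D <= 0 ->
             cross (vsub (V (i + d)%nat) (V 0%nat)) D <= cross (vsub (V i) (V 0%nat)) D /\
             cross (edge V (i + d)) D <= 0).
  { induction d as [|d IHd]; intros i H1 H2 Hi.
    - rewrite Nat.add_0_r; split; lra.
    - destruct (IHd i H1 ltac:(lia) Hi) as [Ha Hb].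
      rewrite Nat.add_succ_r; split; [unfold edge in Hb; vunf; lra|].
      left; apply Hdesc; trivial; lia. }
  intros j Hj Hjr; unfold orient; fold D.
  induction j as [|j IH]; [lia|].
  destruct j; [exact Hfirst|].
  specialize (IH ltac:(lia) ltac:(lia)).
  destruct (Rle_lt_dec (cross (edge V (S j)) D) 0) as [Hle|Hgt].
  - destruct (Nat.eq_dec (S (S j)) (r - 1)) as [->|]; trivial.
    pose proof (Hdesc (S j) ltac:(lia) ltac:(lia) Hle) as Hlt.
    destruct (Hd2 (r - 1 - S (S j))%nat (S (S j)) ltac:(lia) ltac:(lia) ltac:(lra)) as [Ha _].
    replace (S (S j) + (r - 1 - S (S j)))%nat with (r - 1)%nat in Ha by lia. lra.
  - unfold edge in Hgt; vunf; lra.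
Qed.

(** For [w <= l] the sum is at least the hypotenuse over [w] and [l] plus [l - w]. It is smallest at
    [w = l], since the hypotenuse grows more slowly than [w]; for larger [w] the hypotenuse alone
    suffices. *)
Lemma leg_sum (A B w c l : R) : 0 < l -> 0 <= A -> 0 <= w -> 0 <= c -> l <= w + c ->
  w * w + l * l <= A * A -> c <= B -> sqrt 2 * l <= A + B.
Proof.
  intros Hl HA Hw Hc Hwc HA2 HB.
  assert (HwA : w <= A) by nra.
  assert (H2 : sqrt 2 * sqrt 2 = 2) by (apply sqrt_sqrt; lra).
  destruct (Rle_lt_dec (sqrt 2 * l) (A + c)); [lra|nra].
Qed.

(** * Two sides whose directions differ by at most a right angle *)

Section Cone.
Variables (n : nat) (l : R) (V : nat -> pt).
Hypothesis HV : obtuse_cycle n l V.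
Variable r : nat.
Hypothesis Hr : (1 <= r < n)%nat.
Notation E := (edge V).
Hypothesis Hc : 0 < cross (E 0) (E r).
Hypothesis Hd : 0 <= dot (E 0) (E r).

Definition in_cone (v : pt) : Prop := 0 <= cross (E 0) v /\ 0 <= cross v (E r).

(** In the basis [E 0], [E r] vectors of the cone have nonnegative coordinates, and the basis
    vectors have nonnegative products. *)
Lemma cone_dot u v : in_cone u -> in_cone v -> 0 <= dot u v.
Proof.
  intros [H1 H2] [H3 H4].
  set (k := cross (E 0) (E r)) in *.
  set (a := cross u (E r)) in *; set (b := cross (E 0) u) in *.
  set (a' := cross v (E r)) in *; set (b' := cross (E 0) v) in *.
  assert (Hid : (k * k) * dot u v = (a * a') * dot (E 0) (E 0)
     + (a * b' + b * a') * dot (E 0) (E r) + (b * b') * dot (E r) (E r))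
    by (subst k a a' b b'; vring).
  pose proof (dot_nonneg (E 0)); pose proof (dot_nonneg (E r)).
  assert (0 <= (a * a') * dot (E 0) (E 0)) by (repeat apply Rmult_le_pos; trivial).
  assert (0 <= (b * b') * dot (E r) (E r)) by (repeat apply Rmult_le_pos; trivial).
  assert (0 <= (a * b' + b * a') * dot (E 0) (E r)) by
    (apply Rmult_le_pos; trivial; apply Rplus_le_le_0_compat; now apply Rmult_le_pos).
  assert (0 < k * k) by nra.
  destruct (Rle_lt_dec 0 (dot u v)); trivial; nra.
Qed.

Lemma cone_add u v : in_cone u -> in_cone v -> in_cone (vadd u v).
Proof. intros [H1 H2] [H3 H4]; split; vunf; lra. Qed.

Lemma cone_scale s u : 0 <= s -> in_cone u -> in_cone (vscale s u).
Proof.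
  intros Hs [H1 H2]; split.
  - replace (cross (E 0) (vscale s u)) with (s * cross (E 0) u) by vring; now apply Rmult_le_pos.
  - replace (cross (vscale s u) (E r)) with (s * cross u (E r)) by vring; now apply Rmult_le_pos.
Qed.

Lemma cone_edge i : (i <= r)%nat -> in_cone (E i).
Proof.
  intros Hi; split.
  - destruct (Nat.eq_dec i 0) as [->|]; [right; vring|].
    destruct (Nat.eq_dec i r) as [->|]; [lra|].
    left; apply (cross_first_range n l V HV r); try lia; lra.
  - destruct (Nat.eq_dec i 0) as [->|]; [lra|].
    destruct (Nat.eq_dec i r) as [->|]; [right; vring|].
    left; apply (cross_last_range n l V HV r); try lia; lra.
Qed.

Lemma cone_chain j k : (j <= k)%nat -> (k <= S r)%nat -> in_cone (vsub (V k) (V j)).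
Proof.
  intros Hjk Hk; induction k as [|k IH].
  - replace j with 0%nat by lia; split; right; vring.
  - destruct (Nat.eq_dec j (S k)) as [->|]; [split; right; vring|].
    replace (vsub (V (S k)) (V j)) with (vadd (E k) (vsub (V k) (V j))) by (unfold edge; veq).
    apply cone_add; [apply cone_edge|apply IH]; lia.
Qed.

Lemma cone_sqr_ge u v w : in_cone u -> in_cone v -> in_cone w ->
  dot u u + dot v v <= dot (vadd (vadd u v) w) (vadd (vadd u v) w).
Proof.
  intros Hu Hv Hw; pose proof (cone_dot u v Hu Hv); pose proof (cone_dot u w Hu Hw).
  pose proof (cone_dot v w Hv Hw); pose proof (dot_nonneg w).
  replace (dot (vadd (vadd u v) w) (vadd (vadd u v) w))
    with (dot u u + dot v v + dot w w + 2 * dot u v + 2 * dot u w + 2 * dot v w) by vring.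
  lra.
Qed.

Lemma orient_ge i j k : (i <= j)%nat -> (j <= k)%nat -> (k <= i + n)%nat ->
  0 <= orient (V i) (V j) (V k).
Proof.
  intros H1 H2 H3.
  destruct (Nat.eq_dec i j) as [->|]; [right; unfold orient; vring|].
  destruct (Nat.eq_dec j k) as [->|]; [right; unfold orient; vring|].
  destruct (Nat.eq_dec k (i + n)) as [->|].
  - rewrite (oc_period _ _ _ HV); right; unfold orient; vring.
  - left; apply (orient_pos n l V HV); lia.
Qed.

Variables s s2 : R.
Hypothesis Hs : 0 < s < 1.
Hypothesis Hs2 : 0 < s2 < 1.
Let x := seg_pt (V 0%nat) (V 1%nat) s.
Let y := seg_pt (V r) (V (S r)) s2.
(** Up to sign, the corner piece in a neighbouring polygon that joins the copies of [x] and [y]: its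
    legs are the parts of the two glued sides next to the corner. The pieces before and after it lie
    in the polygon [V] and have the same direction. *)
Let g := vadd (vscale s (E 0)) (vscale (1 - s2) (E r)).

Lemma chord_side_expand p : orient x y p =
  (1 - s) * (1 - s2) * orient (V 0%nat) (V r) p + (1 - s) * s2 * orient (V 0%nat) (V (S r)) p
  + s * (1 - s2) * orient (V 1%nat) (V r) p + s * s2 * orient (V 1%nat) (V (S r)) p.
Proof. unfold x, y, orient; vring. Qed.

(** The value is an average of four values at vertices of the two sides, with positive weights; none
    is negative and one is positive. *)
Lemma chord_left j : (r < j)%nat -> (j <= n)%nat -> 0 < orient x y (V j).
Proof.
  intros H1 H2; rewrite chord_side_expand.
  pose proof (orient_ge 0 r j ltac:(lia) ltac:(lia) ltac:(lia)).
  pose proof (orient_ge 0 (S r) j ltac:(lia) ltac:(lia) ltac:(lia)).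
  pose proof (orient_ge 1 r j ltac:(lia) ltac:(lia) ltac:(lia)).
  pose proof (orient_ge 1 (S r) j ltac:(lia) ltac:(lia) ltac:(lia)).
  pose proof (four_sides n l V HV).
  assert (0 < (1 - s) * (1 - s2)) by nra; assert (0 < (1 - s) * s2) by nra.
  assert (0 < s * (1 - s2)) by nra; assert (0 < s * s2) by nra.
  assert (Hp : 0 < orient (V 0%nat) (V r) (V j) \/ 0 < orient (V 1%nat) (V (S r)) (V j)
               \/ 0 < orient (V 1%nat) (V r) (V j)).
  { destruct (Nat.eq_dec j n) as [->|].
    - destruct (Nat.eq_dec r 1) as [->|].
      + right; left; apply (orient_pos n l V HV); lia.
      + right; right; apply (orient_pos n l V HV); lia.
    - left; apply (orient_pos n l V HV); lia. }
  assert (Hm : forall c o, 0 < c -> 0 <= o -> 0 <= c * o) by (intros; nra).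
  set (o1 := orient (V 0%nat) (V r) (V j)) in *; set (o2 := orient (V 0%nat) (V (S r)) (V j)) in *.
  set (o3 := orient (V 1%nat) (V r) (V j)) in *; set (o4 := orient (V 1%nat) (V (S r)) (V j)) in *.
  pose proof (Hm _ o1 H6 ltac:(lra)); pose proof (Hm _ o2 H7 ltac:(lra)).
  pose proof (Hm _ o3 H8 ltac:(lra)); pose proof (Hm _ o4 H9 ltac:(lra)).
  destruct Hp as [Hp|[Hp|Hp]].
  - pose proof (Rmult_lt_0_compat _ _ H6 Hp); lra.
  - pose proof (Rmult_lt_0_compat _ _ H9 Hp); lra.
  - pose proof (Rmult_lt_0_compat _ _ H8 Hp); lra.
Qed.

Lemma zigzag_norm : s * norm (E 0) <= norm g /\ (1 - s2) * norm (E r) <= norm g.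
Proof.
  assert (Hsq : forall c u v, 0 <= c -> 0 <= dot u v -> c * norm u <= norm (vadd (vscale c u) v)).
  { intros c u v H1 H2; apply norm_ge.
    replace (c * norm u * (c * norm u)) with (c * c * (norm u * norm u)) by ring.
    rewrite norm_sqr; pose proof (dot_nonneg v).
    replace (dot (vadd (vscale c u) v) (vadd (vscale c u) v))
      with (c * c * dot u u + 2 * c * dot u v + dot v v) by vring. nra. }
  split; unfold g.
  - apply Hsq; [lra|].
    replace (dot (E 0) (vscale (1 - s2) (E r))) with ((1 - s2) * dot (E 0) (E r)) by vring; nra.
  - replace (vadd (vscale s (E 0)) (vscale (1 - s2) (E r)))
      with (vadd (vscale (1 - s2) (E r)) (vscale s (E 0))) by veq.
    apply Hsq; [lra|].
    replace (dot (E r) (vscale s (E 0))) with (s * dot (E 0) (E r)) by vring; nra.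
Qed.

(** The sign of [cross g (vsub y x)] keeps the vertex from lying to the left of the chord, so it
    belongs to the arc between the two sides, beyond [V 1]. The way to it consists of the rest of
    side 0, the whole edge 1 and a remainder, all in the cone. *)
Lemma zigzag_left lam j : 0 < lam -> V j = vadd x (vscale lam g) -> 0 <= cross g (vsub y x) ->
  (1 - s) * norm (E 0) * ((1 - s) * norm (E 0)) + l * l <= dot (vscale lam g) (vscale lam g).
Proof.
  intros Hlam Hj Hside.
  destruct (oc_repr _ _ _ HV 1 j) as (r' & Hr' & Hjr & _); rewrite Hjr in Hj; clear Hjr j.
  remember (1 + r')%nat as j eqn:Ej.
  assert (Hf : orient x y (V j) <= 0).
  { rewrite Hj; replace (orient x y (vadd x (vscale lam g))) with (- (lam * cross g (vsub y x)))
      by (unfold orient; vring). nra. }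
  assert (Hjle : (j <= r)%nat).
  { destruct (le_lt_dec j r); trivial; pose proof (chord_left j ltac:(lia) ltac:(lia)); lra. }
  assert (Hj1 : j <> 1%nat).
  { intros ->.
    assert (He : cross (E 0) (vsub (V 1%nat) x) = 0) by (unfold x, edge; vring).
    rewrite Hj in He.
    replace (cross (E 0) (vsub (vadd x (vscale lam g)) x)) with (lam * (1 - s2) * cross (E 0) (E r)) in He
      by (unfold g; vring).
    assert (0 < lam * (1 - s2)) by nra; nra. }
  assert (Hv : vscale lam g = vadd (vadd (vscale (1 - s) (E 0)) (E 1)) (vsub (V j) (V 2%nat))).
  { assert (H1 : vscale lam g = vsub (V j) x) by (rewrite Hj; veq).
    rewrite H1; unfold x, edge; veq. }
  rewrite Hv.
  pose proof (cone_sqr_ge (vscale (1 - s) (E 0)) (E 1) (vsub (V j) (V 2%nat))) as Hge.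
  specialize (Hge (cone_scale (1 - s) _ ltac:(lra) (cone_edge 0 ltac:(lia))) (cone_edge 1 ltac:(lia))
                (cone_chain 2 j ltac:(lia) ltac:(lia))).
  pose proof (oc_len _ _ _ HV 1%nat); pose proof (norm_sqr (E 0)) as Hn.
  replace ((1 - s) * norm (E 0) * ((1 - s) * norm (E 0)))
    with ((1 - s) * (1 - s) * (norm (E 0) * norm (E 0))) by ring.
  rewrite Hn.
  replace (dot (vscale (1 - s) (E 0)) (vscale (1 - s) (E 0)))
    with ((1 - s) * (1 - s) * dot (E 0) (E 0)) in Hge by vring.
  lra.
Qed.

Lemma right_chain_sqr mu j c (v : pt) : (1 <= j)%nat -> (S j <= r)%nat -> in_cone v ->
  vscale mu g = vadd (vadd (vscale s2 (E r)) (E (r - 1))) (vadd (vsub (V (r - 1)%nat) (V j)) (vscale c v)) ->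
  0 <= c ->
  s2 * norm (E r) * (s2 * norm (E r)) + l * l <= dot (vscale mu g) (vscale mu g).
Proof.
  intros H1 H2 Hv Hg Hc0; rewrite Hg.
  pose proof (cone_sqr_ge (vscale s2 (E r)) (E (r - 1))
     (vadd (vsub (V (r - 1)%nat) (V j)) (vscale c v))) as Hge.
  specialize (Hge (cone_scale s2 _ ltac:(lra) (cone_edge r ltac:(lia))) (cone_edge (r - 1) ltac:(lia))
     (cone_add _ _ (cone_chain j (r - 1) ltac:(lia) ltac:(lia)) (cone_scale _ _ Hc0 Hv))).
  pose proof (oc_len _ _ _ HV (r - 1)%nat); pose proof (norm_sqr (E r)) as Hn.
  replace (s2 * norm (E r) * (s2 * norm (E r))) with (s2 * s2 * (norm (E r) * norm (E r))) by ring.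
  rewrite Hn.
  replace (dot (vscale s2 (E r)) (vscale s2 (E r))) with (s2 * s2 * dot (E r) (E r)) in Hge by vring.
  lra.
Qed.

(** The counterpart at the other end: for the opposite sign the vertex reached from [y] belongs to
    the arc before [V r], and the whole edge [r - 1] is passed. *)
Lemma zigzag_right_vertex mu j : 0 < mu -> V j = vsub y (vscale mu g) -> cross g (vsub y x) <= 0 ->
  s2 * norm (E r) * (s2 * norm (E r)) + l * l <= dot (vscale mu g) (vscale mu g).
Proof.
  intros Hmu Hj Hside.
  destruct (oc_repr _ _ _ HV 1 j) as (r' & Hr' & Hjr & _); rewrite Hjr in Hj; clear Hjr j.
  remember (1 + r')%nat as j eqn:Ej.
  assert (Hf : orient x y (V j) <= 0).
  { rewrite Hj; replace (orient x y (vsub y (vscale mu g))) with (mu * cross g (vsub y x))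
      by (unfold orient; vring). nra. }
  assert (Hjle : (j <= r)%nat).
  { destruct (le_lt_dec j r); trivial; pose proof (chord_left j ltac:(lia) ltac:(lia)); lra. }
  assert (Hjr : j <> r).
  { intros ->.
    assert (He : cross (vsub (V r) y) (E r) = 0) by (unfold y, edge; vring).
    rewrite Hj in He.
    replace (cross (vsub (vsub y (vscale mu g)) y) (E r)) with (- (mu * s * cross (E 0) (E r))) in He
      by (unfold g; vring).
    assert (0 < mu * s) by nra; nra. }
  apply (right_chain_sqr mu j 0 (E 0)); try lia; try lra.
  - apply cone_edge; lia.
  - assert (H1 : vscale mu g = vsub y (V j)) by (rewrite Hj; veq).
    rewrite H1; unfold y, edge; replace (S (r - 1)) with r by lia; veq.
Qed.

(** The exception is the side just before side [r]: the piece from [y] is then itself a corner piece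
    and may be short. In that case only the corner piece in the neighbour and this one together are
    bounded, and a further piece must supply the rest. *)
Lemma zigzag_right_side mu m s3 : 0 < mu -> 0 < s3 < 1 ->
  seg_pt (V m) (V (S m)) s3 = vsub y (vscale mu g) -> cross g (vsub y x) <= 0 ->
  s2 * norm (E r) * (s2 * norm (E r)) + l * l <= dot (vscale mu g) (vscale mu g) \/
  (V m = V (r - 1)%nat /\ V (S m) = V r /\
   (1 - s3) * norm (E m) * ((1 - s3) * norm (E m)) + l * l
     <= dot (vadd g (vscale mu g)) (vadd g (vscale mu g))).
Proof.
  intros Hmu Hs3 Hz Hside.
  assert (exists m', (m' < n)%nat /\ V m = V m' /\ V (S m) = V (S m')) as (m' & Hm' & E1 & E2).
  { exists (m mod n)%nat; split; [apply Nat.mod_upper_bound; lia|].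
    rewrite (Nat.div_mod m n) at 1 3 by lia; rewrite <- !Nat.add_succ_l.
    rewrite Nat.add_comm, (Nat.mul_comm n), (oc_period_mul _ _ _ HV); split; trivial.
    rewrite <- (oc_period_mul _ _ _ HV (m / n) (S (m mod n))); f_equal; lia. }
  assert (He : E m = E m') by (unfold edge; congruence).
  rewrite E1, E2, He in *; clear E1 E2 He m; rename m' into m.
  assert (Hf : orient x y (seg_pt (V m) (V (S m)) s3) <= 0).
  { rewrite Hz; replace (orient x y (vsub y (vscale mu g))) with (mu * cross g (vsub y x))
      by (unfold orient; vring). nra. }
  assert (Hjle : (m <= r)%nat).
  { destruct (le_lt_dec m r); trivial.
    pose proof (chord_left m ltac:(lia) ltac:(lia)); pose proof (chord_left (S m) ltac:(lia) ltac:(lia)).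
    assert (orient x y (seg_pt (V m) (V (S m)) s3)
       = (1 - s3) * orient x y (V m) + s3 * orient x y (V (S m))) by (unfold orient; vring).
    assert (0 < (1 - s3) * orient x y (V m)) by (apply Rmult_lt_0_compat; lra).
    assert (0 < s3 * orient x y (V (S m))) by (apply Rmult_lt_0_compat; lra). lra. }
  assert (Hjr : m <> r).
  { intros ->.
    assert (He : cross (vsub (seg_pt (V r) (V (S r)) s3) y) (E r) = 0) by (unfold y, edge; vring).
    rewrite Hz in He.
    replace (cross (vsub (vsub y (vscale mu g)) y) (E r)) with (- (mu * s * cross (E 0) (E r))) in He
      by (unfold g; vring).
    assert (0 < mu * s) by nra; nra. }
  assert (Hg : vscale mu g = vsub y (seg_pt (V m) (V (S m)) s3)) by (rewrite Hz; veq).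
  destruct (Nat.eq_dec (S m) r) as [Hm|Hm].
  - right; replace (r - 1)%nat with m by lia; rewrite Hm; repeat split; trivial.
    (* Together the two pieces run along the whole side [r]: one contributes [(1 - s2) * E r], the
       other [s2 * E r]. *)
    assert (Hsum : vadd g (vscale mu g)
      = vadd (vadd (E r) (vscale (1 - s3) (E m))) (vscale s (E 0))).
    { rewrite Hg; unfold g, y, edge; rewrite Hm; veq. }
    rewrite Hsum.
    pose proof (cone_sqr_ge (E r) (vscale (1 - s3) (E m)) (vscale s (E 0))) as Hge.
    specialize (Hge (cone_edge r ltac:(lia)) (cone_scale (1 - s3) _ ltac:(lra) (cone_edge m ltac:(lia)))
       (cone_scale s _ ltac:(lra) (cone_edge 0 ltac:(lia)))).
    pose proof (oc_len _ _ _ HV r); pose proof (norm_sqr (E m)) as Hn.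
    replace ((1 - s3) * norm (E m) * ((1 - s3) * norm (E m)))
      with ((1 - s3) * (1 - s3) * (norm (E m) * norm (E m))) by ring.
    rewrite Hn.
    replace (dot (vscale (1 - s3) (E m)) (vscale (1 - s3) (E m)))
      with ((1 - s3) * (1 - s3) * dot (E m) (E m)) in Hge by vring.
    lra.
  - left; apply (right_chain_sqr mu (S m) (1 - s3) (E m)); try lia; try lra.
    + apply cone_edge; lia.
    + rewrite Hg; unfold y, edge; replace (S (r - 1)) with r by lia; veq.
Qed.

End Cone.

(** * The polygons of a surface *)

Lemma vtx_mod P k : vtx P (k mod length P) = vtx P k.
Proof. unfold vtx; now rewrite Nat.Div0.mod_mod. Qed.

Lemma vtx_congr P j k : (j mod length P = k mod length P)%nat -> vtx P j = vtx P k.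
Proof. unfold vtx; now intros ->. Qed.

Definition height (P : polygon) (k : nat) (p : pt) : R := cross (edge (vtx P) k) (vsub p (vtx P k)).

Lemma height_seg P k p q s : height P k (seg_pt p q s) = (1 - s) * height P k p + s * height P k q.
Proof. unfold height; vring. Qed.

Lemma edge_vtx_mod P k : edge (vtx P) (k mod length P) = edge (vtx P) k.
Proof.
  unfold edge; rewrite vtx_mod; f_equal; apply vtx_congr.
  rewrite <- (Nat.add_1_r (k mod _)), <- (Nat.add_1_r k); apply Nat.Div0.add_mod_idemp_l.
Qed.

Lemma height_mod P k p : height P (k mod length P) p = height P k p.
Proof. unfold height; now rewrite edge_vtx_mod, vtx_mod. Qed.

Lemma seg_0 p q : seg_pt p q 0 = p.
Proof. veq. Qed.

Lemma seg_1 p q : seg_pt p q 1 = q.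
Proof. veq. Qed.

Section Polygon.
Variables (l : R) (P : polygon).
Notation n := (length P).
Notation V := (vtx P).
Hypothesis HV : obtuse_cycle n l V.
Let Hn := oc_size _ _ _ HV.

Lemma in_poly_height p : in_poly P p -> forall k, 0 <= height P k p.
Proof.
  intros H k; rewrite <- height_mod; apply Rge_le, H, Nat.mod_upper_bound; lia.
Qed.

Lemma height_vertex j k : 0 <= height P k (V j).
Proof. apply (convex_ge _ _ _ HV). Qed.

Lemma height_open_pos j k s : (j < n)%nat -> (k < n)%nat -> j <> k -> 0 < s < 1 ->
  0 < height P j (seg_pt (V k) (V (S k)) s).
Proof.
  intros Hj Hk Hjk Hs; rewrite height_seg.
  pose proof (height_vertex k j) as H1; pose proof (height_vertex (S k) j) as H2.
  assert (Hp : 0 < height P j (V k) \/ 0 < height P j (V (S k))).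
  { destruct (le_lt_dec k j) as [Hlt|Hlt].
    - rewrite <- (oc_period _ _ _ HV k), <- (oc_period _ _ _ HV (S k)).
      destruct (Nat.eq_dec (S k + n) (j + n)) as [He|He].
      + left; apply (convex_lt _ _ _ HV); lia.
      + right; apply (convex_lt _ _ _ HV); lia.
    - destruct (Nat.eq_dec k (S j)) as [He|He].
      + right; apply (convex_lt _ _ _ HV); lia.
      + left; apply (convex_lt _ _ _ HV); lia. }
  destruct Hp as [Hp|Hp].
  - assert (0 < (1 - s) * height P j (V k)) by (apply Rmult_lt_0_compat; lra).
    assert (0 <= s * height P j (V (S k))) by (apply Rmult_le_pos; lra). lra.
  - assert (0 <= (1 - s) * height P j (V k)) by (apply Rmult_le_pos; lra).
    assert (0 < s * height P j (V (S k))) by (apply Rmult_lt_0_compat; lra). lra.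
Qed.

Lemma open_side_unique j k s : (j < n)%nat -> (k < n)%nat -> 0 < s < 1 ->
  height P j (seg_pt (V k) (V (S k)) s) = 0 -> j = k.
Proof.
  intros Hj Hk Hs H; destruct (Nat.eq_dec j k) as [|Hne]; trivial.
  pose proof (height_open_pos j k s Hj Hk Hne Hs); lra.
Qed.

Lemma height_vertex_zero j k : (j < n)%nat -> (k < n)%nat -> height P k (V j) = 0 ->
  j = k \/ j = (S k mod n)%nat.
Proof.
  intros Hj Hk H; destruct (Nat.eq_dec j k) as [|H1]; [now left|right].
  destruct (Nat.eq_dec j (S k mod n)) as [|H2]; trivial; exfalso.
  destruct (le_lt_dec j k) as [Hlt|Hlt].
  - rewrite <- (oc_period _ _ _ HV j) in H.
    assert (j + n <> S k)%nat.
    { intros He; apply H2. rewrite <- He, Nat.Div0.add_mod, Nat.Div0.mod_same, Nat.add_0_r,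
        Nat.Div0.mod_mod; symmetry; now apply Nat.mod_small. }
    pose proof (convex_lt _ _ _ HV k (j + n) ltac:(lia) ltac:(lia) ltac:(lia)).
    unfold height in H; lra.
  - assert (j <> S k) by (intros He; apply H2; rewrite <- He; symmetry; now apply Nat.mod_small).
    pose proof (convex_lt _ _ _ HV k j ltac:(lia) ltac:(lia) ltac:(lia)).
    unfold height in H; lra.
Qed.

Lemma vtx_inj j k : (j < n)%nat -> (k < n)%nat -> V j = V k -> j = k.
Proof.
  intros Hj Hk H.
  destruct (Nat.eq_dec j k) as [|Hne]; trivial; exfalso.
  assert (Hgen : forall a b, (a < b)%nat -> (b < n)%nat -> V a <> V b).
  { intros a b H1 H2 He.
    destruct (Nat.eq_dec b (S a)) as [->|].
    - pose proof (edge_sqr_pos _ _ _ HV a) as Hp; unfold edge in Hp; rewrite He in Hp; vunf; lra.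
    - pose proof (convex_lt _ _ _ HV a b ltac:(lia) ltac:(lia) ltac:(lia)) as Hp.
      rewrite He in Hp; vunf; lra. }
  destruct (lt_eq_lt_dec j k) as [[Hlt| ->]|Hlt]; [| lia |].
  - now apply (Hgen j k).
  - now apply (Hgen k j).
Qed.

End Polygon.

(** * From the data of a surface to obtuse cycles; gluings as translations *)

Section Surface.
Variables (X : surface) (l0 : R).
Hypothesis Hwf : wf_surface X.
Hypothesis HP1 : P1 X.
Hypothesis Hmin : is_min_side_length X l0.
Notation PG i := (polyg X i).
Notation len i := (length (polyg X i)).

(** Passes from vertices below the length to all indices. The two vertices excluded in
    [convex_polygon] are those with [r] equal to 0 or 1 modulo the length. *)
Lemma convex_lift P : convex_polygon P -> forall i r, (2 <= r < length P)%nat ->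
  0 < cross (edge (vtx P) i) (vsub (vtx P (i + r)) (vtx P i)).
Proof.
  intros [H3 Hc] i r Hr; set (n := length P) in *.
  rewrite <- edge_vtx_mod, <- (vtx_mod P (i + r)), <- (vtx_mod P i); fold n.
  assert (Hn : n <> 0%nat) by lia.
  pose proof (Nat.div_mod i n Hn) as Di; pose proof (Nat.div_mod (i + r) n Hn) as Dr.
  pose proof (Nat.mod_upper_bound i n Hn); pose proof (Nat.mod_upper_bound (i + r) n Hn).
  apply Hc; trivial.
  - intros He. rewrite He in Dr. assert (r = n * ((i + r) / n - i / n))%nat by nia.
    destruct ((i + r) / n - i / n)%nat; nia.
  - intros He.
    assert (Hq : exists q, (i + r = S i + q * n \/ i + r + q * n = S i)%nat).
    { pose proof (Nat.div_mod (S (i mod n)) n Hn) as Ds; rewrite <- He in Ds.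
      destruct (le_lt_dec (i / n + S (i mod n) / n) ((i + r) / n)).
      - exists ((i + r) / n - (i / n + S (i mod n) / n))%nat; left; nia.
      - exists ((i / n + S (i mod n) / n) - (i + r) / n)%nat; right; nia. }
    destruct Hq as ([|q] & [Hq|Hq]); nia.
Qed.

(** A side of length zero would have zero cross products, against convexity. *)
Lemma min_side_pos : 0 < l0.
Proof.
  destruct Hmin as [(i & k & [Hi Hk] & <-) _]; destruct Hwf as [Hcv _].
  pose proof (convex_lift _ (Hcv i Hi) k 2) as H; destruct (Hcv i Hi) as [H3 _].
  specialize (H ltac:(lia)).
  apply norm_gt; [lra|]. change (side_vec (PG i) k) with (edge (vtx (PG i)) k).
  set (e := edge (vtx (PG i)) k) in *.
  destruct (Rle_lt_dec (dot e e) 0); [|lra]; exfalso.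
  assert (fst e = 0 /\ snd e = 0) as [E1 E2] by (vunf; split; nra).
  unfold cross in H; rewrite E1, E2 in H; lra.
Qed.

Lemma polygon_cycle i : (i < npoly X)%nat -> obtuse_cycle (len i) l0 (vtx (PG i)).
Proof.
  intros Hi; destruct Hwf as [Hcv _]; pose proof (Hcv i Hi) as Hci; destruct Hci as [H3 _].
  assert (Hn : len i <> 0%nat) by lia.
  constructor; trivial.
  - intros k; apply vtx_congr.
    rewrite Nat.Div0.add_mod, Nat.Div0.mod_same, Nat.add_0_r; apply Nat.Div0.mod_mod.
  - apply convex_lift, Hcv, Hi.
  - intros k; pose proof (HP1 i (S k mod len i)) as H.
    specialize (H (conj Hi (Nat.mod_upper_bound _ _ Hn))); unfold angle_dot in H.
    rewrite vtx_mod in H.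
    assert (E1 : vtx (PG i) (S (S k mod len i)) = vtx (PG i) (S (S k))).
    { apply vtx_congr. rewrite <- (Nat.add_1_r (S k mod _)), Nat.Div0.add_mod_idemp_l; f_equal; lia. }
    assert (E2 : vtx (PG i) (S k mod len i + len i - 1) = vtx (PG i) k).
    { apply vtx_congr. pose proof (Nat.div_mod (S k) (len i) Hn).
      rewrite <- (Nat.Div0.mod_add (S k mod len i + len i - 1) (S k / len i)).
      rewrite <- (Nat.Div0.mod_add k 1). f_equal. nia. }
    rewrite E1, E2 in H; unfold edge; vunf; lra.
  - apply min_side_pos.
  - intros k; rewrite <- edge_vtx_mod.
    apply norm_le_sqr; [left; apply min_side_pos|].
    apply (proj2 Hmin i); split; trivial; now apply Nat.mod_upper_bound.
Qed.

Lemma strictly_obtuse_polygon i : (i < npoly X)%nat -> all_strictly_obtuse X ->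
  strictly_obtuse_cycle (vtx (PG i)).
Proof.
  intros Hi Ho k.
  pose proof (oc_size _ _ _ (polygon_cycle i Hi)) as H3; assert (Hn : len i <> 0%nat) by lia.
  pose proof (Ho i (S k mod len i)) as H.
  specialize (H (conj Hi (Nat.mod_upper_bound _ _ Hn))); unfold angle_dot in H.
  rewrite vtx_mod in H.
  assert (E1 : vtx (PG i) (S (S k mod len i)) = vtx (PG i) (S (S k))).
  { apply vtx_congr. rewrite <- (Nat.add_1_r (S k mod _)), Nat.Div0.add_mod_idemp_l; f_equal; lia. }
  assert (E2 : vtx (PG i) (S k mod len i + len i - 1) = vtx (PG i) k).
  { apply vtx_congr. pose proof (Nat.div_mod (S k) (len i) Hn).
    rewrite <- (Nat.Div0.mod_add (S k mod len i + len i - 1) (S k / len i)).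
    rewrite <- (Nat.Div0.mod_add k 1). f_equal. nia. }
  rewrite E1, E2 in H; unfold edge; vunf; lra.
Qed.

Definition gpoly i k := fst (glue X i k).
Definition gside i k := snd (glue X i k).

Lemma glue_valid i k : valid_side X i k -> valid_side X (gpoly i k) (gside i k).
Proof. intros H; apply (proj2 Hwf i k H). Qed.

Lemma glue_glue i k : valid_side X i k -> glue X (gpoly i k) (gside i k) = (i, k).
Proof. intros H; apply (proj2 Hwf i k H). Qed.

Lemma glue_edge i k : valid_side X i k ->
  edge (vtx (PG (gpoly i k))) (gside i k) = vscale (-1) (edge (vtx (PG i)) k).
Proof. intros H; apply (proj2 Hwf i k H). Qed.

Lemma transl_glue i k : valid_side X i k ->
  transl X (gpoly i k) (gside i k) = vscale (-1) (transl X i k).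
Proof.
  intros H; pose proof (glue_glue i k H) as Hg; pose proof (glue_edge i k H) as He.
  unfold transl at 1; rewrite Hg; cbn [fst snd].
  unfold transl; fold (gpoly i k) (gside i k). unfold edge in He.
  assert (E1 := f_equal fst He); assert (E2 := f_equal snd He).
  apply pt_eq; vunf; lra.
Qed.

(** Glued sides have opposite boundary orientation, which turns the parameter [s] into [1 - s]. *)
Lemma transl_seg i k s : valid_side X i k ->
  vadd (seg_pt (vtx (PG i) k) (vtx (PG i) (S k)) s) (transl X i k)
  = seg_pt (vtx (PG (gpoly i k)) (gside i k)) (vtx (PG (gpoly i k)) (S (gside i k))) (1 - s).
Proof.
  intros H; pose proof (glue_edge i k H) as He; unfold edge in He.
  assert (E1 := f_equal fst He); assert (E2 := f_equal snd He).
  unfold transl; fold (gpoly i k) (gside i k).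
  apply pt_eq; vunf; nra.
Qed.

End Surface.

(** * Points of the surface *)

Fixpoint psum (f : nat -> R) (n : nat) : R :=
  match n with O => 0 | S m => psum f m + f m end.

Lemma psum_ext f g n : (forall t, (t < n)%nat -> f t = g t) -> psum f n = psum g n.
Proof. induction n; simpl; intros H; [trivial|]. rewrite IHn, H; auto. Qed.

Lemma psum_scale c f n : psum (fun t => f t * c) n = psum f n * c.
Proof. induction n; simpl; [ring|rewrite IHn; ring]. Qed.

Lemma psum_mono f n : (forall t, (t < n)%nat -> 0 < f t) ->
  forall j k, (j < k)%nat -> (k <= n)%nat -> psum f j < psum f k.
Proof.
  intros Hf j k Hjk; induction k as [|k IH]; intros Hk; [lia|].
  simpl; pose proof (Hf k ltac:(lia)).
  destruct (Nat.eq_dec j k) as [->|]; [lra|]. pose proof (IH ltac:(lia) ltac:(lia)); lra.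
Qed.

Lemma psum_shift f n : psum f (S n) = f 0%nat + psum (fun t => f (S t)) n.
Proof. induction n; [simpl; ring|]. change (psum f (S (S n))) with (psum f (S n) + f (S n)). rewrite IHn; simpl; ring. Qed.

Lemma psum_locate f n : (forall t, (t < n)%nat -> 0 < f t) -> (0 < n)%nat ->
  forall sg, 0 <= sg <= psum f n ->
  exists t s, (t < n)%nat /\ 0 <= s <= 1 /\ sg = psum f t + s * f t.
Proof.
  intros Hf; induction n as [|n IH]; intros Hn sg Hsg; [lia|].
  pose proof (Hf n ltac:(lia)) as Hfn; simpl in Hsg.
  destruct (Rle_lt_dec (psum f n) sg) as [Hle|Hlt].
  - exists n, ((sg - psum f n) / f n); split; [lia|].
    assert (He : (sg - psum f n) / f n * f n = sg - psum f n) by (field; lra).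
    split; [|lra]. split.
    + apply Rmult_le_reg_r with (f n); lra.
    + apply Rmult_le_reg_r with (f n); lra.
  - destruct (Nat.eq_dec n 0) as [->|]; [simpl in Hlt; lra|].
    destruct (IH ltac:(intros; apply Hf; lia) ltac:(lia) sg ltac:(lra)) as (t & s & H1 & H2 & H3).
    exists t, s; split; [lia|split; trivial].
Qed.

Section Points.
Variables (X : surface) (l0 : R).
Hypothesis Hwf : wf_surface X.
Hypothesis HP1 : P1 X.
Hypothesis Hmin : is_min_side_length X l0.
Notation PG i := (polyg X i).
Notation len i := (length (polyg X i)).
Let Hcyc := polygon_cycle X l0 Hwf HP1 Hmin.

Definition side_pt (i k : nat) (s : R) : pt := seg_pt (vtx (PG i) k) (vtx (PG i) (S k)) s.

(** The gluing on points strictly inside sides. Vertices are left out because they may have many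
    copies, whereas any other point has at most two. *)
Definition partner (x y : xpt) : Prop :=
  exists k s, valid_side X (fst x) k /\ 0 < s < 1 /\ snd x = side_pt (fst x) k s /\
    y = (gpoly X (fst x) k, side_pt (gpoly X (fst x) k) (gside X (fst x) k) (1 - s)).

(** A vertex lies on two sides, a point inside a side on one only. *)
Lemma open_side_not_vertex i k s : valid_side X i k -> 0 < s < 1 ->
  ~ is_vertex X i (side_pt i k s).
Proof.
  intros [Hi Hk] Hs (j & Hj & He).
  pose proof (Hcyc i Hi) as HV; pose proof (four_sides _ _ _ HV) as H4.
  assert (Hoj : forall m, (m < len i)%nat -> height (PG i) m (vtx (PG i) j) = 0 -> m = k).
  { intros m Hm Hz; rewrite <- He in Hz; now apply (open_side_unique l0 _ HV m k s). }
  assert (H1 : j = k) by (apply Hoj; trivial; unfold height; vring).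
  assert (H2 : ((j + len i - 1) mod len i)%nat = k).
  { apply Hoj; [apply Nat.mod_upper_bound; lia|]. rewrite height_mod.
    replace (vtx (PG i) j) with (vtx (PG i) (S (j + len i - 1))).
    - unfold height, edge; vring.
    - replace (S (j + len i - 1)) with (j + len i)%nat by lia; apply (oc_period _ _ _ HV). }
  subst j.
  destruct k as [|k].
  - rewrite Nat.mod_small in H2; lia.
  - replace (S k + len i - 1)%nat with (k + 1 * len i)%nat in H2 by lia.
    rewrite Nat.Div0.mod_add, Nat.mod_small in H2; lia.
Qed.

Lemma side_pt_end i k s : valid_side X i k -> 0 <= s <= 1 ->
  ~ is_vertex X i (side_pt i k s) -> 0 < s < 1.
Proof.
  intros [Hi Hk] Hs Hn.
  destruct (Req_dec s 0) as [->|].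
  { exfalso; apply Hn; exists k; split; trivial; apply seg_0. }
  destruct (Req_dec s 1) as [->|]; [|lra].
  exfalso; apply Hn; exists (S k mod len i)%nat; split; [apply Nat.mod_upper_bound; lia|].
  rewrite vtx_mod; apply seg_1.
Qed.

Lemma side_pt_unique i j k s s' : valid_side X i j -> valid_side X i k -> 0 < s < 1 ->
  side_pt i j s = side_pt i k s' -> j = k /\ s = s'.
Proof.
  intros Hj Hk Hs He; pose proof (Hcyc i (proj1 Hj)) as HV.
  assert (k = j) as ->.
  { apply (open_side_unique l0 _ HV k j s); [apply Hk|apply Hj|trivial|].
    fold (side_pt i j s); rewrite He; unfold height, side_pt, edge; vring. }
  split; trivial.
  pose proof (edge_sqr_pos _ _ _ HV j) as Hp.
  assert (Hd : (s - s') * dot (edge (vtx (PG i)) j) (edge (vtx (PG i)) j) = 0).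
  { replace ((s - s') * dot (edge (vtx (PG i)) j) (edge (vtx (PG i)) j))
      with (dot (vsub (side_pt i j s) (side_pt i j s')) (edge (vtx (PG i)) j))
      by (unfold side_pt, edge; vring). rewrite He; vring. }
  apply Rmult_integral in Hd as [Hd|Hd]; lra.
Qed.

Lemma step_partner x y : ~ is_vertex X (fst x) (snd x) -> glue_step X x y -> partner x y.
Proof.
  intros Hn (k & Hk & (s & Hs & He) & H1 & H2).
  assert (Hs' : 0 < s < 1).
  { apply (side_pt_end (fst x) k); trivial. unfold side_pt; now rewrite <- He. }
  exists k, s; split; [trivial|split; [trivial|split; [trivial|]]].
  destruct y as [j q]; cbn [fst snd] in *; subst j q; f_equal.
  rewrite He; now apply (transl_seg X).
Qed.

Lemma partner_not_vertex x y : partner x y -> ~ is_vertex X (fst y) (snd y).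
Proof.
  intros (k & s & Hk & Hs & _ & ->); cbn [fst snd].
  apply open_side_not_vertex; [now apply (glue_valid X)|lra].
Qed.

Lemma partner_sym x y : partner x y -> partner y x.
Proof.
  intros (k & s & Hk & Hs & He & ->).
  pose proof (glue_glue X Hwf _ _ Hk) as Hg.
  exists (gside X (fst x) k), (1 - s); cbn [fst snd].
  split; [now apply (glue_valid X)|]; split; [lra|]; split; trivial.
  assert (E1 : gpoly X (gpoly X (fst x) k) (gside X (fst x) k) = fst x)
    by (unfold gpoly at 1; now rewrite Hg).
  assert (E2 : gside X (gpoly X (fst x) k) (gside X (fst x) k) = k)
    by (unfold gside at 1; now rewrite Hg).
  rewrite E1, E2; replace (1 - (1 - s)) with s by ring; rewrite <- He; now destruct x.
Qed.

Lemma partner_fun x y z : partner x y -> partner x z -> y = z.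
Proof.
  intros (k & s & Hk & Hs & He & ->) (k' & s' & Hk' & Hs' & He' & ->).
  rewrite He in He'; destruct (side_pt_unique _ _ _ _ _ Hk Hk' Hs He') as [<- <-]; trivial.
Qed.

Lemma partner_same_pt x y : partner x y -> same_pt X x y.
Proof.
  intros (k & s & Hk & Hs & He & ->); apply rst_step; exists k.
  repeat split; cbn [fst snd]; trivial; try apply Hk.
  - exists s; split; [lra|exact He].
  - rewrite He; symmetry; now apply (transl_seg X).
Qed.

Lemma step_partner_back x y : ~ is_vertex X (fst x) (snd x) -> glue_step X y x -> partner x y.
Proof.
  intros Hn Hst; apply partner_sym.
  apply step_partner; trivial.
  destruct Hst as (k & Hk & (s & Hs & He) & H1 & H2).
  intros Hy; apply Hn.
  rewrite H1, H2, He, (transl_seg X) by trivial.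
  pose proof (glue_valid X Hwf _ _ Hk) as Hg.
  destruct (classic (is_vertex X (gpoly X (fst y) k)
     (side_pt (gpoly X (fst y) k) (gside X (fst y) k) (1 - s)))) as [Hv|Hv]; [exact Hv|exfalso].
  pose proof (side_pt_end _ _ (1 - s) Hg ltac:(lra) Hv) as Ho.
  apply (open_side_not_vertex (fst y) k s); trivial; [lra|].
  unfold side_pt; now rewrite <- He.
Qed.

(** Away from vertices every gluing step is an instance of [partner], which is symmetric and
    single-valued; a chain of steps can only go back and forth between two copies. *)
Lemma same_pt_class x y : ~ is_vertex X (fst x) (snd x) -> same_pt X x y -> y = x \/ partner x y.
Proof.
  intros Hn H; apply clos_rst_rst1n in H.
  revert Hn; induction H as [x|x z y Hst H IH]; intros Hn; [now left|].
  assert (Hp : partner x z) by (destruct Hst; [now apply step_partner|now apply step_partner_back]).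
  destruct (IH (partner_not_vertex _ _ Hp)) as [->|Hz]; [now right|left].
  apply partner_sym in Hp; exact (partner_fun _ _ _ Hz Hp).
Qed.

Lemma same_pt_not_vertex x y : ~ is_vertex X (fst x) (snd x) -> same_pt X x y ->
  ~ is_vertex X (fst y) (snd y).
Proof.
  intros Hn H; destruct (same_pt_class _ _ Hn H) as [->|Hp]; trivial.
  now apply (partner_not_vertex x).
Qed.

Lemma not_singular_iff x : ~ singular X x <-> ~ is_vertex X (fst x) (snd x).
Proof.
  split.
  - intros Hs Hv; apply Hs; exists x; split; trivial; apply rst_refl.
  - intros Hv (y & Hy & Hvy); exact (same_pt_not_vertex _ _ Hv Hy Hvy).
Qed.

End Points.

(** * Unfolding a saddle connection *)

Definition ppoly (L : list piece) (t : nat) : nat := pc_poly (pc L t).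
Definition pA (L : list piece) (t : nat) : pt := pc_a (pc L t).
Definition pB (L : list piece) (t : nat) : pt := pc_b (pc L t).
Definition pdir (L : list piece) (t : nat) : pt := pc_dir (pc L t).
(** As all pieces are parallel, this is the ratio of the lengths of the pieces [t] and 0. *)
Definition plam (L : list piece) (t : nat) : R :=
  dot (pdir L t) (pdir L 0) / dot (pdir L 0) (pdir L 0).
Definition ppt (L : list piece) (t : nat) (s : R) : pt := seg_pt (pA L t) (pB L t) s.

(** The pieces are unfolded along one straight segment starting at [pA L 0]: the piece [t] is moved by
    [poff L t], and [ptime L t s] is the position on the segment, in units of the first piece. *)
Definition poff (L : list piece) (t : nat) : pt :=
  vsub (vadd (pA L 0) (vscale (psum (plam L) t) (pdir L 0))) (pA L t).
Definition ptime (L : list piece) (t : nat) (s : R) : R := psum (plam L) t + s * plam L t.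

Lemma sc_length_psum L : sc_length L = psum (fun t => norm (pdir L t)) (length L).
Proof.
  induction L as [|c L IH]; [reflexivity|].
  change (sc_length (c :: L)) with (norm (pc_dir c) + sc_length L).
  change (length (c :: L)) with (S (length L)); rewrite psum_shift, IH; reflexivity.
Qed.

Section Saddle.
Variables (X : surface) (l0 : R).
Hypothesis Hwf : wf_surface X.
Hypothesis HP1 : P1 X.
Hypothesis Hmin : is_min_side_length X l0.
Notation PG i := (polyg X i).
Notation len i := (length (polyg X i)).
Let Hcyc := polygon_cycle X l0 Hwf HP1 Hmin.

Variable L : list piece.
Hypothesis HL : is_saddle_connection X L.
Notation p := (length L).
Notation u := (pdir L 0).

Lemma sc_pos : (0 < p)%nat.
Proof. destruct HL as [H _]; destruct L; [congruence|simpl; lia]. Qed.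

Lemma ppoly_valid t : (t < p)%nat -> (ppoly L t < npoly X)%nat.
Proof. intros Ht; apply (proj1 (proj2 HL) t Ht). Qed.

Lemma pA_in t : (t < p)%nat -> in_poly (PG (ppoly L t)) (pA L t).
Proof. intros Ht; apply (proj1 (proj2 HL) t Ht). Qed.

Lemma pB_in t : (t < p)%nat -> in_poly (PG (ppoly L t)) (pB L t).
Proof. intros Ht; apply (proj1 (proj2 HL) t Ht). Qed.

Lemma pdir_eq t : pdir L t = vsub (pB L t) (pA L t).
Proof. reflexivity. Qed.

Lemma u_sqr_pos : 0 < dot u u.
Proof. destruct (proj1 (proj2 HL) 0%nat sc_pos) as (_ & _ & _ & _ & _ & H & _); exact H. Qed.

Lemma u_norm_pos : 0 < norm u.
Proof. apply norm_gt; [lra|]. pose proof u_sqr_pos; lra. Qed.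

Lemma plam_pos t : (t < p)%nat -> 0 < plam L t.
Proof.
  intros Ht; destruct (proj1 (proj2 HL) t Ht) as (_ & _ & _ & _ & _ & H & _).
  apply Rdiv_lt_0_compat; [exact H|apply u_sqr_pos].
Qed.

Lemma pdir_plam t : (t < p)%nat -> pdir L t = vscale (plam L t) u.
Proof.
  intros Ht; destruct (proj1 (proj2 HL) t Ht) as (_ & _ & _ & _ & Hc & _).
  pose proof u_sqr_pos as Hu.
  fold (pdir L t) (pdir L 0) in Hc.
  assert (Hs : plam L t * dot u u = dot (pdir L t) u) by (unfold plam; field; lra).
  set (d := pdir L t) in *; set (m := plam L t) in *; set (w := pdir L 0) in *.
  assert (H1 : forall a b, (a - b) * dot w w = 0 -> a = b).
  { intros a b H; apply Rmult_integral in H as [H|H]; lra. }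
  apply pt_eq; apply H1; unfold vscale; cbn [fst snd].
  - replace ((fst d - m * fst w) * dot w w) with (fst d * dot w w - (m * dot w w) * fst w) by ring.
    rewrite Hs. replace (fst d * dot w w - dot d w * fst w) with (snd w * cross d w) by vring.
    rewrite Hc; ring.
  - replace ((snd d - m * snd w) * dot w w) with (snd d * dot w w - (m * dot w w) * snd w) by ring.
    rewrite Hs. replace (snd d * dot w w - dot d w * snd w) with (- fst w * cross d w) by vring.
    rewrite Hc; ring.
Qed.

Lemma pdir_norm t : (t < p)%nat -> norm (pdir L t) = plam L t * norm u.
Proof.
  intros Ht; rewrite pdir_plam by trivial; apply norm_scale; left; now apply plam_pos.
Qed.

Lemma pdir_norm_pos t : (t < p)%nat -> 0 < norm (pdir L t).
Proof.
  intros Ht; rewrite pdir_norm by trivial; apply Rmult_lt_0_compat;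
    [now apply plam_pos|apply u_norm_pos].
Qed.

Lemma sc_length_plam : sc_length L = psum (plam L) p * norm u.
Proof.
  rewrite sc_length_psum, <- psum_scale; apply psum_ext; intros t Ht; now apply pdir_norm.
Qed.

Lemma ppt_unfold t s : (t < p)%nat ->
  vadd (ppt L t s) (poff L t) = vadd (pA L 0) (vscale (ptime L t s) u).
Proof.
  intros Ht; pose proof (pdir_plam t Ht) as Hd; rewrite pdir_eq in Hd.
  assert (Hs : ppt L t s = vadd (pA L t) (vscale s (vscale (plam L t) u)))
    by (rewrite <- Hd; unfold ppt; veq).
  rewrite Hs; unfold poff, ptime; veq.
Qed.

Definition exit_spec (t : nat) (k : nat) (s : R) : Prop :=
  valid_side X (ppoly L t) k /\ 0 < s < 1 /\ pB L t = side_pt X (ppoly L t) k s /\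
  ppoly L (S t) = gpoly X (ppoly L t) k /\
  pA L (S t) = side_pt X (gpoly X (ppoly L t) k) (gside X (ppoly L t) k) (1 - s).

Lemma exit_exists t : (S t < p)%nat -> exists k s, exit_spec t k s.
Proof.
  intros Ht; destruct HL as (_ & _ & _ & _ & Htr).
  destruct (Htr t Ht) as (k & Hk & (s & Hs & He) & H1 & H2).
  exists k, s; repeat split; trivial; try apply Hk; try lra.
  unfold pA; rewrite H2, He; now apply (transl_seg X).
Qed.

Lemma exit_off t k s : (S t < p)%nat -> exit_spec t k s ->
  poff L (S t) = vsub (poff L t) (transl X (ppoly L t) k).
Proof.
  intros Ht (Hk & Hs & HB & HP & HA).
  pose proof (transl_seg X Hwf (ppoly L t) k s Hk) as Htr.
  fold (side_pt X (ppoly L t) k s) in Htr; rewrite <- HB in Htr.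
  fold (side_pt X (gpoly X (ppoly L t) k) (gside X (ppoly L t) k) (1 - s)) in Htr.
  rewrite <- HA in Htr.
  pose proof (pdir_plam t ltac:(lia)) as Hd; rewrite pdir_eq in Hd.
  assert (E1 := f_equal fst Hd); assert (E2 := f_equal snd Hd).
  assert (E3 := f_equal fst Htr); assert (E4 := f_equal snd Htr).
  unfold poff; cbn [psum]; apply pt_eq; vunf; lra.
Qed.

Lemma exit_same_pt t : (S t < p)%nat -> same_pt X (ppoly L t, pB L t) (ppoly L (S t), pA L (S t)).
Proof.
  intros Ht; destruct (exit_exists t Ht) as (k & s & Hk & Hs & HB & HP & HA).
  apply (partner_same_pt X Hwf); exists k, s; cbn [fst snd].
  split; [trivial|split; [trivial|split; [trivial|]]]. rewrite HP, HA; reflexivity.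
Qed.

(** Times increase strictly along the pieces, so two different pieces share a time only at the
    common end of consecutive ones. *)
Lemma ptime_same_pt t t' s s' : (t < p)%nat -> (t' < p)%nat -> 0 <= s <= 1 -> 0 <= s' <= 1 ->
  ptime L t s = ptime L t' s' -> same_pt X (ppoly L t, ppt L t s) (ppoly L t', ppt L t' s').
Proof.
  assert (Hgen : forall t t' s s', (t <= t')%nat -> (t' < p)%nat -> 0 <= s <= 1 -> 0 <= s' <= 1 ->
     ptime L t s = ptime L t' s' -> same_pt X (ppoly L t, ppt L t s) (ppoly L t', ppt L t' s')).
  { clear t t' s s'; intros t t' s s' Hle Ht' Hs Hs' He.
    pose proof (plam_pos t ltac:(lia)) as Hl; pose proof (plam_pos t' ltac:(lia)) as Hl'.
    unfold ptime in He.
    destruct (Nat.eq_dec t t') as [->|Hne].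
    - assert (s = s') as -> by nra; apply rst_refl.
    - assert (Hlt : psum (plam L) t + s * plam L t <= psum (plam L) (S t)) by (simpl; nra).
      destruct (Nat.eq_dec (S t) t') as [Est|Hne2].
      + subst t'.
        assert (s = 1) as -> by (simpl in He; nra). assert (s' = 0) as -> by (simpl in He; nra).
        unfold ppt; rewrite seg_0, seg_1; apply exit_same_pt; lia.
      + pose proof (psum_mono (plam L) p plam_pos (S t) t' ltac:(lia) ltac:(lia)).
        assert (0 <= s' * plam L t') by (apply Rmult_le_pos; lra). lra. }
  intros Ht Ht' Hs Hs' He; destruct (le_lt_dec t t').
  - now apply Hgen.
  - apply rst_sym, Hgen; trivial; [lia|now symmetry].
Qed.

Lemma start_vertex : exists a, (a < len (ppoly L 0))%nat /\ pA L 0 = vtx (PG (ppoly L 0)) a.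
Proof. destruct HL as (_ & _ & H & _); exact H. Qed.

Lemma end_vertex : exists b, (b < len (ppoly L (p - 1)))%nat /\
  pB L (p - 1) = vtx (PG (ppoly L (p - 1))) b.
Proof. destruct HL as (_ & _ & _ & H & _); exact H. Qed.

Lemma interior_not_vertex t s : (t < p)%nat -> 0 < s < 1 -> ~ is_vertex X (ppoly L t) (ppt L t s).
Proof. intros Ht Hs; destruct (proj1 (proj2 HL) t Ht) as (_ & _ & _ & _ & _ & _ & H); now apply H. Qed.

Lemma ppt_in_poly t s : (t < p)%nat -> 0 <= s <= 1 -> in_poly (PG (ppoly L t)) (ppt L t s).
Proof.
  intros Ht Hs k Hk; apply Rle_ge; change (0 <= height (PG (ppoly L t)) k (ppt L t s)).
  unfold ppt; rewrite height_seg.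
  pose proof (in_poly_height l0 _ (Hcyc _ (ppoly_valid t Ht)) _ (pA_in t Ht) k).
  pose proof (in_poly_height l0 _ (Hcyc _ (ppoly_valid t Ht)) _ (pB_in t Ht) k).
  assert (0 <= (1 - s) * height (PG (ppoly L t)) k (pA L t)) by (apply Rmult_le_pos; lra).
  assert (0 <= s * height (PG (ppoly L t)) k (pB L t)) by (apply Rmult_le_pos; lra). lra.
Qed.

Definition side_piece (t : nat) : Prop := exists k, (k < len (ppoly L t))%nat /\
  height (PG (ppoly L t)) k (pA L t) = 0 /\ height (PG (ppoly L t)) k (pB L t) = 0.

(** The exit point is inside side [k] and lies on no other side, so the piece runs along [k]; the
    next piece starts on the glued copy and is parallel to it. *)
Lemma side_piece_next t k s : (S t < p)%nat -> exit_spec t k s -> side_piece t ->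
  height (PG (ppoly L t)) k (pA L t) = 0 /\ height (PG (ppoly L t)) k (pB L t) = 0 /\
  height (PG (ppoly L (S t))) (gside X (ppoly L t) k) (pA L (S t)) = 0 /\
  height (PG (ppoly L (S t))) (gside X (ppoly L t) k) (pB L (S t)) = 0.
Proof.
  intros Ht (Hk & Hs & HB & HP & HA) (k' & Hk' & HA' & HB').
  assert (k' = k) as ->.
  { rewrite HB in HB'; apply (open_side_unique l0 _ (Hcyc _ (proj1 Hk)) k' k s); trivial; apply Hk. }
  split; [trivial|split; [trivial|]]. rewrite HP.
  assert (H0 : height (PG (gpoly X (ppoly L t) k)) (gside X (ppoly L t) k) (pA L (S t)) = 0)
    by (rewrite HA; unfold height, side_pt, edge; vring).
  split; trivial.
  pose proof (glue_edge X Hwf _ _ Hk) as He.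
  pose proof (pdir_plam t ltac:(lia)) as Hd; pose proof (pdir_plam (S t) Ht) as Hd'.
  pose proof (plam_pos t ltac:(lia)) as Hl.
  assert (Hu : cross (edge (vtx (PG (ppoly L t))) k) u = 0).
  { assert (Hc : plam L t * cross (edge (vtx (PG (ppoly L t))) k) u = 0).
    { replace (plam L t * cross (edge (vtx (PG (ppoly L t))) k) u)
        with (cross (edge (vtx (PG (ppoly L t))) k) (vscale (plam L t) u)) by vring.
      rewrite <- Hd, pdir_eq; unfold height in HA', HB'; vunf; lra. }
    apply Rmult_integral in Hc as [Hc|Hc]; lra. }
  unfold height in *; rewrite He in *.
  assert (Hb : pB L (S t) = vadd (pA L (S t)) (vscale (plam L (S t)) u))
    by (rewrite <- Hd', pdir_eq; veq).
  rewrite Hb.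
  replace (cross (vscale (-1) (edge (vtx (PG (ppoly L t))) k))
     (vsub (vadd (pA L (S t)) (vscale (plam L (S t)) u)) (vtx (PG (gpoly X (ppoly L t) k)) (gside X (ppoly L t) k))))
   with (cross (vscale (-1) (edge (vtx (PG (ppoly L t))) k))
     (vsub (pA L (S t)) (vtx (PG (gpoly X (ppoly L t) k)) (gside X (ppoly L t) k)))
     - plam L (S t) * cross (edge (vtx (PG (ppoly L t))) k) u) by vring.
  rewrite H0, Hu; ring.
Qed.

Lemma side_piece_prev t k s : (S t < p)%nat -> exit_spec t k s -> side_piece (S t) -> side_piece t.
Proof.
  intros Ht (Hk & Hs & HB & HP & HA) (k' & Hk' & HA' & HB').
  pose proof (glue_valid X Hwf _ _ Hk) as Hg.
  rewrite HP in *.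
  assert (k' = gside X (ppoly L t) k) as ->.
  { rewrite HA in HA'; apply (open_side_unique l0 _ (Hcyc _ (proj1 Hg)) k' _ (1 - s)); trivial;
      [apply Hg|lra]. }
  exists k; split; [apply Hk|].
  assert (H0 : height (PG (ppoly L t)) k (pB L t) = 0)
    by (rewrite HB; unfold height, side_pt, edge; vring).
  split; trivial.
  pose proof (glue_edge X Hwf _ _ Hk) as He.
  pose proof (pdir_plam t ltac:(lia)) as Hd; pose proof (pdir_plam (S t) Ht) as Hd'.
  pose proof (plam_pos (S t) ltac:(lia)) as Hl.
  unfold height in *; rewrite He in *.
  assert (Hu : cross (edge (vtx (PG (ppoly L t))) k) u = 0).
  { assert (Hc : plam L (S t) * cross (edge (vtx (PG (ppoly L t))) k) u = 0).
    { replace (plam L (S t) * cross (edge (vtx (PG (ppoly L t))) k) u)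
        with (cross (edge (vtx (PG (ppoly L t))) k) (vscale (plam L (S t)) u)) by vring.
      rewrite <- Hd', pdir_eq; vunf; lra. }
    apply Rmult_integral in Hc as [Hc|Hc]; lra. }
  assert (Hb : pA L t = vsub (pB L t) (vscale (plam L t) u))
    by (rewrite <- Hd, pdir_eq; veq).
  rewrite Hb.
  replace (cross (edge (vtx (PG (ppoly L t))) k) (vsub (vsub (pB L t) (vscale (plam L t) u)) (vtx (PG (ppoly L t)) k)))
   with (cross (edge (vtx (PG (ppoly L t))) k) (vsub (pB L t) (vtx (PG (ppoly L t)) k))
     - plam L t * cross (edge (vtx (PG (ppoly L t))) k) u) by vring.
  rewrite H0, Hu; ring.
Qed.

Definition nonside : Prop := forall t, (t < p)%nat -> ~ side_piece t.

Lemma side_or_nonside : side_piece 0 \/ nonside.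
Proof.
  destruct (classic (side_piece 0)) as [|Hn]; [now left|right].
  intros t; induction t as [|t IH]; intros Ht; trivial.
  intros Hsp; destruct (exit_exists t Ht) as (k & s & He).
  apply (IH ltac:(lia)); now apply (side_piece_prev t k s).
Qed.

End Saddle.

(** * Saddle connections along a side *)

Section SideConnection.
Variables (X : surface) (l0 : R).
Hypothesis Hwf : wf_surface X.
Hypothesis HP1 : P1 X.
Hypothesis Hmin : is_min_side_length X l0.
Notation PG i := (polyg X i).
Notation len i := (length (polyg X i)).
Let Hcyc := polygon_cycle X l0 Hwf HP1 Hmin.

(** [is_side] describes only a set of points; the length, which is computed from the pieces, has to
    be recorded beside it. *)
Definition covers_side (L : list piece) (i k : nat) : Prop := valid_side X i k /\
  sc_length L = norm (side_vec (PG i) k) /\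
  forall x, sc_mem X L x <-> exists s, 0 <= s <= 1 /\ same_pt X x (i, side_pt X i k s).

Lemma glued_side_same_pt i k s : valid_side X i k -> 0 <= s <= 1 ->
  same_pt X (i, side_pt X i k s) (gpoly X i k, side_pt X (gpoly X i k) (gside X i k) (1 - s)).
Proof.
  intros Hk Hs; apply rst_step; exists k; cbn [fst snd].
  split; [trivial|split; [exists s; split; trivial|split; trivial]].
  symmetry; now apply (transl_seg X).
Qed.

Variable L : list piece.
Hypothesis HL : is_saddle_connection X L.
Notation p := (length L).
Notation u := (pdir L 0).

(** A connection along a side may pass any number of times to the other copy of the side. Unfolded,
    all its pieces lie on side [k] of the first polygon, and since it starts and ends at different
    vertices of that side, it covers it. *)
Lemma side_connection : side_piece X L 0 -> exists k, covers_side L (ppoly L 0) k.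
Proof.
  intros (k & Hk & HA0 & HB0).
  set (i := ppoly L 0) in *; set (j := gpoly X i k); set (m := gside X i k).
  pose proof (sc_pos X L HL) as Hp.
  pose proof (ppoly_valid X L HL 0 Hp) as Hi.
  assert (Hv : valid_side X i k) by (split; trivial).
  assert (Hvm : valid_side X j m) by (now apply (glue_valid X)).
  assert (Hgg : glue X j m = (i, k)) by (now apply (glue_glue X)).
  (* Invariant: the piece lies on side [k] and is not displaced, or it lies on the glued copy and is
     displaced by the inverse gluing. *)
  assert (Hst : forall t, (t < p)%nat ->
    (ppoly L t = i /\ poff L t = (0, 0) /\ height (PG i) k (pA L t) = 0 /\ height (PG i) k (pB L t) = 0)
    \/ (ppoly L t = j /\ poff L t = vscale (-1) (transl X i k) /\
        height (PG j) m (pA L t) = 0 /\ height (PG j) m (pB L t) = 0)).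
  { induction t as [|t IH]; intros Ht.
    - left; repeat split; trivial. unfold poff; cbn [psum]; veq.
    - destruct (exit_exists X Hwf L HL t Ht) as (k' & s & Hex).
      pose proof (exit_off X Hwf L HL t k' s Ht Hex) as Hoff.
      pose proof Hex as (Hk' & Hs & HB & HPS & HA).
      destruct (IH ltac:(lia)) as [(E1 & E2 & E3 & E4)|(E1 & E2 & E3 & E4)].
      + right.
        assert (Hsp : side_piece X L t) by (exists k; rewrite E1; repeat split; trivial).
        pose proof (side_piece_next X l0 Hwf HP1 Hmin L HL t k' s Ht Hex Hsp) as (_ & _ & N3 & N4).
        rewrite E1 in *.
        assert (k' = k) as ->.
        { symmetry; apply (open_side_unique l0 _ (Hcyc _ Hi) k k' s); trivial; [apply Hk'|].
          now rewrite HB in E4. }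
        rewrite HPS in *; repeat split; trivial.
        rewrite Hoff, E2; veq.
      + left.
        assert (Hsp : side_piece X L t) by (exists m; rewrite E1; repeat split; trivial; apply Hvm).
        pose proof (side_piece_next X l0 Hwf HP1 Hmin L HL t k' s Ht Hex Hsp) as (_ & _ & N3 & N4).
        rewrite E1 in *.
        assert (k' = m) as ->.
        { symmetry; apply (open_side_unique l0 _ (Hcyc _ (proj1 Hvm)) m k' s); trivial;
            [apply Hvm|apply Hk'|]. now rewrite HB in E4. }
        assert (Eg : gpoly X j m = i) by (unfold gpoly; now rewrite Hgg).
        assert (Es : gside X j m = k) by (unfold gside; now rewrite Hgg).
        rewrite Eg in HPS; rewrite Es, HPS in *; repeat split; trivial.
        rewrite Hoff, E2; unfold j, m; rewrite (transl_glue X Hwf _ _ Hv); veq. }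
  assert (Hends : forall a, (a < len i)%nat -> height (PG i) k (vtx (PG i) a) = 0 ->
     vtx (PG i) a = vtx (PG i) k \/ vtx (PG i) a = vtx (PG i) (S k)).
  { intros a Ha Hz; destruct (height_vertex_zero l0 _ (Hcyc _ Hi) a k Ha Hk Hz) as [->| ->];
      [now left|right; apply vtx_mod]. }
  assert (Hstart : pA L 0 = vtx (PG i) k \/ pA L 0 = vtx (PG i) (S k)).
  { destruct (start_vertex X L HL) as (a & Ha & HaE).
    rewrite HaE in *; now apply Hends. }
  set (Lam := psum (plam L) p).
  assert (Hend : vadd (pA L 0) (vscale Lam u) = vtx (PG i) k \/
                 vadd (pA L 0) (vscale Lam u) = vtx (PG i) (S k)).
  { destruct (end_vertex X L HL) as (b & Hb & HbE).
    assert (Hun : vadd (pB L (p - 1)) (poff L (p - 1)) = vadd (pA L 0) (vscale Lam u)).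
    { pose proof (ppt_unfold X L HL (p - 1) 1 ltac:(lia)) as Hu.
      unfold ppt in Hu; rewrite seg_1 in Hu; rewrite Hu; unfold ptime, Lam.
      replace p with (S (p - 1)) at 3 by lia; cbn [psum]; veq. }
    rewrite <- Hun.
    destruct (Hst (p - 1)%nat ltac:(lia)) as [(E1 & E2 & E3 & E4)|(E1 & E2 & E3 & E4)];
      rewrite E1 in *; rewrite E2, HbE in *.
    - replace (vadd (vtx (PG i) b) (0, 0)) with (vtx (PG i) b) by veq; now apply Hends.
    - assert (Hq : forall q s, q = side_pt X j m s -> vadd q (vscale (-1) (transl X i k)) = side_pt X i k (1 - s)).
      { intros q s ->.
        pose proof (transl_seg X Hwf i k (1 - s) Hv) as Ht; fold j m in Ht.
        replace (1 - (1 - s)) with s in Ht by ring; fold (side_pt X j m s) (side_pt X i k (1 - s)) in Ht.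
        rewrite <- Ht; veq. }
      destruct (height_vertex_zero l0 _ (Hcyc _ (proj1 Hvm)) b m Hb (proj2 Hvm) E4) as [->| ->].
      + right; rewrite (Hq _ 0) by (unfold side_pt; now rewrite seg_0).
        replace (1 - 0) with 1 by ring; apply seg_1.
      + left; rewrite (Hq _ 1) by (unfold side_pt; now rewrite seg_1, vtx_mod).
        replace (1 - 1) with 0 by ring; apply seg_0. }
  assert (HLam : 0 < Lam).
  { apply (psum_mono (plam L) p (plam_pos X L HL) 0 p); lia. }
  assert (Hu0 := u_sqr_pos X L HL).
  (* Both ends of the unfolded segment are ends of the side, and they differ because the segment has
     positive length: it is the side, in one of two directions. *)
  assert (Hdir : (pA L 0 = vtx (PG i) k /\ vscale Lam u = edge (vtx (PG i)) k) \/
                 (pA L 0 = vtx (PG i) (S k) /\ vscale Lam u = vscale (-1) (edge (vtx (PG i)) k))).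
  { assert (Hne : vadd (pA L 0) (vscale Lam u) <> pA L 0).
    { intros He.
      assert (Hz : Lam * dot u u = 0).
      { replace (Lam * dot u u) with (dot (vsub (vadd (pA L 0) (vscale Lam u)) (pA L 0)) u) by vring.
        rewrite He; vring. }
      apply Rmult_integral in Hz as [Hz|Hz]; lra. }
    assert (Hw : vscale Lam u = vsub (vadd (pA L 0) (vscale Lam u)) (pA L 0)) by veq.
    destruct Hstart as [S1|S1], Hend as [S2|S2].
    - congruence.
    - left; split; trivial; rewrite Hw, S2, S1; reflexivity.
    - right; split; trivial; rewrite Hw, S2, S1; unfold edge; veq.
    - congruence. }
  exists k; split; [trivial|split].
  - rewrite (sc_length_plam X L HL); fold Lam.
    rewrite <- norm_scale by lra.
    change (side_vec (PG i) k) with (edge (vtx (PG i)) k).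
    destruct Hdir as [[_ ->]|[_ ->]]; trivial; unfold norm; f_equal; vring.
  - assert (Hdev : forall t s, (t < p)%nat -> 0 <= s <= 1 -> exists q, q = vadd (pA L 0) (vscale (ptime L t s) u) /\
        (exists s', 0 <= s' <= 1 /\ q = side_pt X i k s') /\ same_pt X (i, q) (ppoly L t, ppt L t s)).
    { intros t s Ht Hs; exists (vadd (pA L 0) (vscale (ptime L t s) u)); split; trivial.
      assert (Hon : exists s', 0 <= s' <= 1 /\ vadd (pA L 0) (vscale (ptime L t s) u) = side_pt X i k s').
      { assert (Hpt : 0 <= ptime L t s <= Lam).
        { pose proof (plam_pos X L HL t Ht) as Hl.
          assert (H0 : 0 <= psum (plam L) t).
          { destruct t; [simpl; lra|left; apply (psum_mono (plam L) p (plam_pos X L HL) 0 (S t)); lia]. }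
          assert (H1 : psum (plam L) (S t) <= Lam).
          { destruct (Nat.eq_dec (S t) p) as [E|]; [unfold Lam; rewrite E; lra|].
            left; apply (psum_mono (plam L) p (plam_pos X L HL) (S t) p); lia. }
          cbn [psum] in H1; unfold ptime; nra. }
        set (sg := ptime L t s) in *.
        assert (Hr : 0 <= sg / Lam <= 1).
        { assert (sg / Lam * Lam = sg) by (field; lra). split; apply Rmult_le_reg_r with Lam; lra. }
        assert (Hsg : vscale sg u = vscale (sg / Lam) (vscale Lam u)).
        { unfold vscale; cbn [fst snd]; f_equal; field; lra. }
        destruct Hdir as [[Ha Hd]|[Ha Hd]]; rewrite Hsg, Hd, Ha.
        - exists (sg / Lam); split; trivial; unfold side_pt, edge; veq.
        - exists (1 - sg / Lam); split; [lra|]; unfold side_pt, edge; veq. }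
      split; trivial.
      pose proof (ppt_unfold X L HL t s Ht) as Hu; rewrite <- Hu in Hon |- *.
      destruct (Hst t Ht) as [(E1 & E2 & _)|(E1 & E2 & _)]; rewrite E1, E2 in *.
      - replace (vadd (ppt L t s) (0, 0)) with (ppt L t s) by veq; apply rst_refl.
      - destruct Hon as (s' & Hs' & Hq); rewrite Hq.
        pose proof (transl_seg X Hwf i k s' Hv) as Htr.
        fold (side_pt X i k s') in Htr; rewrite <- Hq in Htr.
        replace (vadd (vadd (ppt L t s) (vscale (-1) (transl X i k))) (transl X i k))
          with (ppt L t s) in Htr by veq.
        rewrite Htr; now apply glued_side_same_pt. }
    intros x; split.
    + intros (t & s & Ht & Hs & Hx).
      destruct (Hdev t s Ht Hs) as (q & _ & (s' & Hs' & Hq) & Hsame).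
      exists s'; split; trivial; rewrite <- Hq.
      eapply rst_trans; [exact Hx|apply rst_sym; exact Hsame].
    + intros (s & Hs & Hx).
      assert (Hsg : exists sg, 0 <= sg <= Lam /\ side_pt X i k s = vadd (pA L 0) (vscale sg u)).
      { assert (Hb : forall r, 0 <= r <= 1 -> 0 <= r * Lam <= Lam) by (intros; nra).
        destruct Hdir as [[Ha Hd]|[Ha Hd]].
        - exists (s * Lam); split; [now apply Hb|].
          replace (vscale (s * Lam) u) with (vscale s (vscale Lam u)) by veq.
          rewrite Hd, Ha; unfold side_pt, edge; veq.
        - exists ((1 - s) * Lam); split; [apply Hb; lra|].
          replace (vscale ((1 - s) * Lam) u) with (vscale (1 - s) (vscale Lam u)) by veq.
          rewrite Hd, Ha; unfold side_pt, edge; veq. }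
      destruct Hsg as (sg & Hsg & Hq).
      destruct (psum_locate (plam L) p (plam_pos X L HL) Hp sg Hsg) as (t & s' & Ht & Hs' & Hloc).
      exists t, s'; split; [trivial|split; [trivial|]].
      destruct (Hdev t s' Ht Hs') as (q & Hq' & _ & Hsame).
      unfold ptime in Hq'; rewrite <- Hloc, <- Hq in Hq'; subst q.
      eapply rst_trans; [exact Hx|exact Hsame].
Qed.

End SideConnection.

Section TwoSides.
Variables (X : surface) (l0 : R).
Hypothesis Hwf : wf_surface X.
Hypothesis HP1 : P1 X.
Hypothesis Hmin : is_min_side_length X l0.

(** A nonsingular common point is inside both sides; as it has at most two copies, the sides
    coincide or are glued to each other. *)
Lemma covers_side_eq L1 L2 i k j m : covers_side X L1 i k -> covers_side X L2 j m ->
  (exists x, sc_mem X L1 x /\ sc_mem X L2 x /\ ~ singular X x) -> sc_eq X L1 L2.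
Proof.
  intros (Hk & _ & H1) (Hm & _ & H2) (x & Hx1 & Hx2 & Hns) y.
  apply H1 in Hx1 as (s & Hs & E1); apply H2 in Hx2 as (s' & Hs' & E2).
  assert (Hsame : same_pt X (i, side_pt X i k s) (j, side_pt X j m s'))
    by (eapply rst_trans; [apply rst_sym; exact E1|exact E2]).
  assert (Hnv : ~ is_vertex X i (side_pt X i k s)).
  { intros Hv; apply Hns; exists (i, side_pt X i k s); split; [exact E1|exact Hv]. }
  pose proof (side_pt_end X i k s Hk Hs Hnv) as Ho.
  rewrite H1, H2.
  destruct (same_pt_class X l0 Hwf HP1 Hmin (i, side_pt X i k s) _ Hnv Hsame) as [He|Hp].
  - assert (Ej := f_equal fst He); apply (f_equal snd) in He; cbn [fst snd] in Ej, He; subst j; symmetry in He.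
    destruct (side_pt_unique X l0 Hwf HP1 Hmin i k m s s' Hk Hm Ho He) as [-> _]; reflexivity.
  - destruct Hp as (k' & s2 & Hk' & Hs2 & He & Hq); cbn [fst snd] in *.
    destruct (side_pt_unique X l0 Hwf HP1 Hmin i k k' s s2 Hk Hk' Ho He) as [<- <-].
    assert (Ej := f_equal fst Hq); apply (f_equal snd) in Hq; cbn [fst snd] in Ej, Hq; subst j; symmetry in Hq.
    pose proof (glue_valid X Hwf i k Hk) as Hg.
    destruct (side_pt_unique X l0 Hwf HP1 Hmin _ _ m (1 - s) s' Hg Hm ltac:(lra) Hq) as [<- _].
    split; intros (r & Hr & Hy).
    + exists (1 - r); split; [lra|].
      eapply rst_trans; [exact Hy|now apply (glued_side_same_pt X Hwf)].
    + exists (1 - r); split; [lra|].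
      eapply rst_trans; [exact Hy|].
      apply rst_sym; replace r with (1 - (1 - r)) at 2 by ring.
      apply (glued_side_same_pt X Hwf); trivial; lra.
Qed.

End TwoSides.

(** * Corner pieces *)

Section PolygonDistances.
Variables (l : R) (P : polygon).
Notation n := (length P).
Notation V := (vtx P).
Hypothesis HV : obtuse_cycle n l V.

Lemma index_offset j k : (j < n)%nat -> (k < n)%nat ->
  exists d, (d < n)%nat /\ k = ((j + d) mod n)%nat.
Proof.
  intros Hj Hk; destruct (le_lt_dec j k).
  - exists (k - j)%nat; split; [lia|].
    replace (j + (k - j))%nat with k by lia; symmetry; now apply Nat.mod_small.
  - exists (k + n - j)%nat; split; [lia|].
    replace (j + (k + n - j))%nat with (k + 1 * n)%nat by lia.
    rewrite Nat.Div0.mod_add; symmetry; now apply Nat.mod_small.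
Qed.

Lemma vtx_mod_S m : V (S (m mod n)) = V (S m).
Proof.
  apply vtx_congr; rewrite <- (Nat.add_1_r (m mod n)), <- (Nat.add_1_r m).
  apply Nat.Div0.add_mod_idemp_l.
Qed.

Lemma vertex_vertex_far a b : (a < n)%nat -> (b < n)%nat -> a <> b ->
  b <> (S a mod n)%nat -> a <> (S b mod n)%nat -> l < norm (vsub (V b) (V a)).
Proof.
  intros Ha Hb H1 H2 H3; destruct (index_offset a b Ha Hb) as (d & Hd & ->).
  rewrite vtx_mod.
  apply (diagonal_far _ _ _ HV).
  - destruct d as [|[|d]]; [| |lia]; exfalso.
    + apply H1; rewrite Nat.add_0_r; symmetry; now apply Nat.mod_small.
    + apply H2; f_equal; lia.
  - destruct (le_lt_dec (d + 2) n); trivial; exfalso; apply H3.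
    rewrite <- (Nat.add_1_r ((a + d) mod n)), Nat.Div0.add_mod_idemp_l.
    replace (a + d + 1)%nat with (a + 1 * n)%nat by lia.
    rewrite Nat.Div0.mod_add; symmetry; now apply Nat.mod_small.
Qed.

Lemma side_side_far j k s s' : (j < n)%nat -> (k < n)%nat -> j <> k ->
  k <> (S j mod n)%nat -> j <> (S k mod n)%nat -> 0 <= s <= 1 -> 0 <= s' <= 1 ->
  l <= norm (vsub (seg_pt (V k) (V (S k)) s') (seg_pt (V j) (V (S j)) s)).
Proof.
  intros Ha Hb H1 H2 H3 Hs Hs'; destruct (index_offset j k Ha Hb) as (d & Hd & ->).
  rewrite vtx_mod, vtx_mod_S.
  apply (chord_far _ _ _ HV); trivial.
  - destruct d as [|[|d]]; [| |lia]; exfalso.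
    + apply H1; rewrite Nat.add_0_r; symmetry; now apply Nat.mod_small.
    + apply H2; f_equal; lia.
  - destruct (le_lt_dec (d + 2) n); trivial; exfalso; apply H3.
    rewrite <- (Nat.add_1_r ((j + d) mod n)), Nat.Div0.add_mod_idemp_l.
    replace (j + d + 1)%nat with (j + 1 * n)%nat by lia.
    rewrite Nat.Div0.mod_add; symmetry; now apply Nat.mod_small.
Qed.

Lemma vertex_side_far a k s : (a < n)%nat -> (k < n)%nat -> a <> k -> a <> (S k mod n)%nat ->
  0 < s < 1 -> let w := vsub (seg_pt (V k) (V (S k)) s) (V a) in
  l <= norm w /\ (strictly_obtuse_cycle V -> l < norm w).
Proof.
  intros Ha Hk H1 H2 Hs; destruct (index_offset a k Ha Hk) as (d & Hd & ->).
  pose proof (four_sides _ _ _ HV); rewrite vtx_mod, vtx_mod_S.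
  assert (Hd0 : d <> 0%nat).
  { intros ->; apply H1; rewrite Nat.add_0_r; symmetry; now apply Nat.mod_small. }
  assert (Hdn : (d + 2 <= n)%nat).
  { destruct (le_lt_dec (d + 2) n); trivial; exfalso; apply H2.
    rewrite <- (Nat.add_1_r ((a + d) mod n)), Nat.Div0.add_mod_idemp_l.
    replace (a + d + 1)%nat with (a + 1 * n)%nat by lia.
    rewrite Nat.Div0.mod_add; symmetry; now apply Nat.mod_small. }
  (* Side [a + 1] is adjacent to side [a], so the vertex [a] is taken here as the far end of side
     [a - 1], two sides away. *)
  destruct (Nat.eq_dec d 1) as [->|Hd1].
  - pose proof (chord_far _ _ _ HV (a + (n - 1)) 2 1 s ltac:(lia) ltac:(lia) ltac:(lra) ltac:(lra)) as H0.
    rewrite seg_1 in H0.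
    replace (S (a + (n - 1))) with (a + n)%nat in H0 by lia.
    replace (a + (n - 1) + 2)%nat with ((a + 1) + n)%nat in H0 by lia.
    rewrite (seg_period _ _ _ HV), (oc_period _ _ _ HV) in H0.
    destruct H0 as [HA HB]; split; trivial; intros Ho; apply HB; trivial; lra.
  - pose proof (chord_far _ _ _ HV a d 0 s ltac:(lia) ltac:(lia) ltac:(lra) ltac:(lra)) as H0.
    rewrite seg_0 in H0.
    destruct H0 as [HA HB]; split; trivial; intros Ho; apply HB; trivial; lra.
Qed.

End PolygonDistances.

(** The side and the parameter at which piece [t] leaves its polygon, chosen as total functions;
    they are meaningful only for [S t < length L]. The entry data [kin] and [sin_] are the glued
    image of the exit of piece [t - 1], so they need [0 < t]. *)
Definition exit_data (X : surface) (L : list piece) (t : nat) : nat * R :=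
  epsilon (inhabits (0%nat, 0)) (fun ks => exit_spec X L t (fst ks) (snd ks)).
Definition kout X L t := fst (exit_data X L t).
Definition sout X L t := snd (exit_data X L t).
Definition kin X L t := gside X (ppoly L (t - 1)) (kout X L (t - 1)).
Definition sin_ X L t := 1 - sout X L (t - 1).

(** A corner piece joins two adjacent sides; [cornerA] turns around the common vertex so that this
    vertex is on the left, [cornerB] so that it is on the right. *)
Definition cornerA X L t :=
  (S (kin X L t) mod length (polyg X (ppoly L t)) = kout X L t)%nat.
Definition cornerB X L t :=
  (S (kout X L t) mod length (polyg X (ppoly L t)) = kin X L t)%nat.
Definition corner (X : surface) (L : list piece) (t : nat) : bool :=
  ((1 <=? t)%nat && (S t <? length L)%nat &&
   ((S (kin X L t) mod length (polyg X (ppoly L t)) =? kout X L t)%nat ||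
    (S (kout X L t) mod length (polyg X (ppoly L t)) =? kin X L t)%nat))%bool.

Lemma corner_spec X L t : corner X L t = true <->
  (0 < t)%nat /\ (S t < length L)%nat /\ (cornerA X L t \/ cornerB X L t).
Proof.
  unfold corner, cornerA, cornerB.
  rewrite !Bool.andb_true_iff, Bool.orb_true_iff, Nat.leb_le, Nat.ltb_lt, !Nat.eqb_eq.
  split; [intros ((H1 & H2) & H3)|intros (H1 & H2 & H3)]; repeat split; trivial; lia.
Qed.

(** * Lengths of the pieces of a connection that does not run along a side *)

Section Nonside.
Variables (X : surface) (l0 : R).
Hypothesis Hwf : wf_surface X.
Hypothesis HP1 : P1 X.
Hypothesis HP2 : P2 X.
Hypothesis Hmin : is_min_side_length X l0.
Notation PG i := (polyg X i).
Notation len i := (length (polyg X i)).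
Let Hcyc := polygon_cycle X l0 Hwf HP1 Hmin.

Variable L : list piece.
Hypothesis HL : is_saddle_connection X L.
Hypothesis Hns : nonside X L.
Notation p := (length L).
Notation PP t := (ppoly L t).
Notation E t k := (edge (vtx (PG (PP t))) k).

Lemma exit_kout t : (S t < p)%nat -> exit_spec X L t (kout X L t) (sout X L t).
Proof.
  intros Ht; unfold kout, sout, exit_data.
  apply epsilon_spec with (P := fun ks => exit_spec X L t (fst ks) (snd ks)).
  destruct (exit_exists X Hwf L HL t Ht) as (k & s & H); now exists (k, s).
Qed.

Lemma exit_unique t k s : (S t < p)%nat -> valid_side X (PP t) k -> pB L t = side_pt X (PP t) k s ->
  k = kout X L t /\ s = sout X L t.
Proof.
  intros Ht Hk He; destruct (exit_kout t Ht) as (Hk' & Hs' & HB & _).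
  rewrite HB in He.
  destruct (side_pt_unique X l0 Hwf HP1 Hmin _ _ _ _ _ Hk' Hk Hs' He); now split.
Qed.

Lemma entry_kin t : (0 < t)%nat -> (t < p)%nat -> valid_side X (PP t) (kin X L t) /\
  0 < sin_ X L t < 1 /\ pA L t = side_pt X (PP t) (kin X L t) (sin_ X L t).
Proof.
  intros H0 Ht; destruct t as [|t]; [lia|].
  destruct (exit_kout t Ht) as (Hk & Hs & HB & HP & HA).
  unfold kin, sin_; replace (S t - 1)%nat with t by lia.
  rewrite HP; split; [now apply (glue_valid X)|split; [lra|trivial]].
Qed.

Lemma entry_edge t : (S t < p)%nat -> E (S t) (kin X L (S t)) = vscale (-1) (E t (kout X L t)).
Proof.
  intros Ht; destruct (exit_kout t Ht) as (Hk & Hs & HB & HP & HA).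
  unfold kin; replace (S t - 1)%nat with t by lia; rewrite HP.
  now apply (glue_edge X).
Qed.

Lemma next_polygon t : (S t < p)%nat -> PP (S t) <> PP t.
Proof.
  intros Ht; destruct (exit_kout t Ht) as (Hk & Hs & HB & HP & HA).
  rewrite HP; now apply HP2.
Qed.

Lemma height_side_pt i k s : height (PG i) k (side_pt X i k s) = 0.
Proof. unfold height, side_pt, edge; vring. Qed.

(** An end of the piece is a vertex if the piece is first or last, and inside a side otherwise. The
    two ends never share a side, and the case of adjacent sides is the excluded corner, so the
    estimates for diagonals and chords apply. *)
Lemma piece_far t : (t < p)%nat -> corner X L t = false ->
  l0 <= norm (pdir L t) /\ (p = 1%nat -> l0 < norm (pdir L t)) /\
  (all_strictly_obtuse X -> t = 0%nat \/ S t = p -> l0 < norm (pdir L t)).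
Proof.
  intros Ht Hc; rewrite pdir_eq.
  pose proof (ppoly_valid X L HL t Ht) as Hi; pose proof (Hcyc _ Hi) as HV.
  assert (Hbad : forall k, (k < len (PP t))%nat -> height (PG (PP t)) k (pA L t) = 0 ->
            height (PG (PP t)) k (pB L t) = 0 -> False).
  { intros k Hk HA HB; apply (Hns t Ht); exists k; now repeat split. }
  assert (Hself : forall k, height (PG (PP t)) k (vtx (PG (PP t)) k) = 0) by (intros; unfold height; vring).
  assert (Hsucc : forall k, height (PG (PP t)) k (vtx (PG (PP t)) (S k mod len (PP t))) = 0)
    by (intros; rewrite vtx_mod; unfold height, edge; vring).
  destruct (Nat.eq_dec t 0) as [E0|N0]; destruct (Nat.eq_dec (S t) p) as [E1|N1].
  - destruct (start_vertex X L HL) as (a & Ha & HA); destruct (end_vertex X L HL) as (b & Hb & HB).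
    replace (p - 1)%nat with t in Hb, HB by lia; rewrite <- E0 in Ha, HA.
    rewrite HA, HB in *.
    assert (l0 < norm (vsub (vtx (PG (PP t)) b) (vtx (PG (PP t)) a))).
    { apply (vertex_vertex_far _ _ HV); trivial.
      - intros ->; now apply (Hbad b).
      - intros ->; now apply (Hbad a).
      - intros ->; now apply (Hbad b). }
    repeat split; intros; lra.
  - destruct (start_vertex X L HL) as (a & Ha & HA); rewrite <- E0 in Ha, HA.
    destruct (exit_kout t ltac:(lia)) as ((_ & Hk) & Hs & HB & _).
    rewrite HA, HB in *.
    destruct (vertex_side_far _ _ HV a (kout X L t) (sout X L t)) as [F1 F2]; trivial.
    + intros ->; apply (Hbad (kout X L t)); trivial; apply height_side_pt.
    + intros ->; apply (Hbad (kout X L t)); trivial; apply height_side_pt.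
    + split; [exact F1|split; [lia|]].
      intros Ho _; apply F2; now apply (strictly_obtuse_polygon X l0).
  - destruct (end_vertex X L HL) as (b & Hb & HB); replace (p - 1)%nat with t in Hb, HB by lia.
    destruct (entry_kin t ltac:(lia) Ht) as ((_ & Hk) & Hs & HA).
    rewrite norm_vsub_sym; rewrite HA, HB in *.
    destruct (vertex_side_far _ _ HV b (kin X L t) (sin_ X L t)) as [F1 F2]; trivial.
    + intros ->; apply (Hbad (kin X L t)); trivial; apply height_side_pt.
    + intros ->; apply (Hbad (kin X L t)); trivial; apply height_side_pt.
    + split; [exact F1|split; [lia|]].
      intros Ho _; apply F2; now apply (strictly_obtuse_polygon X l0).
  - destruct (exit_kout t ltac:(lia)) as ((_ & Hk) & Hs & HB & _).
    destruct (entry_kin t ltac:(lia) Ht) as ((_ & Hk') & Hs' & HA).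
    rewrite HA, HB in *.
    split; [|split; lia].
    apply (side_side_far _ _ HV); trivial; try lra.
    + intros He; apply (Hbad (kout X L t)); trivial; [rewrite <- He|]; apply height_side_pt.
    + intros He; assert (corner X L t = true); [|congruence].
      apply corner_spec; split; [lia|split; [lia|left; symmetry; exact He]].
    + intros He; assert (corner X L t = true); [|congruence].
      apply corner_spec; split; [lia|split; [lia|right; symmetry; exact He]].
Qed.

Lemma cornerA_eq t : (0 < t)%nat -> (S t < p)%nat -> cornerA X L t ->
  vtx (PG (PP t)) (S (kin X L t)) = vtx (PG (PP t)) (kout X L t) /\
  pdir L t = vadd (vscale (1 - sin_ X L t) (E t (kin X L t))) (vscale (sout X L t) (E t (kout X L t))) /\
  0 <= dot (E t (kin X L t)) (E t (kout X L t)) /\ 0 < cross (E t (kin X L t)) (E t (kout X L t)).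
Proof.
  intros H0 Ht Hc; unfold cornerA in Hc.
  destruct (exit_kout t Ht) as ((Hi & Hk) & Hs & HB & _).
  destruct (entry_kin t H0 ltac:(lia)) as ((_ & Hk') & Hs' & HA).
  pose proof (Hcyc _ Hi) as HV.
  assert (Hv : vtx (PG (PP t)) (S (kin X L t)) = vtx (PG (PP t)) (kout X L t))
    by (rewrite <- Hc; symmetry; apply vtx_mod).
  assert (He : E t (kout X L t) = E t (S (kin X L t))) by (rewrite <- Hc; apply edge_vtx_mod).
  split; [trivial|split].
  - rewrite pdir_eq, HA, HB; unfold side_pt, edge; rewrite Hv; veq.
  - rewrite He; split; [apply (oc_dot _ _ _ HV)|apply (turn_left _ _ _ HV)].
Qed.

Lemma cornerB_eq t : (0 < t)%nat -> (S t < p)%nat -> cornerB X L t ->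
  vtx (PG (PP t)) (S (kout X L t)) = vtx (PG (PP t)) (kin X L t) /\
  pdir L t = vscale (-1) (vadd (vscale (1 - sout X L t) (E t (kout X L t))) (vscale (sin_ X L t) (E t (kin X L t)))) /\
  0 <= dot (E t (kout X L t)) (E t (kin X L t)) /\ 0 < cross (E t (kout X L t)) (E t (kin X L t)).
Proof.
  intros H0 Ht Hc; unfold cornerB in Hc.
  destruct (exit_kout t Ht) as ((Hi & Hk) & Hs & HB & _).
  destruct (entry_kin t H0 ltac:(lia)) as ((_ & Hk') & Hs' & HA).
  pose proof (Hcyc _ Hi) as HV.
  assert (Hv : vtx (PG (PP t)) (S (kout X L t)) = vtx (PG (PP t)) (kin X L t))
    by (rewrite <- Hc; symmetry; apply vtx_mod).
  assert (He : E t (kin X L t) = E t (S (kout X L t))) by (rewrite <- Hc; apply edge_vtx_mod).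
  split; [trivial|split].
  - rewrite pdir_eq, HA, HB; unfold side_pt, edge; rewrite Hv; veq.
  - rewrite He; split; [apply (oc_dot _ _ _ HV)|apply (turn_left _ _ _ HV)].
Qed.

Lemma norm_gt_leg c d (v w : pt) : 0 < c -> 0 < d -> 0 < dot w w -> 0 <= dot v w ->
  c * norm v < norm (vadd (vscale c v) (vscale d w)).
Proof.
  intros Hc Hd Hw Hvw; apply norm_gt; [pose proof (norm_nonneg v); nra|].
  replace (c * norm v * (c * norm v)) with (c * c * (norm v * norm v)) by ring; rewrite norm_sqr.
  replace (dot (vadd (vscale c v) (vscale d w)) (vadd (vscale c v) (vscale d w)))
    with (c * c * dot v v + 2 * (c * d) * dot v w + d * d * dot w w) by vring.
  assert (0 < c * d) by nra; assert (0 < d * d * dot w w) by (apply Rmult_lt_0_compat; nra). nra.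
Qed.

Lemma vadd_comm (v w : pt) : vadd v w = vadd w v.
Proof. veq. Qed.

Lemma norm_opp (v : pt) : norm (vscale (-1) v) = norm v.
Proof. unfold norm; f_equal; vring. Qed.

Lemma dot_comm (v w : pt) : dot v w = dot w v.
Proof. vring. Qed.

Lemma cornerA_legs t : (0 < t)%nat -> (S t < p)%nat -> cornerA X L t ->
  sout X L t * norm (E t (kout X L t)) < norm (pdir L t) /\
  (1 - sin_ X L t) * norm (E t (kin X L t)) < norm (pdir L t).
Proof.
  intros H0 Ht Hc; destruct (cornerA_eq t H0 Ht Hc) as (_ & Hd & Hdot & _).
  destruct (exit_kout t Ht) as ((Hi & _) & Hs & _).
  destruct (entry_kin t H0 ltac:(lia)) as (_ & Hs' & _).
  pose proof (Hcyc _ Hi) as HV.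
  rewrite Hd; split.
  - rewrite vadd_comm; apply norm_gt_leg; try lra; [apply (edge_sqr_pos _ _ _ HV)|].
    now rewrite dot_comm.
  - apply norm_gt_leg; try lra; apply (edge_sqr_pos _ _ _ HV).
Qed.

Lemma cornerB_legs t : (0 < t)%nat -> (S t < p)%nat -> cornerB X L t ->
  (1 - sout X L t) * norm (E t (kout X L t)) < norm (pdir L t) /\
  sin_ X L t * norm (E t (kin X L t)) < norm (pdir L t).
Proof.
  intros H0 Ht Hc; destruct (cornerB_eq t H0 Ht Hc) as (_ & Hd & Hdot & _).
  destruct (exit_kout t Ht) as ((Hi & _) & Hs & _).
  destruct (entry_kin t H0 ltac:(lia)) as (_ & Hs' & _).
  pose proof (Hcyc _ Hi) as HV.
  rewrite Hd, norm_opp; split.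
  - apply norm_gt_leg; try lra; apply (edge_sqr_pos _ _ _ HV).
  - rewrite vadd_comm; apply norm_gt_leg; try lra; [apply (edge_sqr_pos _ _ _ HV)|].
    now rewrite dot_comm.
Qed.

Lemma pdir_dot_sign t t' v : (t < p)%nat -> (t' < p)%nat -> 0 < dot (pdir L t) v -> 0 < dot (pdir L t') v.
Proof.
  intros Ht Ht' H; pose proof (plam_pos X L HL t Ht) as H1; pose proof (plam_pos X L HL t' Ht') as H2.
  rewrite (pdir_plam X L HL) in * by trivial.
  assert (H3 : dot (vscale (plam L t) (pdir L 0)) v = plam L t * dot (pdir L 0) v) by vring.
  assert (H4 : dot (vscale (plam L t') (pdir L 0)) v = plam L t' * dot (pdir L 0) v) by vring.
  rewrite H3 in H; rewrite H4.
  assert (0 < dot (pdir L 0) v) by (apply Rmult_lt_reg_l with (plam L t); lra).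
  now apply Rmult_lt_0_compat.
Qed.

(** Two consecutive corner pieces turn around opposite ends of their common side [e], as
    the component of the direction along [e] shows. *)
Lemma corner_alternate t : (0 < t)%nat -> (S (S t) < p)%nat ->
  ~ (cornerA X L t /\ cornerA X L (S t)) /\ ~ (cornerB X L t /\ cornerB X L (S t)).
Proof.
  intros H0 Ht.
  destruct (exit_kout t ltac:(lia)) as ((Hi & _) & Hs & _).
  destruct (exit_kout (S t) ltac:(lia)) as ((Hi' & _) & Hs' & _).
  destruct (entry_kin t H0 ltac:(lia)) as (_ & Hsi & _).
  pose proof (Hcyc _ Hi) as HV.
  pose proof (entry_edge t ltac:(lia)) as He.
  assert (Hsin : sin_ X L (S t) = 1 - sout X L t) by (unfold sin_; now replace (S t - 1)%nat with t by lia).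
  pose proof (edge_sqr_pos _ _ _ HV (kout X L t)) as Hpos.
  set (e := E t (kout X L t)) in *.
  split; intros [H1 H2].
  - destruct (cornerA_eq t H0 ltac:(lia) H1) as (_ & Hd & Hdot & _).
    destruct (cornerA_eq (S t) ltac:(lia) ltac:(lia) H2) as (_ & Hd' & Hdot' & _).
    rewrite He in *; fold e in Hd, Hdot.
    set (f := E t (kin X L t)) in *; set (h := E (S t) (kout X L (S t))) in *.
    assert (Hp : 0 < dot (pdir L t) e).
    { rewrite Hd.
      replace (dot (vadd (vscale (1 - sin_ X L t) f) (vscale (sout X L t) e)) e)
        with ((1 - sin_ X L t) * dot f e + sout X L t * dot e e) by vring. nra. }
    apply (pdir_dot_sign t (S t)) in Hp; try lia.
    rewrite Hd', Hsin in Hp.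
    replace (dot (vadd (vscale (1 - (1 - sout X L t)) (vscale (-1) e)) (vscale (sout X L (S t)) h)) e)
      with (- (sout X L t * dot e e) - sout X L (S t) * dot (vscale (-1) e) h) in Hp by vring. nra.
  - destruct (cornerB_eq t H0 ltac:(lia) H1) as (_ & Hd & Hdot & _).
    destruct (cornerB_eq (S t) ltac:(lia) ltac:(lia) H2) as (_ & Hd' & Hdot' & _).
    rewrite He in *; fold e in Hd, Hdot.
    set (f := E t (kin X L t)) in *; set (h := E (S t) (kout X L (S t))) in *.
    rewrite Hsin in Hd'.
    assert (Hp : 0 < dot (pdir L (S t)) e).
    { rewrite Hd'.
      replace (dot (vscale (-1) (vadd (vscale (1 - sout X L (S t)) h) (vscale (1 - sout X L t) (vscale (-1) e)))) e)
        with ((1 - sout X L (S t)) * dot h (vscale (-1) e) + (1 - sout X L t) * dot e e) by vring. nra. }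
    apply (pdir_dot_sign (S t) t) in Hp; try lia.
    rewrite Hd in Hp.
    replace (dot (vscale (-1) (vadd (vscale (1 - sout X L t) e) (vscale (sin_ X L t) f))) e)
      with (- ((1 - sout X L t) * dot e e) - sin_ X L t * dot e f) in Hp by vring. nra.
Qed.

(** Since consecutive corners turn around opposite ends of their common side, the leg of the second
    one is the part of that side which the first one leaves over. The two legs add up to a whole
    side. *)
Lemma corner_next_leg t : (0 < t)%nat -> (S (S t) < p)%nat -> corner X L (S t) = true ->
  (cornerA X L t -> (1 - sout X L t) * norm (E t (kout X L t)) < norm (pdir L (S t))) /\
  (cornerB X L t -> sout X L t * norm (E t (kout X L t)) < norm (pdir L (S t))).
Proof.
  intros H0 Ht Hc; apply corner_spec in Hc as (_ & _ & Hc).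
  destruct (corner_alternate t H0 Ht) as [NA NB].
  pose proof (entry_edge t ltac:(lia)) as He.
  assert (Hn : norm (E (S t) (kin X L (S t))) = norm (E t (kout X L t)))
    by (rewrite He; apply norm_opp).
  assert (Hsin : sin_ X L (S t) = 1 - sout X L t) by (unfold sin_; now replace (S t - 1)%nat with t by lia).
  split; intros Hct.
  - destruct Hc as [Hc|Hc]; [exfalso; now apply NA|].
    destruct (cornerB_legs (S t) ltac:(lia) Ht Hc) as [_ H]; now rewrite Hn, Hsin in H.
  - destruct Hc as [Hc|Hc]; [|exfalso; now apply NB].
    destruct (cornerA_legs (S t) ltac:(lia) Ht Hc) as [_ H]; rewrite Hn, Hsin in H.
    now replace (1 - (1 - sout X L t)) with (sout X L t) in H by ring.
Qed.

Lemma two_pieces_far t : (S t < p)%nat -> l0 < norm (pdir L t) + norm (pdir L (S t)).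
Proof.
  intros Ht.
  pose proof (pdir_norm_pos X L HL t ltac:(lia)); pose proof (pdir_norm_pos X L HL (S t) Ht).
  destruct (corner X L t) eqn:C1;
    [|destruct (piece_far t ltac:(lia) C1) as [H1 _]; lra].
  destruct (corner X L (S t)) eqn:C2;
    [|destruct (piece_far (S t) ltac:(lia) C2) as [H1 _]; lra].
  pose proof C2 as C2'; apply corner_spec in C2' as (_ & Ht2 & _).
  apply corner_spec in C1 as (H0t & _ & C1).
  destruct (corner_next_leg t H0t Ht2 C2) as [NA NB].
  destruct (exit_kout t Ht) as ((Hi & _) & Hs & _).
  pose proof (edge_norm_ge _ _ _ (Hcyc _ Hi) (kout X L t)) as Hge.
  destruct C1 as [C1|C1].
  - specialize (NA C1); destruct (cornerA_legs t H0t Ht C1) as [LA _]; nra.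
  - specialize (NB C1); destruct (cornerB_legs t H0t Ht C1) as [LB _]; nra.
Qed.

End Nonside.

(** * Counting crossings of itineraries *)

Fixpoint cnt (U : nat -> bool) (n : nat) : nat :=
  match n with O => O | S m => (cnt U m + if U m then 1 else 0)%nat end.

Fixpoint nsum (f : nat -> nat) (n : nat) : nat :=
  match n with O => O | S m => (nsum f m + f m)%nat end.

Lemma cnt_filter U n : length (filter U (seq 0 n)) = cnt U n.
Proof.
  induction n as [|n IH]; trivial.
  rewrite seq_S, filter_app, length_app, IH; simpl; now destruct (U n).
Qed.

Lemma cnt_ext U W n : (forall t, (t < n)%nat -> U t = W t) -> cnt U n = cnt W n.
Proof. induction n; simpl; intros H; trivial. rewrite IHn, H; auto. Qed.

Lemma cnt_even h : cnt Nat.even (2 * h + 1) = S h.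
Proof.
  induction h as [|h IH]; trivial.
  replace (2 * S h + 1)%nat with (S (S (2 * h + 1))) by lia; cbn [cnt]; rewrite IH.
  replace (2 * h + 1)%nat with (S (2 * h)) by lia.
  rewrite Nat.even_succ_succ, Nat.even_even, Nat.even_succ, Nat.odd_even; simpl; lia.
Qed.

(** [P t] is the polygon containing the piece [t], [w t] its length in units of the
    smallest side, and [C t] tells whether it is a corner piece. *)
Record itinerary (p : nat) (P : nat -> nat) (w : nat -> R) (C : nat -> bool) : Prop := {
  it_pos : (0 < p)%nat;
  it_first : C 0%nat = false;
  it_last : C (p - 1)%nat = false;
  it_long : forall t, (t < p)%nat -> C t = false -> 1 <= w t;
  it_w : forall t, (t < p)%nat -> 0 < w t;
  it_pair : forall t, (S t < p)%nat -> 1 < w t + w (S t);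
  it_single : p = 1%nat -> 1 < w 0%nat;
  it_poly : forall t, (S t < p)%nat -> P (S t) <> P t }.

(** Contains every piece that is not a corner and one of any two consecutive pieces. *)
Fixpoint cover (C : nat -> bool) (t : nat) : bool :=
  match t with O => true | S m => (negb (C (S m)) || negb (cover C m))%bool end.

Section Itinerary.
Variables (p : nat) (P : nat -> nat) (w : nat -> R) (C : nat -> bool).
Hypothesis HI : itinerary p P w C.
Notation T := (cover C).
Notation S_ n := (psum w n).

Definition independent (U : nat -> bool) : Prop :=
  forall t, (S t < p)%nat -> U t = true -> U (S t) = true -> False.

(** The induction goes two pieces at a time: a chosen piece is preceded by one that is not chosen,
    and the pair weighs more than 1. The first piece is not a corner and weighs at least 1 by
    itself. *)
Lemma independent_prefix U : independent U ->
  forall m, (m <= p)%nat -> INR (cnt U m) <= S_ m.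
Proof.
  intros HU; destruct HI as [H0 HF HLa HLo Hw Hp _ _].
  assert (H : forall m, ((m <= p)%nat -> INR (cnt U m) <= S_ m) /\
                        ((S m <= p)%nat -> INR (cnt U (S m)) <= S_ (S m))).
  { induction m as [|m [IH1 IH2]].
    - split; intros Hm; [simpl; lra|].
      pose proof (HLo 0%nat H0 HF); simpl; destruct (U 0%nat); simpl; lra.
    - split; trivial; intros Hm.
      specialize (IH1 ltac:(lia)); specialize (IH2 ltac:(lia)).
      pose proof (Hw (S m) ltac:(lia)); pose proof (Hp m ltac:(lia)).
      destruct (U (S m)) eqn:E1.
      + assert (E0 : U m = false) by (destruct (U m) eqn:E0; trivial; exfalso; apply (HU m); trivial; lia).
        cbn [cnt psum]; rewrite E0, E1, Nat.add_0_r, Nat.add_1_r, S_INR; lra.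
      + cbn [cnt psum] in *; rewrite E1, Nat.add_0_r; lra. }
  intros m; apply H.
Qed.

(** The same count read towards the last piece, which is not a corner. With two pieces or more
    something is left over: the excess of a pair, or a piece that is not counted. *)
Lemma independent_suffix U : independent U -> forall d m, (m + d = p)%nat ->
  INR (cnt U p) - INR (cnt U m) <= S_ p - S_ m /\
  ((2 <= d)%nat -> INR (cnt U p) - INR (cnt U m) < S_ p - S_ m).
Proof.
  intros HU; destruct HI as [H0 HF HLa HLo Hw Hp _ _].
  induction d as [d IH] using (well_founded_induction lt_wf); intros m Hm.
  destruct d as [|[|d]].
  - replace m with p by lia; split; [lra|lia].
  - split; [|lia]. replace p with (S m) in * by lia.
    replace (S m - 1)%nat with m in HLa by lia.
    pose proof (HLo m ltac:(lia) HLa); cbn [cnt psum]; destruct (U m);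
      rewrite ?Nat.add_0_r, ?Nat.add_1_r, ?S_INR; lra.
  - assert (Hlt : INR (cnt U p) - INR (cnt U m) < S_ p - S_ m); [|split; intros; lra].
    destruct (U m) eqn:E0.
    + assert (E1 : U (S m) = false) by (destruct (U (S m)) eqn:E1; trivial; exfalso; apply (HU m); trivial; lia).
      destruct (IH d ltac:(lia) (S (S m)) ltac:(lia)) as [H1 _].
      pose proof (Hp m ltac:(lia)).
      cbn [cnt psum] in H1; rewrite E0, E1, Nat.add_0_r, Nat.add_1_r, S_INR in H1; lra.
    + destruct (IH (S d) ltac:(lia) (S m) ltac:(lia)) as [H1 _].
      pose proof (Hw m ltac:(lia)).
      cbn [cnt psum] in H1; rewrite E0, Nat.add_0_r in H1; lra.
Qed.

Lemma independent_total U : independent U -> INR (cnt U p) < S_ p.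
Proof.
  intros HU; destruct (independent_suffix U HU p 0 eq_refl) as [_ H].
  pose proof (it_pos _ _ _ _ HI) as H0.
  destruct (Nat.eq_dec p 1) as [E|E].
  - pose proof (it_single _ _ _ _ HI E); rewrite E; simpl; destruct (U 0%nat); simpl; lra.
  - specialize (H ltac:(lia)); simpl in H; lra.
Qed.

(** The first piece weighs at least 1 and is not counted. The only way to lose the strictness is to
    have just two pieces, both of weight 1; this exception is the origin of case (c). *)
Lemma independent_miss_first U : independent U -> U 0%nat = false ->
  INR (cnt U p) + 1 < S_ p \/
  (p = 2%nat /\ cnt U p = 1%nat /\ w 0%nat = 1 /\ w 1%nat = 1 /\ INR (cnt U p) + 1 = S_ p).
Proof.
  intros HU E0.
  pose proof (it_pos _ _ _ _ HI) as H0; pose proof (it_long _ _ _ _ HI 0%nat H0 (it_first _ _ _ _ HI)) as Hl.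
  destruct (independent_suffix U HU (p - 1) 1 ltac:(lia)) as [H1 H2].
  simpl in H1, H2; rewrite E0 in H1, H2; simpl in H1, H2.
  destruct (le_lt_dec 2 (p - 1)) as [Hp|Hp]; [left; specialize (H2 Hp); lra|].
  destruct (Nat.eq_dec p 1) as [E|E].
  - pose proof (it_single _ _ _ _ HI E); left; rewrite E; simpl; rewrite E0; simpl; lra.
  - assert (E2 : p = 2%nat) by lia.
    pose proof (it_last _ _ _ _ HI) as HLa; rewrite E2 in HLa; simpl in HLa.
    pose proof (it_long _ _ _ _ HI 1%nat ltac:(lia) HLa) as Hl1.
    rewrite E2; simpl; rewrite E0; simpl; destruct (U 1%nat); simpl; [|left; lra].
    destruct (Rlt_le_dec (1 + 1) (0 + w 0%nat + w 1%nat)); [left; lra|right; repeat split; lra].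
Qed.

Lemma independent_miss_last U : independent U -> U (p - 1)%nat = false -> INR (cnt U p) + 1 <= S_ p.
Proof.
  intros HU E0.
  pose proof (it_pos _ _ _ _ HI) as H0; pose proof (it_long _ _ _ _ HI (p - 1)%nat ltac:(lia) (it_last _ _ _ _ HI)) as Hl.
  pose proof (independent_prefix U HU (p - 1) ltac:(lia)) as H1.
  replace p with (S (p - 1)) by lia; cbn [cnt psum]; rewrite E0, Nat.add_0_r; lra.
Qed.

Lemma independent_gap U u : independent U -> (S u < p)%nat -> U u = false -> U (S u) = false ->
  INR (cnt U p) + 1 < S_ p.
Proof.
  intros HU Hu E0 E1.
  pose proof (independent_prefix U HU u ltac:(lia)) as H1.
  destruct (independent_suffix U HU (p - S (S u)) (S (S u)) ltac:(lia)) as [H2 _].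
  pose proof (it_pair _ _ _ _ HI u Hu).
  cbn [cnt psum] in H2; rewrite E0, E1, !Nat.add_0_r in H2; lra.
Qed.

Lemma independent_miss_end U u : independent U -> u = 0%nat \/ u = (p - 1)%nat -> U u = false ->
  INR (cnt U p) + 1 <= S_ p.
Proof.
  intros HU [->| ->] E; [|now apply independent_miss_last].
  destruct (independent_miss_first U HU E) as [H|(_ & _ & _ & _ & H)]; lra.
Qed.

Lemma cover_false t : (t < p)%nat -> T t = false ->
  (0 < t)%nat /\ (S t < p)%nat /\ C t = true /\ T (t - 1)%nat = true /\ T (S t) = true.
Proof.
  intros Ht E; destruct t as [|t]; [discriminate|].
  pose proof E as E'; simpl in E; apply Bool.orb_false_iff in E as [E1 E2].
  apply Bool.negb_false_iff in E1, E2.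
  split; [lia|]; split.
  - destruct (Nat.eq_dec (S t) (p - 1)) as [Ep|]; [|lia].
    pose proof (it_last _ _ _ _ HI) as HLa; rewrite <- Ep in HLa; congruence.
  - split; [trivial|]; replace (S t - 1)%nat with t by lia; split; trivial.
    change (T (S (S t))) with (negb (C (S (S t))) || negb (T (S t)))%bool.
    rewrite E'; simpl; apply Bool.orb_true_r.
Qed.

Lemma cover_last : T (p - 1)%nat = true.
Proof.
  pose proof (it_pos _ _ _ _ HI); destruct (T (p - 1)%nat) eqn:E; trivial.
  apply cover_false in E; lia.
Qed.

Lemma cover_count : INR (cnt T p) <= S_ p /\
  ((exists t, (t < p)%nat /\ T t = false) -> INR (cnt T p) < S_ p).
Proof.
  destruct HI as [H0 HF HLa HLo Hw Hp _ _].
  (* If piece [m] is missing from the cover, its weight is kept in reserve for the next piece: the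
     bound is then [S_ m], without [w m]. *)
  assert (H : forall m, (S m <= p)%nat ->
    (T m = true -> INR (cnt T (S m)) <= S_ (S m) /\
        ((exists t, (t < S m)%nat /\ T t = false) -> INR (cnt T (S m)) < S_ (S m))) /\
    (T m = false -> INR (cnt T (S m)) <= S_ m)).
  { induction m as [|m IH]; intros Hm.
    - split; [|discriminate]. intros _; pose proof (HLo 0%nat H0 HF).
      simpl; split; [lra|]. intros (t & Ht & E); replace t with 0%nat in E by lia; discriminate.
    - destruct (IH ltac:(lia)) as [IH1 IH2].
      split; intros E.
      + destruct (T m) eqn:Em.
        * assert (EC : C (S m) = false).
          { change (T (S m)) with (negb (C (S m)) || negb (T m))%bool in E; rewrite Em in E.
            simpl in E; now destruct (C (S m)). }
          pose proof (HLo (S m) ltac:(lia) EC). destruct (IH1 eq_refl) as [J1 J2].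
          assert (Ec : INR (cnt T (S (S m))) = INR (cnt T (S m)) + 1).
          { change (cnt T (S (S m))) with (cnt T (S m) + if T (S m) then 1 else 0)%nat.
            now rewrite E, Nat.add_1_r, S_INR. }
          change (S_ (S (S m))) with (S_ (S m) + w (S m)).
          rewrite Ec; split; [lra|]. intros (t & Ht & Et).
          assert (t <> S m) by congruence.
          assert (INR (cnt T (S m)) < S_ (S m)); [|lra]. apply J2; exists t; split; trivial; lia.
        * specialize (IH2 eq_refl); pose proof (Hp m ltac:(lia)).
          assert (Ec : INR (cnt T (S (S m))) = INR (cnt T (S m)) + 1).
          { change (cnt T (S (S m))) with (cnt T (S m) + if T (S m) then 1 else 0)%nat.
            now rewrite E, Nat.add_1_r, S_INR. }
          change (S_ (S (S m))) with (S_ m + w m + w (S m)).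
          rewrite Ec; split; intros; lra.
      + assert (Em : T m = true).
        { change (T (S m)) with (negb (C (S m)) || negb (T m))%bool in E.
          apply Bool.orb_false_iff in E as [_ E]; now apply Bool.negb_false_iff in E. }
        destruct (IH1 Em) as [J1 _].
        assert (Ec : cnt T (S (S m)) = cnt T (S m)).
        { change (cnt T (S (S m))) with (cnt T (S m) + if T (S m) then 1 else 0)%nat.
          rewrite E; lia. }
        now rewrite Ec. }
  destruct (H (p - 1)%nat ltac:(lia)) as [H1 _]; specialize (H1 cover_last).
  now replace (S (p - 1)) with p in H1 by lia.
Qed.

Lemma cover_count_pos : (1 <= cnt T p)%nat /\ ((2 <= p)%nat -> (2 <= cnt T p)%nat).
Proof.
  pose proof (it_pos _ _ _ _ HI) as H0.
  assert (Hm : forall m, (1 <= cnt T (S m))%nat) by (induction m; cbn [cnt] in *; [simpl; lia|lia]).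
  split; [replace p with (S (p - 1)) by lia; apply Hm|].
  intros H2; replace p with (S (S (p - 2))) by lia.
  change (cnt T (S (S (p - 2)))) with (cnt T (S (p - 2)) + if T (S (p - 2)) then 1 else 0)%nat.
  replace (S (p - 2)) with (p - 1)%nat at 2 by lia; rewrite cover_last.
  pose proof (Hm (p - 2)%nat); lia.
Qed.

End Itinerary.

Lemma nsum_le T f K n : (forall t, (t < n)%nat -> T t = true -> (f t <= K)%nat) ->
  (nsum (fun t => if T t then f t else 0) n <= cnt T n * K)%nat.
Proof.
  induction n as [|n IH]; intros H; simpl; [lia|].
  specialize (IH ltac:(intros; apply H; trivial; lia)); destruct (T n) eqn:E; [|lia].
  pose proof (H n ltac:(lia) E); lia.
Qed.

Lemma nsum_lt T f K n : (forall t, (t < n)%nat -> T t = true -> (f t <= K)%nat) ->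
  (exists t, (t < n)%nat /\ T t = true /\ (f t < K)%nat) ->
  (nsum (fun t => if T t then f t else 0) n + 1 <= cnt T n * K)%nat.
Proof.
  induction n as [|n IH]; intros H (t & Ht & E & Hlt); [lia|]; simpl.
  destruct (Nat.eq_dec t n) as [->|].
  - pose proof (nsum_le T f K n ltac:(intros; apply H; trivial; lia)); rewrite E; nia.
  - assert (Hex : exists t, (t < n)%nat /\ T t = true /\ (f t < K)%nat)
      by (exists t; repeat split; trivial; lia).
    specialize (IH ltac:(intros; apply H; trivial; lia) Hex).
    destruct (T n) eqn:En; [pose proof (H n ltac:(lia) En); nia|nia].
Qed.

Lemma max_exists (T : nat -> bool) (f : nat -> nat) n : T 0%nat = true ->
  exists t0, (t0 <= n)%nat /\ T t0 = true /\
    forall t, (t <= n)%nat -> T t = true -> (f t <= f t0)%nat.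
Proof.
  intros H0; induction n as [|n (t0 & H1 & H2 & H3)].
  - exists 0%nat; repeat split; trivial; intros t Ht _; replace t with 0%nat by lia; lia.
  - destruct (T (S n)) eqn:E.
    + destruct (le_lt_dec (f (S n)) (f t0)).
      * exists t0; split; [lia|split; trivial]; intros t Ht Et.
        destruct (Nat.eq_dec t (S n)) as [->|]; [trivial|apply H3; trivial; lia].
      * exists (S n); split; [lia|split; trivial]; intros t Ht Et.
        destruct (Nat.eq_dec t (S n)) as [->|]; [lia|].
        pose proof (H3 t ltac:(lia) Et); lia.
    + exists t0; split; [lia|split; trivial]; intros t Ht Et.
      destruct (Nat.eq_dec t (S n)) as [->|]; [congruence|apply H3; trivial; lia].
Qed.

Lemma alternate_even (U : nat -> bool) p : U 0%nat = true ->
  (forall t, (S t < p)%nat -> U (S t) = negb (U t)) ->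
  forall t, (t < p)%nat -> U t = Nat.even t.
Proof.
  intros H0 Hs; induction t as [|t IH]; intros Ht; trivial.
  rewrite Hs, IH by lia; rewrite Nat.even_succ, <- Nat.negb_even; reflexivity.
Qed.

(** * Two itineraries: counting pairs of pieces in a common polygon *)

Section Count.
Variables (p : nat) (P : nat -> nat) (w : nat -> R) (C : nat -> bool).
Variables (q : nat) (Q : nat -> nat) (v : nat -> R) (D : nat -> bool).
Hypothesis HA : itinerary p P w C.
Hypothesis HB : itinerary q Q v D.
Notation T := (cover C).
Notation U t := (fun u => (P t =? Q u)%nat).
Notation "'SA'" := (psum w p).
Notation "'SB'" := (psum v q).

(** Extra pairs stand for the crossings of a corner piece [t - 1] with a piece that starts or ends at its
    corner. *)
Variable extra : nat -> nat -> Prop.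
Hypothesis Hextra : forall t u, (t < p)%nat -> extra t u -> (0 < t)%nat /\ T (t - 1)%nat = false /\
  P (t - 1)%nat = Q u /\ (u = 0%nat \/ u = (q - 1)%nat).
Hypothesis Hextra1 : forall t u u', (t < p)%nat -> extra t u -> extra t u' -> u = u'.

Lemma same_poly_independent t : independent q (U t).
Proof.
  intros u Hu H1 H2; apply Nat.eqb_eq in H1, H2; apply (it_poly _ _ _ _ HB u Hu); congruence.
Qed.

Definition has_extra t : bool := if excluded_middle_informative (exists u, extra t u) then true else false.
Definition extra_list t : list nat :=
  if has_extra t then [epsilon (inhabits 0%nat) (extra t)] else [].
(** All [u] that can be paired with [t]. A table with these rows, restricted to the cover, contains
    every crossing. *)
Definition row t : list nat := filter (U t) (seq 0 q) ++ extra_list t.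
Definition row_size t : nat := (cnt (U t) q + if has_extra t then 1 else 0)%nat.

Lemma row_length t : length (row t) = row_size t.
Proof.
  unfold row, row_size, extra_list; rewrite length_app, cnt_filter; now destruct (has_extra t).
Qed.

Lemma has_extra_spec t : has_extra t = true <-> exists u, extra t u.
Proof. unfold has_extra; destruct (excluded_middle_informative _); split; intros; trivial; congruence. Qed.

Definition all_pairs n : list (nat * nat) :=
  flat_map (fun t => if T t then map (pair t) (row t) else []) (seq 0 n).

Lemma all_pairs_length n : length (all_pairs n) = nsum (fun t => if T t then row_size t else 0%nat) n.
Proof.
  unfold all_pairs; induction n as [|n IH]; trivial.
  rewrite seq_S, flat_map_app, length_app, IH; cbn [nsum flat_map]; rewrite app_nil_r; f_equal.
  simpl; destruct (T n); trivial; now rewrite length_map, row_length.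
Qed.

Variable crossings : list (nat * nat).
Hypothesis Hnodup : NoDup crossings.
Hypothesis Hcross : forall t u, In (t, u) crossings -> (t < p)%nat /\ T t = true /\ (u < q)%nat /\
  (P t = Q u \/ extra t u).

Lemma crossings_le : (length crossings <= nsum (fun t => if T t then row_size t else 0) p)%nat.
Proof.
  rewrite <- all_pairs_length; apply NoDup_incl_length; trivial.
  intros [t u] Hin; destruct (Hcross t u Hin) as (Ht & HT & Hu & Hor).
  apply in_flat_map; exists t; split; [apply in_seq; lia|]; rewrite HT.
  apply in_map, in_or_app; destruct Hor as [He|He].
  - left; apply filter_In; split; [apply in_seq; lia|now apply Nat.eqb_eq].
  - right; unfold extra_list.
    assert (Hh : has_extra t = true) by (apply has_extra_spec; now exists u).
    rewrite Hh; left; apply (Hextra1 t _ _ Ht); trivial.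
    apply epsilon_spec; now exists u.
Qed.

(** An extra entry pays for itself: it is an end piece of [b] in the polygon of [t - 1], hence not
    in that of [t], and pieces that miss an end leave room for one more. *)
Lemma row_size_le t : (t < p)%nat -> INR (row_size t) <= SB /\ (has_extra t = false -> INR (row_size t) < SB).
Proof.
  intros Ht; pose proof (independent_total _ _ _ _ HB _ (same_poly_independent t)) as H.
  unfold row_size; destruct (has_extra t) eqn:E.
  - split; [|discriminate]. apply has_extra_spec in E as (u & Hu).
    destruct (Hextra t u Ht Hu) as (H0 & _ & H1 & H2).
    rewrite Nat.add_1_r, S_INR.
    apply (independent_miss_end _ _ _ _ HB _ u (same_poly_independent t) H2).
    apply Nat.eqb_neq; rewrite <- H1.
    pose proof (it_poly _ _ _ _ HA (t - 1) ltac:(lia)) as Hne.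
    now replace (S (t - 1)) with t in Hne by lia.
  - rewrite Nat.add_0_r; split; intros; lra.
Qed.

Hypothesis Hzig_a : forall h, p = (2 * h + 1)%nat ->
  (forall t, (t < p)%nat -> Nat.even t = true -> P t = P 0%nat) -> INR h + sqrt 2 <= SA.
Hypothesis Hzig_b : forall h, q = (2 * h + 1)%nat ->
  (forall t, (t < q)%nat -> Nat.even t = true -> Q t = Q 0%nat) -> INR h + sqrt 2 <= SB.

(** With [N] rows of length at most [K] there are at most [N * K] crossings, while [N <= SA] and
    [K <= SB]. The missing unit comes from a shorter row, an extra pair, an end of [b] outside the
    polygon of some covered piece, or two consecutive pieces of [b] outside the first polygon. If
    all these fail, both itineraries alternate and the hypotheses with [sqrt 2] decide, except for
    two single pieces. *)
Lemma crossings_bound : INR (length crossings) + 1 < SA * SB \/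
  (p = 1%nat /\ q = 1%nat /\ (length crossings <= 1)%nat).
Proof.
  pose proof (it_pos _ _ _ _ HA) as Hp0; pose proof (it_pos _ _ _ _ HB) as Hq0.
  destruct (cover_count p P w C HA) as [HN HNlt].
  destruct (cover_count_pos p P w C HA) as [HN1 HN2].
  set (N := cnt T p) in *.
  set (n := length crossings) in *.
  pose proof crossings_le as Hn.
  destruct (max_exists T row_size (p - 1) eq_refl) as (t0 & Ht0 & HT0 & Hmax).
  set (K := row_size t0) in *.
  assert (Hle : forall t, (t < p)%nat -> T t = true -> (row_size t <= K)%nat)
    by (intros; apply Hmax; trivial; lia).
  destruct (row_size_le t0 ltac:(lia)) as [HK HKlt]; fold K in HK, HKlt.
  assert (HN1r : 1 <= INR N) by (change 1 with (INR 1); now apply le_INR).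
  pose proof (pos_INR K) as HK0.
  assert (Hall : (exists t, (t < p)%nat /\ T t = false) \/ (forall t, (t < p)%nat -> T t = true)).
  { destruct (classic (exists t, (t < p)%nat /\ T t = false)) as [|Hno]; [now left|right].
    intros t Ht; destruct (T t) eqn:E; trivial; exfalso; apply Hno; now exists t. }
  assert (Hnoext : (forall t, (t < p)%nat -> T t = true) -> forall t, (t < p)%nat -> has_extra t = false).
  { intros Ha t Ht; destruct (has_extra t) eqn:E; trivial.
    apply has_extra_spec in E as (u & Hu); destruct (Hextra t u Ht Hu) as (H0 & H1 & _).
    rewrite Ha in H1; [discriminate|lia]. }
  destruct (classic (exists t, (t < p)%nat /\ T t = true /\ (row_size t < K)%nat)) as [Hlt|Heq].
  { left; pose proof (nsum_lt T row_size K p Hle Hlt) as Hs.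
    assert (Hr : INR n + 1 <= INR N * INR K).
    { rewrite <- S_INR, <- mult_INR; apply le_INR; lia. }
    destruct Hlt as (t1 & Ht1 & _ & Hlt1).
    assert (HK1 : 1 <= INR K) by (change 1 with (INR 1); apply le_INR; lia).
    destruct Hall as [Hex|Ha]; [specialize (HNlt Hex); nra|].
    specialize (HKlt (Hnoext Ha t0 ltac:(lia))); nra. }
  assert (Hconst : forall t, (t < p)%nat -> T t = true -> row_size t = K).
  { intros t Ht HT; pose proof (Hle t Ht HT).
    destruct (Nat.eq_dec (row_size t) K); trivial; exfalso; apply Heq; exists t; repeat split; trivial; lia. }
  assert (HnNK : INR n <= INR N * INR K).
  { pose proof (nsum_le T row_size K p Hle) as Hs.
    rewrite <- mult_INR; apply le_INR; lia. }
  (* A spare unit in the longest row is enough: with several pieces in [a] it is multiplied by at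
     least 2, and a single piece of [a] is longer than 1. *)
  assert (HK1 : INR K + 1 <= SB -> INR n + 1 < SA * SB).
  { intros HKS.
    destruct (Nat.eq_dec p 1) as [E|E].
    - pose proof (it_single _ _ _ _ HA E) as Hs1.
      assert (HS : 1 < SA) by (rewrite E; simpl; lra).
      assert (EN : N = 1%nat) by (unfold N; rewrite E; reflexivity).
      rewrite EN in HnNK; simpl in HnNK; nra.
    - assert (2 <= INR N) by (change 2 with (INR 2); apply le_INR; lia). nra. }
  destruct (classic (exists t, (t < p)%nat /\ T t = true /\ has_extra t = true)) as [Hext|Hnext].
  { left.
    (* For the first extra pair, row [t - 2] has no extra entry but still has length [K]; it misses
       an end of [b], namely the one in the polygon of [t - 1]. *)
    assert (Hminimal : exists t, (t < p)%nat /\ T t = true /\ has_extra t = true /\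
       forall t', (t' < t)%nat -> T t' = true -> has_extra t' = false).
    { destruct Hext as (t & Ht & H1 & H2); revert Ht H1 H2.
      induction t as [t IH] using (well_founded_induction lt_wf); intros Ht H1 H2.
      destruct (classic (exists t', (t' < t)%nat /\ T t' = true /\ has_extra t' = true))
        as [(t' & L1 & L2 & L3)|Hno].
      - apply (IH t'); trivial; lia.
      - exists t; repeat split; trivial; intros t' L1 L2.
        destruct (has_extra t') eqn:E; trivial; exfalso; apply Hno; now exists t'. }
    destruct Hminimal as (t & Ht & HTt & Hh & Hmn).
    apply has_extra_spec in Hh as (u & Hu).
    destruct (Hextra t u Ht Hu) as (H0 & HF & HPQ & Hend).
    destruct (cover_false p P w C HA (t - 1) ltac:(lia) HF) as (H1 & _ & _ & HT2 & _).
    set (t2 := (t - 1 - 1)%nat) in *.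
    pose proof (Hconst t2 ltac:(lia) HT2) as HK2.
    unfold row_size in HK2; rewrite (Hmn t2 ltac:(lia) HT2), Nat.add_0_r in HK2.
    apply HK1; rewrite <- HK2.
    apply (independent_miss_end _ _ _ _ HB _ u (same_poly_independent t2) Hend).
    apply Nat.eqb_neq; rewrite <- HPQ.
    pose proof (it_poly _ _ _ _ HA t2 ltac:(lia)) as Hne.
    replace (S t2) with (t - 1)%nat in Hne by lia; congruence. }
  assert (HKcnt : forall t, (t < p)%nat -> T t = true -> cnt (U t) q = K).
  { intros t Ht HT; rewrite <- (Hconst t Ht HT); unfold row_size.
    destruct (has_extra t) eqn:E; [exfalso; apply Hnext; now exists t|lia]. }
  destruct (classic (exists t u, (t < p)%nat /\ T t = true /\ (u = 0%nat \/ u = (q - 1)%nat) /\ P t <> Q u))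
    as [(t & u & Ht & HT & Hend & Hne)|Hends].
  { left; apply HK1; rewrite <- (HKcnt t Ht HT).
    apply (independent_miss_end _ _ _ _ HB _ u (same_poly_independent t) Hend).
    now apply Nat.eqb_neq. }
  destruct (classic (exists u, (S u < q)%nat /\ (P 0%nat =? Q u)%nat = false /\ (P 0%nat =? Q (S u))%nat = false))
    as [(u & Hu & E0 & E1)|Hgap].
  { left; apply HK1; rewrite <- (HKcnt 0%nat Hp0 eq_refl); left.
    now apply (independent_gap _ _ _ _ HB _ u (same_poly_independent 0)). }
  assert (Hsame : forall t u, (t < p)%nat -> T t = true -> (u = 0%nat \/ u = (q - 1)%nat) -> P t = Q u).
  { intros t u Ht HT Hend; destruct (Nat.eq_dec (P t) (Q u)); trivial; exfalso; apply Hends; now exists t, u. }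
  (* All covered pieces lie in the polygon of the first piece of [b], so two consecutive ones cannot
     both be covered. *)
  assert (HTe : forall t, (t < p)%nat -> T t = Nat.even t).
  { apply alternate_even; trivial; intros t Ht.
    destruct (T t) eqn:E; simpl negb.
    - destruct (T (S t)) eqn:E1; trivial; exfalso.
      apply (it_poly _ _ _ _ HA t Ht).
      rewrite (Hsame t 0%nat), (Hsame (S t) 0%nat); trivial; [now left|lia|now left].
    - destruct (cover_false p P w C HA t ltac:(lia) E) as (_ & _ & _ & _ & H); exact H. }
  assert (HUe : forall u, (u < q)%nat -> (P 0%nat =? Q u)%nat = Nat.even u).
  { apply (alternate_even (U 0%nat) q).
    - apply Nat.eqb_eq, Hsame; trivial; now left.
    - intros u Hu; destruct (P 0%nat =? Q u)%nat eqn:E; simpl negb.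
      + destruct (P 0%nat =? Q (S u))%nat eqn:E1; trivial; exfalso.
        exact (same_poly_independent 0%nat u Hu E E1).
      + destruct (P 0%nat =? Q (S u))%nat eqn:E1; trivial; exfalso; apply Hgap; now exists u. }
  assert (Hpodd : exists h, p = (2 * h + 1)%nat).
  { pose proof (cover_last p P w C HA) as Hl; rewrite HTe in Hl by lia.
    apply Nat.even_spec in Hl as (h & Hh); exists h; lia. }
  assert (Hqodd : exists h, q = (2 * h + 1)%nat).
  { assert (Hl : (P 0%nat =? Q (q - 1))%nat = true) by (apply Nat.eqb_eq, Hsame; trivial; now right).
    rewrite HUe in Hl by lia.
    apply Nat.even_spec in Hl as (h & Hh); exists h; lia. }
  destruct Hpodd as (h & Hph), Hqodd as (h' & Hqh).
  assert (EN : N = S h) by (unfold N; rewrite (cnt_ext _ _ p HTe), Hph; apply cnt_even).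
  assert (EK : K = S h').
  { rewrite <- (HKcnt 0%nat Hp0 eq_refl), (cnt_ext _ _ q HUe), Hqh; apply cnt_even. }
  assert (HSA : INR h + sqrt 2 <= SA).
  { apply Hzig_a; trivial; intros t Ht Ev; rewrite <- HTe in Ev by trivial.
    rewrite (Hsame t 0%nat), (Hsame 0%nat 0%nat); trivial; now left. }
  assert (HSB : INR h' + sqrt 2 <= SB).
  { apply Hzig_b; trivial; intros u Hu Ev; rewrite <- HUe in Ev by trivial.
    apply Nat.eqb_eq in Ev; rewrite <- Ev; apply Hsame; trivial; now left. }
  destruct (Nat.eq_dec (h + h') 0) as [Hz|Hz].
  - right; split; [lia|split; [lia|]]. apply INR_le; rewrite EN, EK in HnNK.
    replace h with 0%nat in HnNK by lia; replace h' with 0%nat in HnNK by lia; simpl in *; lra.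
  - left; rewrite EN, EK, !S_INR in HnNK.
    pose proof (pos_INR h).
    assert (1 <= INR h + INR h') by (rewrite <- plus_INR; change 1 with (INR 1); apply le_INR; lia).
    assert (Hs2 : sqrt 2 * sqrt 2 = 2) by (apply sqrt_sqrt; lra).
    assert (Hs1 : 1 < sqrt 2) by (pose proof (sqrt_pos 2); nra).
    nra.
Qed.

End Count.

(** * Charging common points to pairs of pieces *)

Section Chords.
Variables (X : surface) (l0 : R).
Hypothesis Hwf : wf_surface X.
Hypothesis HP1 : P1 X.
Hypothesis HP2 : P2 X.
Hypothesis Hmin : is_min_side_length X l0.
Notation PG i := (polyg X i).
Notation len i := (length (polyg X i)).
Let Hcyc := polygon_cycle X l0 Hwf HP1 Hmin.

Variable L : list piece.
Hypothesis HL : is_saddle_connection X L.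
Hypothesis Hns : nonside X L.
Notation p := (length L).

Lemma ends_height_ge t k : (t < p)%nat ->
  0 <= height (PG (ppoly L t)) k (pA L t) /\ 0 <= height (PG (ppoly L t)) k (pB L t).
Proof.
  intros Ht; pose proof (Hcyc _ (ppoly_valid X L HL t Ht)) as HV.
  split; apply (in_poly_height l0 _ HV); [now apply (pA_in X L HL)|now apply (pB_in X L HL)].
Qed.

(** The height is affine and nonnegative at both ends of the piece; were it zero in between, it
    would vanish at both and the piece would run along a side. *)
Lemma interior_height_pos t k s : (t < p)%nat -> (k < len (ppoly L t))%nat -> 0 < s < 1 ->
  0 < height (PG (ppoly L t)) k (ppt L t s).
Proof.
  intros Ht Hk Hs; unfold ppt; rewrite height_seg.
  destruct (ends_height_ge t k Ht) as [H1 H2].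
  set (h1 := height (PG (ppoly L t)) k (pA L t)) in *.
  set (h2 := height (PG (ppoly L t)) k (pB L t)) in *.
  assert (Hor : 0 < h1 \/ 0 < h2).
  { destruct (Rle_lt_dec h1 0); [|now left]; destruct (Rle_lt_dec h2 0); [|now right].
    exfalso; apply (Hns t Ht); exists k; split; [trivial|split; unfold h1, h2 in *; lra]. }
  destruct Hor.
  - assert (0 < (1 - s) * h1) by (apply Rmult_lt_0_compat; lra).
    assert (0 <= s * h2) by (apply Rmult_le_pos; lra). lra.
  - assert (0 <= (1 - s) * h1) by (apply Rmult_le_pos; lra).
    assert (0 < s * h2) by (apply Rmult_lt_0_compat; lra). lra.
Qed.

Lemma height_same_vertex i a : height (PG i) a (vtx (PG i) a) = 0.
Proof. unfold height; vring. Qed.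

Definition piece_end (t : nat) (w : pt) : Prop := w = pA L t \/ w = pB L t.

Lemma piece_end_height t w : (t < p)%nat -> piece_end t w ->
  exists k, (k < len (ppoly L t))%nat /\ height (PG (ppoly L t)) k w = 0.
Proof.
  intros Ht [->| ->].
  - destruct (Nat.eq_dec t 0) as [->|].
    + destruct (start_vertex X L HL) as (a & Ha & ->); exists a; split; trivial; apply height_same_vertex.
    + destruct (entry_kin X Hwf L HL t ltac:(lia) Ht) as ((_ & Hk) & _ & ->).
      exists (kin X L t); split; trivial; apply height_side_pt.
  - destruct (Nat.eq_dec (S t) p) as [E|].
    + destruct (end_vertex X L HL) as (b & Hb & HB); replace (p - 1)%nat with t in Hb, HB by lia.
      exists b; rewrite HB; split; trivial; apply height_same_vertex.
    + destruct (exit_kout X Hwf L HL t ltac:(lia)) as ((_ & Hk) & _ & -> & _).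
      exists (kout X L t); split; trivial; apply height_side_pt.
Qed.

(** The piece [t'] lies beyond side [k], whether the connection leaves or enters through it;
    orientation does not matter for charging. *)
Definition across (t k t' : nat) : Prop :=
  (t' = S t /\ (S t < p)%nat /\ kout X L t = k) \/ (S t' = t /\ (t < p)%nat /\ kin X L t = k).

Lemma across_facts t k t' : across t k t' -> (t' < p)%nat /\
  ppoly L t' = gpoly X (ppoly L t) k /\ poff L t' = vsub (poff L t) (transl X (ppoly L t) k).
Proof.
  intros [(-> & Ht & <-)|(<- & Ht & <-)].
  - pose proof (exit_kout X Hwf L HL t Ht) as Hex.
    split; [trivial|split; [apply Hex|]].
    apply (exit_off X Hwf L HL t _ (sout X L t) Ht Hex).
  - pose proof (exit_kout X Hwf L HL t' Ht) as Hex.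
    pose proof (exit_off X Hwf L HL t' _ (sout X L t') Ht Hex) as Hoff.
    destruct Hex as (Hk & Hs & HB & HP & HA).
    unfold kin; replace (S t' - 1)%nat with t' by lia; rewrite HP.
    pose proof (glue_glue X Hwf _ _ Hk) as Hg.
    split; [lia|split].
    + unfold gpoly at 1; now rewrite Hg.
    + rewrite (transl_glue X Hwf _ _ Hk), Hoff; veq.
Qed.

Lemma piece_end_across t w k s : (t < p)%nat -> piece_end t w -> valid_side X (ppoly L t) k ->
  0 < s < 1 -> w = side_pt X (ppoly L t) k s -> exists t', across t k t'.
Proof.
  intros Ht [Hw|Hw] Hk Hs He; rewrite He in Hw.
  - destruct (Nat.eq_dec t 0) as [->|].
    + exfalso; destruct (start_vertex X L HL) as (a & Ha & HA).
      apply (open_side_not_vertex X l0 Hwf HP1 Hmin _ _ _ Hk Hs); exists a; split; congruence.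
    + destruct (entry_kin X Hwf L HL t ltac:(lia) Ht) as (Hk' & Hs' & HA).
      rewrite HA in Hw.
      destruct (side_pt_unique X l0 Hwf HP1 Hmin _ _ _ _ _ Hk Hk' Hs Hw) as [-> _].
      exists (t - 1)%nat; right; repeat split; trivial; lia.
  - destruct (Nat.eq_dec (S t) p) as [E|].
    + exfalso; destruct (end_vertex X L HL) as (b & Hb & HB); replace (p - 1)%nat with t in Hb, HB by lia.
      apply (open_side_not_vertex X l0 Hwf HP1 Hmin _ _ _ Hk Hs); exists b; split; congruence.
    + destruct (exit_kout X Hwf L HL t ltac:(lia)) as (Hk' & Hs' & HB & _).
      rewrite HB in Hw.
      destruct (side_pt_unique X l0 Hwf HP1 Hmin _ _ _ _ _ Hk Hk' Hs Hw) as [-> _].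
      exists (S t); left; repeat split; trivial; lia.
Qed.

Lemma piece_end_vertex t w : (t < p)%nat -> piece_end t w -> is_vertex X (ppoly L t) w ->
  (t = 0%nat /\ w = pA L 0) \/ (t = (p - 1)%nat /\ w = pB L (p - 1)).
Proof.
  intros Ht [->| ->] Hv.
  - destruct (Nat.eq_dec t 0) as [->|]; [now left|exfalso].
    destruct (entry_kin X Hwf L HL t ltac:(lia) Ht) as (Hk' & Hs' & HA).
    rewrite HA in Hv; exact (open_side_not_vertex X l0 Hwf HP1 Hmin _ _ _ Hk' Hs' Hv).
  - destruct (Nat.eq_dec (S t) p) as [E|]; [right; replace (p - 1)%nat with t by lia; now split|exfalso].
    destruct (exit_kout X Hwf L HL t ltac:(lia)) as (Hk' & Hs' & HB & _).
    rewrite HB in Hv; exact (open_side_not_vertex X l0 Hwf HP1 Hmin _ _ _ Hk' Hs' Hv).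
Qed.

(** The interior angle at the common vertex would have to be [PI]. *)
Lemma start_end_vertex : ppoly L 0 = ppoly L (p - 1) -> pA L 0 <> pB L (p - 1).
Proof.
  intros HP He; pose proof (sc_pos X L HL) as H0.
  destruct (start_vertex X L HL) as (a & Ha & HA).
  destruct (ends_height_ge 0 a H0) as [_ H1]; destruct (ends_height_ge (p - 1) a ltac:(lia)) as [H2 _].
  rewrite <- HP in H2.
  assert (Hz : height (PG (ppoly L 0)) a (pA L 0) = 0) by (rewrite HA; apply height_same_vertex).
  apply (Hns 0%nat H0); exists a; split; [trivial|split; trivial].
  pose proof (pdir_plam X L HL (p - 1) ltac:(lia)) as Hd; pose proof (plam_pos X L HL (p - 1) ltac:(lia)) as Hl.
  assert (EA : pA L (p - 1) = vsub (pA L 0) (vscale (plam L (p - 1)) (pdir L 0))).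
  { rewrite <- Hd, He, pdir_eq; veq. }
  set (i := ppoly L 0) in *.
  assert (HB : height (PG i) a (pB L 0) = cross (edge (vtx (PG i)) a) (pdir L 0)).
  { rewrite pdir_eq; unfold height in *; rewrite HA; vring. }
  rewrite EA in H2; unfold height in H2; rewrite HA in H2.
  replace (cross (edge (vtx (PG i)) a) (vsub (vsub (vtx (PG i) a) (vscale (plam L (p - 1)) (pdir L 0))) (vtx (PG i) a)))
    with (- (plam L (p - 1) * cross (edge (vtx (PG i)) a) (pdir L 0))) in H2 by vring.
  rewrite HB in *; nra.
Qed.

End Chords.

Section CornerTriangle.
Variables (l : R) (P : polygon).
Notation n := (length P).
Notation V := (vtx P).
Hypothesis HV : obtuse_cycle n l V.

(** In coordinates [X1], [Y1] along the two sides at [v] the last hypothesis becomes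
    [X1 * y + Y1 * x <= x * y]: the point is in the triangle cut off by [a] and [b]. Being on the
    boundary of the polygon, it must lie on one of the two sides. *)
Lemma corner_cut m x y w : (m < n)%nat -> 0 < x < 1 -> 0 < y < 1 -> in_poly P w ->
  (exists k, (k < n)%nat /\ height P k w = 0) ->
  let v := V (S m) in
  let a := vsub v (vscale x (edge V m)) in let b := vadd v (vscale y (edge V (S m))) in
  cross (vsub b a) (vsub w a) <= 0 ->
  w = v \/ (exists s, 0 < s < 1 /\ w = seg_pt (V m) (V (S m)) s) \/
  (exists s, 0 < s < 1 /\ w = seg_pt (V (S m)) (V (S (S m))) s).
Proof.
  intros Hm Hx Hy Hw (k & Hk & Hkw) v a b Hf.
  pose proof (oc_size _ _ _ HV) as Hn.
  pose proof (turn_left _ _ _ HV m) as Hkap.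
  pose proof (in_poly_height l P HV w Hw m) as H1; pose proof (in_poly_height l P HV w Hw (S m)) as H2.
  set (E := edge V m) in *; set (F := edge V (S m)) in *; set (kap := cross E F) in *.
  assert (H1' : height P m w = cross E (vsub w v)) by (unfold height, E, v, edge; vring).
  assert (H2' : height P (S m) w = cross F (vsub w v)) by reflexivity.
  set (X1 := height P (S m) w / kap); set (Y1 := height P m w / kap).
  assert (HX : X1 * kap = cross F (vsub w v)) by (unfold X1; rewrite H2'; field; lra).
  assert (HY : Y1 * kap = cross E (vsub w v)) by (unfold Y1; rewrite H1'; field; lra).
  assert (HX0 : 0 <= X1) by (apply Rmult_le_reg_r with kap; lra).
  assert (HY0 : 0 <= Y1) by (apply Rmult_le_reg_r with kap; lra).
  assert (Hwv : w = vadd (vsub v (vscale X1 E)) (vscale Y1 F)).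
  { assert (H0 : forall r s, (r - s) * kap = 0 -> r = s).
    { intros r s H; apply Rmult_integral in H as [H|H]; lra. }
    apply pt_eq; apply H0; unfold vadd, vsub, vscale; cbn [fst snd].
    - replace ((fst w - (fst v - X1 * fst E + Y1 * fst F)) * kap)
        with ((fst w - fst v) * kap + (X1 * kap) * fst E - (Y1 * kap) * fst F) by ring.
      rewrite HX, HY; unfold kap; vring.
    - replace ((snd w - (snd v - X1 * snd E + Y1 * snd F)) * kap)
        with ((snd w - snd v) * kap + (X1 * kap) * snd E - (Y1 * kap) * snd F) by ring.
      rewrite HX, HY; unfold kap; vring. }
  assert (Hfe : cross (vsub b a) (vsub w a) = (X1 * y + Y1 * x - x * y) * kap).
  { rewrite Hwv; unfold a, b, kap; vring. }
  assert (Hsum : X1 * y + Y1 * x <= x * y) by nra.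
  assert (Hzero : X1 = 0 \/ Y1 = 0).
  (* Otherwise the point is a convex combination of [v], [a], [b] with positive weights at [a] and
     [b]. These are inside two different sides, so one of them is strictly above side [k], and then
     so is the point. *)
  { destruct (Req_dec X1 0) as [|NX]; [now left|]. destruct (Req_dec Y1 0) as [|NY]; [now right|exfalso].
    assert (Ha : a = seg_pt (V m) (V (S m)) (1 - x)) by (unfold a, v, E, edge; veq).
    assert (Hb : b = seg_pt (V (S m mod n)) (V (S (S m mod n))) y).
    { rewrite vtx_mod, (vtx_mod_S P); unfold b, v, F, edge; veq. }
    assert (Hcomb : height P k w = (1 - X1 / x - Y1 / y) * height P k v
        + X1 / x * height P k a + Y1 / y * height P k b).
    { rewrite Hwv; unfold a, b, height.
      replace (cross (edge V k) (vsub (vadd (vsub v (vscale X1 E)) (vscale Y1 F)) (V k)))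
        with (cross (edge V k) (vsub v (V k)) - X1 * cross (edge V k) E + Y1 * cross (edge V k) F) by vring.
      replace (cross (edge V k) (vsub (vsub v (vscale x E)) (V k)))
        with (cross (edge V k) (vsub v (V k)) - x * cross (edge V k) E) by vring.
      replace (cross (edge V k) (vsub (vadd v (vscale y F)) (V k)))
        with (cross (edge V k) (vsub v (V k)) + y * cross (edge V k) F) by vring.
      field; lra. }
    assert (Hv : 0 <= height P k v) by apply (height_vertex l P HV).
    assert (Hc : 0 <= 1 - X1 / x - Y1 / y).
    { assert (He : (1 - X1 / x - Y1 / y) * (x * y) = x * y - (X1 * y + Y1 * x)) by (field; lra).
      apply Rmult_le_reg_r with (x * y); [nra|lra]. }
    assert (HXx : 0 < X1 / x) by (apply Rdiv_lt_0_compat; lra).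
    assert (HYy : 0 < Y1 / y) by (apply Rdiv_lt_0_compat; lra).
    assert (Hmn : (S m mod n < n)%nat) by (apply Nat.mod_upper_bound; lia).
    assert (Hmne : m <> (S m mod n)%nat).
    { intros He; destruct (Nat.eq_dec (S m) n) as [E1|E1].
      - rewrite E1, Nat.Div0.mod_same in He; lia.
      - rewrite Nat.mod_small in He; lia. }
    assert (Hge : forall r, 0 < r < 1 -> forall j, 0 <= height P k (seg_pt (V j) (V (S j)) r)).
    { intros r Hr j; rewrite height_seg.
      pose proof (height_vertex l P HV j k); pose proof (height_vertex l P HV (S j) k).
      assert (0 <= (1 - r) * height P k (V j)) by (apply Rmult_le_pos; lra).
      assert (0 <= r * height P k (V (S j))) by (apply Rmult_le_pos; lra). lra. }
    assert (Ha0 : 0 <= height P k a) by (rewrite Ha; apply Hge; lra).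
    assert (Hb0 : 0 <= height P k b) by (rewrite Hb; apply Hge; lra).
    assert (Hpos : 0 < height P k a \/ 0 < height P k b).
    { destruct (Nat.eq_dec k m) as [->|Hne].
      - right; rewrite Hb; apply (height_open_pos l P HV); trivial.
      - left; rewrite Ha; apply (height_open_pos l P HV); trivial; lra. }
    assert (0 <= (1 - X1 / x - Y1 / y) * height P k v) by now apply Rmult_le_pos.
    destruct Hpos as [Hpos|Hpos].
    - assert (0 < X1 / x * height P k a) by now apply Rmult_lt_0_compat.
      assert (0 <= Y1 / y * height P k b) by (apply Rmult_le_pos; lra). lra.
    - assert (0 < Y1 / y * height P k b) by now apply Rmult_lt_0_compat.
      assert (0 <= X1 / x * height P k a) by (apply Rmult_le_pos; lra). lra. }
  destruct Hzero as [HX1|HY1].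
  - destruct (Req_dec Y1 0) as [HY1|NY].
    + left; rewrite Hwv, HX1, HY1; veq.
    + right; right; exists Y1; split; [rewrite HX1 in Hsum; nra|].
      rewrite Hwv, HX1; unfold v, F, edge; veq.
  - destruct (Req_dec X1 0) as [HX1|NX].
    + left; rewrite Hwv, HX1, HY1; veq.
    + right; left; exists (1 - X1); split; [rewrite HY1 in Hsum; nra|].
      rewrite Hwv, HY1; unfold v, E, edge; veq.
Qed.

End CornerTriangle.

Definition corner_vertex X L t : pt :=
  if (S (kin X L t) mod length (polyg X (ppoly L t)) =? kout X L t)%nat
  then vtx (polyg X (ppoly L t)) (kout X L t) else vtx (polyg X (ppoly L t)) (kin X L t).

Section TwoChords.
Variables (X : surface) (l0 : R).
Hypothesis Hwf : wf_surface X.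
Hypothesis HP1 : P1 X.
Hypothesis HP2 : P2 X.
Hypothesis Hmin : is_min_side_length X l0.
Notation PG i := (polyg X i).
Notation len i := (length (polyg X i)).
Let Hcyc := polygon_cycle X l0 Hwf HP1 Hmin.

Variables La Lb : list piece.
Hypothesis HLa : is_saddle_connection X La.
Hypothesis HLb : is_saddle_connection X Lb.
Hypothesis Hna : nonside X La.
Hypothesis Hnb : nonside X Lb.
Notation p := (length La).
Notation q := (length Lb).
Notation ua := (pdir La 0).
Notation ub := (pdir Lb 0).

Lemma affine_le (d z : pt) u s' : 0 <= s' <= 1 -> z = ppt Lb u s' ->
  exists w, piece_end Lb u w /\ cross d (vsub w z) <= 0.
Proof.
  intros Hs ->.
  assert (Hz : (1 - s') * cross d (vsub (pA Lb u) (ppt Lb u s')) + s' * cross d (vsub (pB Lb u) (ppt Lb u s')) = 0)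
    by (unfold ppt; vring).
  destruct (Rle_lt_dec (cross d (vsub (pA Lb u) (ppt Lb u s'))) 0).
  - exists (pA Lb u); split; [now left|trivial].
  - exists (pB Lb u); split; [now right|].
    destruct (Rle_lt_dec (cross d (vsub (pB Lb u) (ppt Lb u s'))) 0); trivial; exfalso.
    destruct (Req_dec s' 0) as [->|]; [lra|]. nra.
Qed.

(** The piece of [b] meets the line of the corner piece, so one of its ends is on the side of the
    corner vertex, in the triangle that is cut off; [corner_cut] locates this end. *)
Lemma corner_touch t u s s' : (t < p)%nat -> (u < q)%nat -> ppoly La t = ppoly Lb u ->
  0 <= s <= 1 -> 0 <= s' <= 1 -> ppt La t s = ppt Lb u s' -> corner X La t = true ->
  exists w, piece_end Lb u w /\
   (w = corner_vertex X La t \/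
    exists k r, (k = kin X La t \/ k = kout X La t) /\ valid_side X (ppoly La t) k /\ 0 < r < 1 /\
      w = side_pt X (ppoly La t) k r).
Proof.
  intros Ht Hu HP Hs Hs' Hz Hc.
  apply corner_spec in Hc as (H0 & H1 & Hc).
  destruct (exit_kout X Hwf La HLa t H1) as ((Hi & Hk) & Hso & HB & _).
  destruct (entry_kin X Hwf La HLa t H0 Ht) as ((_ & Hk') & Hsi & HA).
  pose proof (Hcyc _ Hi) as HV.
  assert (Hin : forall w, piece_end Lb u w -> in_poly (PG (ppoly La t)) w /\
            exists k, (k < len (ppoly La t))%nat /\ height (PG (ppoly La t)) k w = 0).
  { intros w Hw; rewrite HP; split.
    - destruct Hw as [->| ->]; [now apply (pA_in X Lb HLb)|now apply (pB_in X Lb HLb)].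
    - now apply (piece_end_height X Hwf Lb HLb). }
  assert (Hsucc : forall k r, (k < len (ppoly La t))%nat ->
     seg_pt (vtx (PG (ppoly La t)) (S k)) (vtx (PG (ppoly La t)) (S (S k))) r
     = side_pt X (ppoly La t) (S k mod len (ppoly La t)) r).
  { intros k r _; unfold side_pt; now rewrite vtx_mod, (vtx_mod_S (PG (ppoly La t))). }
  unfold corner_vertex.
  destruct Hc as [Hc|Hc].
  - destruct (cornerA_eq X l0 Hwf HP1 Hmin La HLa t H0 H1 Hc) as (Hv & Hd & _).
    destruct (affine_le (pdir La t) _ u s' Hs' Hz) as (w & Hw & Hle).
    exists w; split; trivial; destruct (Hin w Hw) as [Hwp Hwk].
    destruct (corner_cut l0 _ HV (kin X La t) (1 - sin_ X La t) (sout X La t) w Hk' ltac:(lra) ltac:(lra) Hwp Hwk)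
      as [E|[(r & Hr & E)|(r & Hr & E)]].
    + unfold cornerA in Hc.
      assert (Ea : vsub (vtx (PG (ppoly La t)) (S (kin X La t)))
           (vscale (1 - sin_ X La t) (edge (vtx (PG (ppoly La t))) (kin X La t))) = pA La t)
        by (rewrite HA; unfold side_pt, edge; veq).
      assert (Eb : vadd (vtx (PG (ppoly La t)) (S (kin X La t)))
           (vscale (sout X La t) (edge (vtx (PG (ppoly La t))) (S (kin X La t)))) = pB La t).
      { rewrite HB, <- Hc, <- Hsucc by trivial. unfold edge; veq. }
      rewrite Ea, Eb, <- pdir_eq.
      assert (Ez : cross (pdir La t) (vsub w (pA La t)) = cross (pdir La t) (vsub w (ppt La t s)))
        by (rewrite pdir_eq; unfold ppt; vring).
      rewrite Ez; exact Hle.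
    + left; rewrite E; unfold cornerA in Hc; rewrite Hc, Nat.eqb_refl; exact Hv.
    + right; exists (kin X La t), r; repeat split; try apply Hr; trivial; now left.
    + right; exists (kout X La t), r; repeat split; try apply Hr; trivial; [now right|].
      rewrite Hsucc in E by trivial; unfold cornerA in Hc; now rewrite Hc in E.
  - destruct (cornerB_eq X l0 Hwf HP1 Hmin La HLa t H0 H1 Hc) as (Hv & Hd & _).
    destruct (affine_le (vscale (-1) (pdir La t)) _ u s' Hs' Hz) as (w & Hw & Hle).
    exists w; split; trivial; destruct (Hin w Hw) as [Hwp Hwk].
    destruct (corner_cut l0 _ HV (kout X La t) (1 - sout X La t) (sin_ X La t) w Hk ltac:(lra) ltac:(lra) Hwp Hwk)
      as [E|[(r & Hr & E)|(r & Hr & E)]].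
    + unfold cornerB in Hc.
      assert (Ea : vsub (vtx (PG (ppoly La t)) (S (kout X La t)))
           (vscale (1 - sout X La t) (edge (vtx (PG (ppoly La t))) (kout X La t))) = pB La t)
        by (rewrite HB; unfold side_pt, edge; veq).
      assert (Eb : vadd (vtx (PG (ppoly La t)) (S (kout X La t)))
           (vscale (sin_ X La t) (edge (vtx (PG (ppoly La t))) (S (kout X La t)))) = pA La t).
      { rewrite HA, <- Hc, <- Hsucc by trivial. unfold edge; veq. }
      rewrite Ea, Eb.
      assert (Ez : cross (vsub (pA La t) (pB La t)) (vsub w (pB La t))
          = cross (vscale (-1) (pdir La t)) (vsub w (ppt La t s)))
        by (rewrite pdir_eq; unfold ppt; vring).
      rewrite Ez; exact Hle.
    (* Two sides that follow each other in both orders would leave room for two sides only. *)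
    + left; rewrite E; destruct (_ =? _)%nat eqn:Eq; [|exact Hv].
      exfalso; apply Nat.eqb_eq in Eq; unfold cornerB in Hc.
      pose proof (four_sides _ _ _ HV).
      rewrite <- Eq in Hc.
      rewrite <- (Nat.add_1_r (S _ mod _)), Nat.Div0.add_mod_idemp_l in Hc.
      destruct (le_lt_dec (len (ppoly La t)) (S (kin X La t) + 1)) as [Hge|Hlt].
      * replace (S (kin X La t) + 1)%nat with ((kin X La t + 2 - len (ppoly La t)) + 1 * len (ppoly La t))%nat in Hc by lia.
        rewrite Nat.Div0.mod_add, Nat.mod_small in Hc; lia.
      * rewrite Nat.mod_small in Hc; lia.
    + right; exists (kout X La t), r; repeat split; try apply Hr; trivial; now right.
    + right; exists (kin X La t), r; repeat split; try apply Hr; trivial; [now left|].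
      rewrite Hsucc in E by trivial; unfold cornerB in Hc; now rewrite Hc in E.
Qed.

Lemma corner_vertex_vertex t : corner X La t = true -> is_vertex X (ppoly La t) (corner_vertex X La t).
Proof.
  intros Hc; apply corner_spec in Hc as (H0 & H1 & _).
  destruct (exit_kout X Hwf La HLa t H1) as ((Hi & Hk) & _).
  destruct (entry_kin X Hwf La HLa t H0 ltac:(lia)) as ((_ & Hk') & _).
  unfold corner_vertex; destruct (_ =? _)%nat; [exists (kout X La t)|exists (kin X La t)]; now split.
Qed.

(** If the point is inside a side, the two connections may describe it in different polygons. Then
    it is an end of the piece of [b], and the neighbouring piece of [b] shows it in the polygon used
    by [a]. *)
Lemma common_point x : ~ singular X x -> sc_mem X La x -> sc_mem X Lb x ->
  exists t u s s', (t < p)%nat /\ (u < q)%nat /\ 0 <= s <= 1 /\ 0 <= s' <= 1 /\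
    ppoly La t = ppoly Lb u /\ ppt La t s = ppt Lb u s' /\
    same_pt X x (ppoly La t, ppt La t s) /\ ~ is_vertex X (ppoly La t) (ppt La t s).
Proof.
  intros Hsx (t & s & Ht & Hs & Hx) (u & s' & Hu & Hs' & Hx').
  assert (Hnv : ~ is_vertex X (ppoly La t) (ppt La t s)).
  { intros Hv; apply Hsx; eexists; split; [exact Hx|exact Hv]. }
  assert (Hnv' : ~ is_vertex X (ppoly Lb u) (ppt Lb u s')).
  { intros Hv; apply Hsx; eexists; split; [exact Hx'|exact Hv]. }
  assert (Hsame : same_pt X (ppoly La t, ppt La t s) (ppoly Lb u, ppt Lb u s'))
    by (eapply rst_trans; [apply rst_sym; exact Hx|exact Hx']).
  destruct (same_pt_class X l0 Hwf HP1 Hmin (ppoly La t, ppt La t s) _ Hnv Hsame) as [He|Hp].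
  - assert (E1 := f_equal fst He); assert (E2 := f_equal snd He); cbn [fst snd] in E1, E2.
    exists t, u, s, s'; repeat split; trivial; try lra; now symmetry.
  - apply (partner_sym X Hwf) in Hp; pose proof Hp as (k & r & Hk & Hr & Hz & Hq); cbn [fst snd] in *.
    assert (Hend : s' = 0 \/ s' = 1).
    { destruct (Req_dec s' 0); [now left|]; destruct (Req_dec s' 1); [now right|exfalso].
      pose proof (interior_height_pos X l0 Hwf HP1 Hmin Lb HLb Hnb u k s' Hu (proj2 Hk) ltac:(lra)) as Hpos.
      rewrite Hz, height_side_pt in Hpos; lra. }
    assert (Hex : exists u' r', (u' < q)%nat /\ 0 <= r' <= 1 /\
       partner X (ppoly Lb u, ppt Lb u s') (ppoly Lb u', ppt Lb u' r')).
    { destruct Hend as [->| ->].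
      - assert (Hu0 : u <> 0%nat).
        { intros ->; apply Hnv'; unfold ppt; rewrite seg_0; destruct (start_vertex X Lb HLb) as (a & Ha & HA).
          exists a; now split. }
        exists (u - 1)%nat, 1; split; [lia|split; [lra|]].
        destruct (exit_kout X Hwf Lb HLb (u - 1) ltac:(lia)) as (Ek & Es & EB & EP & EA).
        replace (S (u - 1)) with u in * by lia.
        unfold ppt; rewrite seg_0, seg_1; apply (partner_sym X Hwf).
        exists (kout X Lb (u - 1)), (sout X Lb (u - 1)); cbn [fst snd].
        split; [trivial|split; [trivial|split; [trivial|]]]; now rewrite EP, EA.
      - assert (Hu0 : S u <> q).
        { intros E; apply Hnv'; unfold ppt; rewrite seg_1; destruct (end_vertex X Lb HLb) as (b & Hb & HB).
          replace (q - 1)%nat with u in Hb, HB by lia; exists b; now split. }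
        exists (S u), 0; split; [lia|split; [lra|]].
        destruct (exit_kout X Hwf Lb HLb u ltac:(lia)) as (Ek & Es & EB & EP & EA).
        unfold ppt; rewrite seg_0, seg_1.
        exists (kout X Lb u), (sout X Lb u); cbn [fst snd].
        split; [trivial|split; [trivial|split; [trivial|]]]; now rewrite EP, EA. }
    destruct Hex as (u' & r' & Hu' & Hr' & Hpart).
    pose proof (partner_fun X l0 Hwf HP1 Hmin _ _ _ Hp Hpart) as He.
    assert (E1 := f_equal fst He); assert (E2 := f_equal snd He); cbn [fst snd] in E1, E2.
    exists t, u', s, r'; repeat split; trivial; lra.
Qed.

(** The corner piece is [t - 1]. Not being in the cover, it hands the pair over to its successor
    [t], which is; the piece [u] remains in the polygon of [t - 1]. *)
Definition extra_pair (t u : nat) : Prop := (0 < t)%nat /\ cover (corner X La) (t - 1) = false /\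
  ppoly La (t - 1) = ppoly Lb u /\
  ((u = 0%nat /\ pA Lb 0 = corner_vertex X La (t - 1)) \/
   (u = (q - 1)%nat /\ pB Lb (q - 1) = corner_vertex X La (t - 1))).

Lemma extra_pair_unique t u u' : extra_pair t u -> extra_pair t u' -> u = u'.
Proof.
  intros (H0 & _ & HP & Hu) (_ & _ & HP' & Hu').
  pose proof (start_end_vertex X l0 Hwf HP1 Hmin Lb HLb Hnb) as Hne.
  destruct Hu as [[-> Eu]|[-> Eu]], Hu' as [[-> Eu']|[-> Eu']]; trivial; exfalso.
  - apply Hne; congruence.
  - apply Hne; congruence.
Qed.

(** The point at time [sg] on the whole line of [a], in the frame of piece [t], lies on the whole
    line of [b], in the frame of piece [u]. As times are not confined to the pieces, the relation
    survives when both connections are followed across the same side. *)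
Definition unfolded_meet (sg : R) (t u : nat) : Prop := exists sg',
  vsub (vadd (pA La 0) (vscale sg ua)) (poff La t) = vsub (vadd (pA Lb 0) (vscale sg' ub)) (poff Lb u).

(** The pair of pieces to which a common point is charged. *)
Definition charged (x : xpt) (tu : nat * nat) : Prop := exists t s, (t < p)%nat /\ 0 <= s <= 1 /\
  same_pt X x (ppoly La t, ppt La t s) /\
  (fst tu < p)%nat /\ cover (corner X La) (fst tu) = true /\ (snd tu < q)%nat /\
  ((ppoly La (fst tu) = ppoly Lb (snd tu) /\ unfolded_meet (ptime La t s) (fst tu) (snd tu)) \/
   (extra_pair (fst tu) (snd tu) /\ unfolded_meet (ptime La t s) (fst tu - 1) (snd tu))).

Lemma cover_corner_false t : (t < p)%nat -> cover (corner X La) t = false ->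
  (0 < t)%nat /\ (S t < p)%nat /\ corner X La t = true /\
  cover (corner X La) (t - 1) = true /\ cover (corner X La) (S t) = true.
Proof.
  intros Ht E; destruct t as [|t]; [discriminate|].
  pose proof E as E'; simpl in E; apply Bool.orb_false_iff in E as [E1 E2].
  apply Bool.negb_false_iff in E1, E2.
  pose proof E1 as E1'; apply corner_spec in E1' as (H1 & H2 & _).
  split; [trivial|split; [trivial|split; [trivial|]]].
  replace (S t - 1)%nat with t by lia; split; trivial.
  change (cover (corner X La) (S (S t)))
    with (negb (corner X La (S (S t))) || negb (cover (corner X La) (S t)))%bool.
  rewrite E'; simpl; apply Bool.orb_true_r.
Qed.

Lemma charged_exists x : ~ singular X x -> sc_mem X La x -> sc_mem X Lb x -> exists tu, charged x tu.
Proof.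
  intros Hsx Hxa Hxb.
  destruct (common_point x Hsx Hxa Hxb) as (t & u & s & s' & Ht & Hu & Hs & Hs' & HP & Hz & Hx & Hnv).
  assert (Hmeet : unfolded_meet (ptime La t s) t u).
  { exists (ptime Lb u s').
    rewrite <- (ppt_unfold X La HLa t s Ht), <- (ppt_unfold X Lb HLb u s' Hu), Hz; veq. }
  destruct (cover (corner X La) t) eqn:ET.
  { exists (t, u), t, s; cbn [fst snd]; repeat split; trivial; try lra; left; now split. }
  destruct (cover_corner_false t Ht ET) as (H0 & H1 & Hc & ETm & ETp).
  destruct (corner_touch t u s s' Ht Hu HP Hs Hs' Hz Hc) as (w & Hw & [Hv|(k & r & Hk & Hkv & Hr & Hwk)]).
  - exists (S t, u), t, s; cbn [fst snd]; repeat split; trivial; try lra; right.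
    replace (S t - 1)%nat with t by lia; split; trivial.
    unfold extra_pair; replace (S t - 1)%nat with t by lia.
    split; [lia|split; [trivial|split; [trivial|]]].
    pose proof (corner_vertex_vertex t Hc) as Hvv; rewrite HP in Hvv; rewrite <- Hv in Hvv |- *.
    destruct (piece_end_vertex X l0 Hwf HP1 Hmin Lb HLb u w Hu Hw Hvv) as [[-> ->]|[-> ->]];
      [left|right]; now split.
  - rewrite HP in Hkv, Hwk.
    destruct (piece_end_across X l0 Hwf HP1 Hmin Lb HLb u w k r Hu Hw Hkv Hr Hwk) as (u' & Hacb).
    (* Both neighbours of a piece missing from the cover belong to it, so the charge can move across
       either side of the corner. *)
    assert (Haca : exists t', across X La t k t' /\ cover (corner X La) t' = true).
    { destruct Hk as [->| ->].
      - exists (t - 1)%nat; split; trivial; right; repeat split; trivial; lia.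
      - exists (S t); split; trivial; left; repeat split; trivial; lia. }
    destruct Haca as (t' & Haca & ET').
    destruct (across_facts X Hwf La HLa t k t' Haca) as (Ht' & HPa & Hoa).
    destruct (across_facts X Hwf Lb HLb u k u' Hacb) as (Hu' & HPb & Hob).
    exists (t', u'), t, s; cbn [fst snd]; repeat split; trivial; try lra; left; split.
    + rewrite HPa, HPb, HP; reflexivity.
    + destruct Hmeet as (sg' & Hm); exists sg'; rewrite Hoa, Hob, HP.
      assert (E1 := f_equal fst Hm); assert (E2 := f_equal snd Hm).
      apply pt_eq; vunf; lra.
Qed.

Lemma unfolded_meet_unique sg1 sg2 t u : cross ua ub <> 0 -> unfolded_meet sg1 t u -> unfolded_meet sg2 t u ->
  sg1 = sg2.
Proof.
  intros Hc (r1 & E1) (r2 & E2).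
  assert (Hz : (sg1 - sg2) * cross ua ub = 0).
  { replace ((sg1 - sg2) * cross ua ub)
      with (cross (vsub (vsub (vadd (pA La 0) (vscale sg1 ua)) (poff La t))
                        (vsub (vadd (pA La 0) (vscale sg2 ua)) (poff La t))) ub) by vring.
    rewrite E1, E2; vring. }
  apply Rmult_integral in Hz as [Hz|Hz]; [lra|contradiction].
Qed.

Lemma charged_inj x y tu : cross ua ub <> 0 -> charged x tu -> charged y tu -> same_pt X x y.
Proof.
  intros Hc (t & s & Ht & Hs & Hx & H1 & H2 & H3 & Hor) (t' & s' & Ht' & Hs' & Hy & _ & _ & _ & Hor').
  (* A pair cannot be both ordinary and extra: [b] would lie in the polygons of two consecutive
     pieces of [a]. *)
  assert (Hex : forall a b, (a < p)%nat -> ppoly La a = ppoly Lb b -> extra_pair a b -> False).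
  { intros a b Ha HP (H0 & _ & HP' & _).
    apply (next_polygon X Hwf HP2 La HLa (a - 1) ltac:(lia)).
    replace (S (a - 1)) with a by lia; congruence. }
  assert (Heq : ptime La t s = ptime La t' s').
  { destruct Hor as [[HP Hm]|[He Hm]], Hor' as [[HP' Hm']|[He' Hm']].
    - exact (unfolded_meet_unique _ _ _ _ Hc Hm Hm').
    - exfalso; now apply (Hex (fst tu) (snd tu)).
    - exfalso; now apply (Hex (fst tu) (snd tu)).
    - exact (unfolded_meet_unique _ _ _ _ Hc Hm Hm'). }
  eapply rst_trans; [exact Hx|].
  eapply rst_trans; [|apply rst_sym; exact Hy].
  now apply (ptime_same_pt X Hwf La HLa).
Qed.

(** One displacement moves both parameters into the open interval; at the ends, the alternatives say
    that both have to move inwards together. The constant [c] keeps each move within one half. *)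
Lemma small_step (ka mu s s' : R) : 0 < ka -> 0 <= s <= 1 -> 0 <= s' <= 1 ->
  (0 < s < 1 /\ 0 < s' < 1) \/ (s = 0 /\ s' = 0 /\ 0 < mu) \/ (s = 0 /\ s' = 1 /\ mu < 0) \/
  (s = 1 /\ s' = 1 /\ 0 < mu) \/ (s = 1 /\ s' = 0 /\ mu < 0) ->
  exists eta, eta <> 0 /\ 0 < s + eta * ka < 1 /\ 0 < s' + eta * mu < 1.
Proof.
  intros Hka Hs Hs' Hor.
  set (c := / (2 * ka + 2 * Rabs mu)); pose proof (Rabs_pos mu) as Hm.
  assert (Hden : 0 < 2 * ka + 2 * Rabs mu) by lra.
  assert (Hc : 0 < c) by (apply Rinv_0_lt_compat; trivial).
  assert (Hcd : c * (2 * ka + 2 * Rabs mu) = 1) by (unfold c; field; lra).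
  assert (H1 : 0 < c * ka) by (apply Rmult_lt_0_compat; trivial).
  assert (Hmu : mu <= Rabs mu /\ - mu <= Rabs mu).
  { split; [apply Rle_abs|]. rewrite <- Rabs_Ropp; apply Rle_abs. }
  assert (H3 : - (c * Rabs mu) <= c * mu <= c * Rabs mu) by (split; nra).
  destruct Hor as [[I1 I2]|[(-> & -> & Hp)|[(-> & -> & Hp)|[(-> & -> & Hp)|(-> & -> & Hp)]]]].
  - set (m := Rmin (Rmin s (1 - s)) (Rmin s' (1 - s'))).
    assert (Hm1 : 0 < m) by (unfold m; repeat apply Rmin_glb_lt; lra).
    assert (Hm2 : m <= s /\ m <= 1 - s /\ m <= s' /\ m <= 1 - s').
    { unfold m; repeat split.
      - eapply Rle_trans; [apply Rmin_l|apply Rmin_l].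
      - eapply Rle_trans; [apply Rmin_l|apply Rmin_r].
      - eapply Rle_trans; [apply Rmin_r|apply Rmin_l].
      - eapply Rle_trans; [apply Rmin_r|apply Rmin_r]. }
    exists (c * m); split; [nra|].
    replace (c * m * ka) with (m * (c * ka)) by ring; replace (c * m * mu) with (m * (c * mu)) by ring.
    split; split; nra.
  - exists c; split; [lra|]; assert (0 < c * mu) by nra; split; lra.
  - exists c; split; [lra|]; assert (c * mu < 0) by nra; split; lra.
  - exists (- c); split; [lra|]; assert (0 < c * mu) by nra; split; lra.
  - exists (- c); split; [lra|]; assert (c * mu < 0) by nra; split; lra.
Qed.

Lemma end_of_boundary_point L (HL : is_saddle_connection X L) (Hn : nonside X L) t s k :
  (t < length L)%nat -> 0 <= s <= 1 -> (k < len (ppoly L t))%nat ->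
  height (PG (ppoly L t)) k (ppt L t s) = 0 ->
  (s = 0 /\ 0 < cross (edge (vtx (PG (ppoly L t))) k) (pdir L 0)) \/
  (s = 1 /\ cross (edge (vtx (PG (ppoly L t))) k) (pdir L 0) < 0).
Proof.
  intros Ht Hs Hk Hz.
  pose proof (fun r => interior_height_pos X l0 Hwf HP1 Hmin L HL Hn t k r Ht Hk) as Hint.
  pose proof (pdir_plam X L HL t Ht) as Hd; pose proof (plam_pos X L HL t Ht) as Hl.
  assert (Hdiff : forall r, height (PG (ppoly L t)) k (ppt L t r) =
     (r - s) * plam L t * cross (edge (vtx (PG (ppoly L t))) k) (pdir L 0)).
  { intros r.
    replace (height (PG (ppoly L t)) k (ppt L t r)) with
      (height (PG (ppoly L t)) k (ppt L t r) - height (PG (ppoly L t)) k (ppt L t s)) by lra.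
    transitivity ((r - s) * cross (edge (vtx (PG (ppoly L t))) k) (pdir L t)).
    - rewrite pdir_eq; unfold height, ppt; vring.
    - rewrite Hd; vring. }
  destruct (Req_dec s 0) as [->|N0]; [|destruct (Req_dec s 1) as [->|N1]].
  - left; split; trivial. specialize (Hint (1/2) ltac:(lra)); rewrite Hdiff in Hint.
    apply Rmult_lt_reg_l with ((1/2 - 0) * plam L t); nra.
  - right; split; trivial. specialize (Hint (1/2) ltac:(lra)); rewrite Hdiff in Hint.
    apply Rmult_lt_reg_l with ((1 - 1/2) * plam L t); nra.
  - exfalso; specialize (Hint s ltac:(lra)); lra.
Qed.

(** Collinear pieces overlap, so that two connections with a common point have infinitely many. *)
Lemma parallel_overlap x : cross ua ub = 0 -> ~ singular X x -> sc_mem X La x -> sc_mem X Lb x ->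
  exists i z d, 0 < dot d d /\ forall r, 0 < r < 1 ->
    sc_mem X La (i, vadd z (vscale r d)) /\ sc_mem X Lb (i, vadd z (vscale r d)) /\
    ~ is_vertex X i (vadd z (vscale r d)) /\
    forall k, (k < len i)%nat -> height (PG i) k (vadd z (vscale r d)) <> 0.
Proof.
  intros Hpar Hsx Hxa Hxb.
  destruct (common_point x Hsx Hxa Hxb) as (t & u & s & s' & Ht & Hu & Hs & Hs' & HP & Hz & Hx & Hnv).
  pose proof (pdir_plam X La HLa t Ht) as Hda; pose proof (plam_pos X La HLa t Ht) as Hla.
  pose proof (pdir_plam X Lb HLb u Hu) as Hdb; pose proof (plam_pos X Lb HLb u Hu) as Hlb.
  pose proof (u_sqr_pos X La HLa) as Hua; pose proof (u_sqr_pos X Lb HLb) as Hub.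
  set (c := dot ua ub / dot ub ub).
  assert (Huc : ua = vscale c ub).
  { assert (Hc : c * dot ub ub = dot ua ub) by (unfold c; field; lra).
    assert (H0 : forall a b, (a - b) * dot ub ub = 0 -> a = b).
    { intros a b H; apply Rmult_integral in H as [H|H]; lra. }
    apply pt_eq; apply H0; unfold vscale; cbn [fst snd].
    - replace ((fst ua - c * fst ub) * dot ub ub) with (fst ua * dot ub ub - (c * dot ub ub) * fst ub) by ring.
      rewrite Hc; replace (fst ua * dot ub ub - dot ua ub * fst ub) with (snd ub * cross ua ub) by vring.
      rewrite Hpar; ring.
    - replace ((snd ua - c * snd ub) * dot ub ub) with (snd ua * dot ub ub - (c * dot ub ub) * snd ub) by ring.
      rewrite Hc; replace (snd ua * dot ub ub - dot ua ub * snd ub) with (- fst ub * cross ua ub) by vring.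
      rewrite Hpar; ring. }
  assert (Hcase : (0 < s < 1 /\ 0 < s' < 1) \/ (s = 0 /\ s' = 0 /\ 0 < c / plam Lb u) \/
     (s = 0 /\ s' = 1 /\ c / plam Lb u < 0) \/ (s = 1 /\ s' = 1 /\ 0 < c / plam Lb u) \/
     (s = 1 /\ s' = 0 /\ c / plam Lb u < 0)).
  { assert (Hpos : 0 < c -> 0 < c / plam Lb u) by (intros; now apply Rdiv_lt_0_compat).
    assert (Hneg : c < 0 -> c / plam Lb u < 0) by (intros; now apply Rdiv_neg_pos).
    destruct (classic (exists k, (k < len (ppoly La t))%nat /\ height (PG (ppoly La t)) k (ppt La t s) = 0))
      as [(k & Hk & Hkz)|Hno].
    - pose proof (end_of_boundary_point La HLa Hna t s k Ht Hs Hk Hkz) as HA.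
      rewrite Hz in Hkz; rewrite HP in Hk, Hkz, HA.
      pose proof (end_of_boundary_point Lb HLb Hnb u s' k Hu Hs' Hk Hkz) as HB.
      assert (Hcr : cross (edge (vtx (PG (ppoly Lb u))) k) ua = c * cross (edge (vtx (PG (ppoly Lb u))) k) ub)
        by (rewrite Huc; vring).
      rewrite Hcr in HA.
      destruct HA as [[-> HA]|[-> HA]], HB as [[-> HB]|[-> HB]].
      + right; left; repeat split; trivial; apply Hpos; nra.
      + right; right; left; repeat split; trivial; apply Hneg; nra.
      + right; right; right; right; repeat split; trivial; apply Hneg; nra.
      + right; right; right; left; repeat split; trivial; apply Hpos; nra.
    - left.
      assert (I1 : 0 < s < 1).
      { destruct (Req_dec s 0) as [->|].
        { exfalso; apply Hno; apply (piece_end_height X Hwf La HLa t _ Ht); left; unfold ppt; apply seg_0. }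
        destruct (Req_dec s 1) as [->|]; [|lra].
        exfalso; apply Hno; apply (piece_end_height X Hwf La HLa t _ Ht); right; unfold ppt; apply seg_1. }
      split; trivial; rewrite Hz, HP in Hno.
      destruct (Req_dec s' 0) as [->|].
      { exfalso; apply Hno; apply (piece_end_height X Hwf Lb HLb u _ Hu); left; unfold ppt; apply seg_0. }
      destruct (Req_dec s' 1) as [->|]; [|lra].
      exfalso; apply Hno; apply (piece_end_height X Hwf Lb HLb u _ Hu); right; unfold ppt; apply seg_1. }
  destruct (small_step (/ plam La t) (c / plam Lb u) s s' (Rinv_0_lt_compat _ Hla) Hs Hs' Hcase)
    as (eta & He0 & HeA & HeB).
  exists (ppoly La t), (ppt La t s), (vscale eta ua); split.
  { replace (dot (vscale eta ua) (vscale eta ua)) with (eta * eta * dot ua ua) by vring.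
    apply Rmult_lt_0_compat; trivial. nra. }
  intros r Hr.
  assert (EA : vadd (ppt La t s) (vscale r (vscale eta ua)) = ppt La t (s + r * (eta * / plam La t))).
  { assert (H1 : forall r', ppt La t r' = vadd (pA La t) (vscale r' (pdir La t)))
      by (intros; rewrite pdir_eq; unfold ppt; veq).
    rewrite !H1, Hda; apply pt_eq; unfold vadd, vscale; cbn [fst snd]; field; lra. }
  assert (EB : vadd (ppt La t s) (vscale r (vscale eta ua)) = ppt Lb u (s' + r * (eta * (c / plam Lb u)))).
  { assert (H1 : forall r', ppt Lb u r' = vadd (pA Lb u) (vscale r' (pdir Lb u)))
      by (intros; rewrite pdir_eq; unfold ppt; veq).
    rewrite Hz, !H1, Hdb, Huc; apply pt_eq; unfold vadd, vscale; cbn [fst snd]; field; lra. }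
  assert (IA : 0 < s + r * (eta * / plam La t) < 1) by nra.
  assert (IB : 0 < s' + r * (eta * (c / plam Lb u)) < 1) by nra.
  split; [|split; [|split]].
  - exists t, (s + r * (eta * / plam La t)); split; [trivial|split; [lra|]].
    rewrite EA; apply rst_refl.
  - exists u, (s' + r * (eta * (c / plam Lb u))); split; [trivial|split; [lra|]].
    rewrite EB; fold (ppoly Lb u); rewrite <- HP; apply rst_refl.
  - rewrite EA; now apply (interior_not_vertex X La HLa).
  - intros k Hk; rewrite EA.
    pose proof (interior_height_pos X l0 Hwf HP1 Hmin La HLa Hna t k _ Ht Hk IA); lra.
Qed.

Lemma parallel_no_common n : cross ua ub = 0 -> ~ sc_eq X La Lb -> inter_count X La Lb n -> n = 0%nat.
Proof.
  intros Hpar Hne [[He _]|[_ (ps & Hlen & Hps & Hdist & Hall)]]; [contradiction|].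
  destruct n as [|n]; trivial; exfalso.
  destruct ps as [|x ps']; [discriminate|]; set (ps := x :: ps') in *.
  destruct (Hps x (or_introl eq_refl)) as (Hxa & Hxb & Hsx).
  destruct (parallel_overlap x Hpar Hsx Hxa Hxb) as (i & z & d & Hd & Hov).
  set (rr := fun m : nat => / INR (S (S m))).
  assert (Hrr : forall m, 0 < rr m < 1).
  { intros m; unfold rr; assert (1 < INR (S (S m))) by (rewrite !S_INR; pose proof (pos_INR m); lra).
    split; [apply Rinv_0_lt_compat; lra|]. rewrite <- Rinv_1; apply Rinv_lt_contravar; lra. }
  set (g := fun m => (i, vadd z (vscale (rr m) d))).
  assert (Hch : forall m, exists y, In y ps /\ same_pt X (g m) y).
  { intros m; destruct (Hov (rr m) (Hrr m)) as (Ha & Hb & Hnv & _).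
    apply Hall; trivial; now apply (not_singular_iff X l0 Hwf HP1 Hmin). }
  set (h := fun m => epsilon (inhabits x) (fun y => In y ps /\ same_pt X (g m) y)).
  assert (Hh : forall m, In (h m) ps /\ same_pt X (g m) (h m))
    by (intros m; apply (epsilon_spec (inhabits x) (fun y => In y ps /\ same_pt X (g m) y)), Hch).
  assert (Hinj : forall m m', h m = h m' -> m = m').
  { intros m m' E; destruct (Hh m) as [_ E1]; destruct (Hh m') as [_ E2]; rewrite E in E1.
    destruct (Hov (rr m) (Hrr m)) as (_ & _ & Hnv & Hhe).
    assert (Hs : same_pt X (g m) (g m')) by (eapply rst_trans; [exact E1|apply rst_sym; exact E2]).
    destruct (same_pt_class X l0 Hwf HP1 Hmin (g m) _ Hnv Hs) as [Heq|(k & s & Hk & _ & Hz & _)].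
    - apply (f_equal snd) in Heq; cbn [snd g] in Heq.
      assert (Hr : (rr m' - rr m) * dot d d = 0).
      { replace ((rr m' - rr m) * dot d d)
          with (dot (vsub (vadd z (vscale (rr m') d)) (vadd z (vscale (rr m) d))) d) by vring.
        unfold g in Heq; cbn [snd] in Heq; rewrite Heq; vring. }
      apply Rmult_integral in Hr as [Hr|Hr]; [|lra].
      assert (Hi : rr m = rr m') by lra; unfold rr in Hi; apply Rinv_eq_reg in Hi.
      apply INR_eq in Hi; lia.
    - exfalso; unfold g in Hz, Hk; cbn [fst snd] in Hz, Hk.
      apply (Hhe k (proj2 Hk)); rewrite Hz; apply height_side_pt. }
  (* At this point [ps] has [S n] elements, and [S (S n)] different points are mapped into it
     injectively. *)
  assert (Hnd : NoDup (map h (seq 0 (S (S n))))).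
  { apply FinFun.Injective_map_NoDup; [exact Hinj|apply seq_NoDup]. }
  assert (Hincl : incl (map h (seq 0 (S (S n)))) ps).
  { intros y Hy; apply in_map_iff in Hy as (m & <- & _); apply Hh. }
  pose proof (NoDup_incl_length Hnd Hincl) as Hlen'.
  rewrite length_map, length_seq in Hlen'; lia.
Qed.

End TwoChords.

(** * Two connections that are not sides *)

(** The sign of [cross g (vsub y x)] decides which of the two outer pieces passes a whole edge of
    the arc between the sides. That piece has a leg of length [l] and one along a side of which the
    middle piece contains the rest, so [leg_sum] applies; the last alternative is the one in which
    the third piece is a corner. *)
Lemma zigzag_core n l W (HW : obtuse_cycle n l W) r s s2 lam mu j : (1 <= r < n)%nat ->
  0 < cross (edge W 0) (edge W r) -> 0 <= dot (edge W 0) (edge W r) ->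
  0 < s < 1 -> 0 < s2 < 1 -> 0 < lam -> 0 < mu ->
  let g := vadd (vscale s (edge W 0)) (vscale (1 - s2) (edge W r)) in
  let x := seg_pt (W 0%nat) (W 1%nat) s in let y := seg_pt (W r) (W (S r)) s2 in
  let z := vsub y (vscale mu g) in
  W j = vadd x (vscale lam g) ->
  (exists i, W i = z) \/ (exists m s3, 0 < s3 < 1 /\ seg_pt (W m) (W (S m)) s3 = z) ->
  sqrt 2 * l <= norm (vscale lam g) + norm g \/ sqrt 2 * l <= norm g + norm (vscale mu g) \/
  (exists m s3, 0 < s3 < 1 /\ seg_pt (W m) (W (S m)) s3 = z /\ W (S m) = W r /\
     (1 - s3) * norm (edge W m) * ((1 - s3) * norm (edge W m)) + l * l
       <= dot (vadd g (vscale mu g)) (vadd g (vscale mu g))).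
Proof.
  intros Hr Hc Hd Hs Hs2 Hlam Hmu g x y z Hj Hz.
  destruct (zigzag_norm W r Hd s s2 Hs Hs2) as [N1 N2].
  pose proof (oc_pos _ _ _ HW) as Hl.
  pose proof (edge_norm_ge _ _ _ HW 0) as G0; pose proof (edge_norm_ge _ _ _ HW r) as Gr.
  assert (Hfin : s2 * norm (edge W r) * (s2 * norm (edge W r)) + l * l <= dot (vscale mu g) (vscale mu g) ->
     sqrt 2 * l <= norm g + norm (vscale mu g)).
  { intros H; rewrite Rplus_comm.
    apply (leg_sum _ _ (s2 * norm (edge W r)) ((1 - s2) * norm (edge W r))); trivial;
      try apply norm_nonneg; try nra. rewrite norm_sqr; exact H. }
  destruct (Rle_lt_dec 0 (cross g (vsub y x))) as [Hside|Hside].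
  - left.
    pose proof (zigzag_left n l W HW r Hr Hc Hd s s2 Hs Hs2 lam j Hlam Hj Hside) as H.
    apply (leg_sum _ _ ((1 - s) * norm (edge W 0)) (s * norm (edge W 0))); trivial;
      try apply norm_nonneg; try nra. rewrite norm_sqr; exact H.
  - right; destruct Hz as [(i & Hi)|(m & s3 & Hs3 & Hm)].
    + left; apply Hfin.
      exact (zigzag_right_vertex n l W HW r Hr Hc Hd s s2 Hs Hs2 mu i Hmu Hi (Rlt_le _ _ Hside)).
    + destruct (zigzag_right_side n l W HW r Hr Hc Hd s s2 Hs Hs2 mu m s3 Hmu Hs3 Hm (Rlt_le _ _ Hside))
        as [H|(H1 & H2 & H3)]; [left; now apply Hfin|right].
      exists m, s3; repeat split; trivial; apply Hs3.
Qed.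

(** * Connections that return to a polygon after a corner piece *)

Section Zigzag.
Variables (X : surface) (l0 : R).
Hypothesis Hwf : wf_surface X.
Hypothesis HP1 : P1 X.
Hypothesis HP2 : P2 X.
Hypothesis Hmin : is_min_side_length X l0.
Notation PG i := (polyg X i).
Notation len i := (length (polyg X i)).
Let Hcyc := polygon_cycle X l0 Hwf HP1 Hmin.

Variable L : list piece.
Hypothesis HL : is_saddle_connection X L.
Hypothesis Hns : nonside X L.
Notation p := (length L).

Lemma nonside_itinerary :
  itinerary p (ppoly L) (fun t => norm (pdir L t) / l0) (corner X L).
Proof.
  pose proof (min_side_pos X l0 Hwf Hmin) as Hl; pose proof (sc_pos X L HL) as H0.
  assert (Hdiv : forall a, a / l0 * l0 = a) by (intros; field; lra).
  assert (Hge : forall a, l0 <= a -> 1 <= a / l0).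
  { intros a Ha; apply Rmult_le_reg_r with l0; trivial; rewrite Hdiv; lra. }
  assert (Hgt : forall a, l0 < a -> 1 < a / l0).
  { intros a Ha; apply Rmult_lt_reg_r with l0; trivial; rewrite Hdiv; lra. }
  assert (Hc : forall t, t = 0%nat \/ t = (p - 1)%nat -> corner X L t = false).
  { intros t Ht; destruct (corner X L t) eqn:E; trivial; apply corner_spec in E; lia. }
  constructor.
  - exact H0.
  - apply Hc; now left.
  - apply Hc; now right.
  - intros t Ht E; apply Hge.
    now apply (piece_far X l0 Hwf HP1 Hmin L HL Hns t Ht E).
  - intros t Ht; apply Rdiv_lt_0_compat; trivial; now apply (pdir_norm_pos X L HL).
  - intros t Ht; unfold Rdiv; rewrite <- Rmult_plus_distr_r.
    apply Hgt, (two_pieces_far X l0 Hwf HP1 Hmin L HL Hns t Ht).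
  - intros E; apply Hgt.
    apply (proj1 (proj2 (piece_far X l0 Hwf HP1 Hmin L HL Hns 0 H0 (Hc 0%nat (or_introl eq_refl))))).
    exact E.
  - intros t Ht; now apply (next_polygon X Hwf HP2 L HL).
Qed.

Lemma psum_lengths : psum (fun t => norm (pdir L t) / l0) p = sc_length L / l0.
Proof. rewrite sc_length_psum; unfold Rdiv; apply psum_scale. Qed.

(** Here [A] is a length reached up to piece [t], whose corner has the leg [w] on the exit side. The
    next piece is either a corner with the rest of that side as a leg, so that [leg_sum] applies, or
    at least [l0] long. *)
Lemma corner_third t : (0 < t)%nat -> (S t < p)%nat -> forall w A,
  (cornerA X L t /\ w = sout X L t * norm (edge (vtx (PG (ppoly L t))) (kout X L t))) \/
  (cornerB X L t /\ w = (1 - sout X L t) * norm (edge (vtx (PG (ppoly L t))) (kout X L t))) ->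
  0 <= A -> l0 <= A -> w * w + l0 * l0 <= A * A -> sqrt 2 * l0 <= A + norm (pdir L (S t)).
Proof.
  intros H0 Ht w A Hw HA0 HA HA2.
  pose proof (min_side_pos X l0 Hwf Hmin) as Hl.
  destruct (exit_kout X Hwf L HL t ltac:(lia)) as ((Hi & _) & Hs & _).
  pose proof (edge_norm_ge _ _ _ (Hcyc _ Hi) (kout X L t)) as Hge.
  destruct (corner X L (S t)) eqn:E.
  - pose proof E as E'; apply corner_spec in E' as (_ & Ht2 & _).
    destruct (corner_next_leg X l0 Hwf HP1 Hmin L HL t H0 Ht2 E) as [NA NB].
    set (e := norm (edge (vtx (PG (ppoly L t))) (kout X L t))) in *.
    destruct Hw as [[Hc ->]|[Hc ->]].
    + specialize (NA Hc); apply (leg_sum _ _ (sout X L t * e) ((1 - sout X L t) * e)); trivial; nra.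
    + specialize (NB Hc); apply (leg_sum _ _ ((1 - sout X L t) * e) (sout X L t * e)); trivial; nra.
  - destruct (piece_far X l0 Hwf HP1 Hmin L HL Hns (S t) ltac:(lia) E) as [H1 _].
    assert (Hs2 : sqrt 2 * sqrt 2 = 2) by (apply sqrt_sqrt; lra).
    nra.
Qed.

Lemma third_piece_exit k r : (2 < p)%nat -> valid_side X (ppoly L 2) k -> 0 < r < 1 ->
  pB L 2 = side_pt X (ppoly L 2) k r -> (3 < p)%nat /\ k = kout X L 2 /\ r = sout X L 2.
Proof.
  intros Hp Hk Hr HB.
  assert (H3 : (3 < p)%nat).
  { destruct (Nat.eq_dec p 3) as [E|]; [exfalso|lia].
    destruct (end_vertex X L HL) as (b & Hb & Hbe); rewrite E in Hb, Hbe; cbn [Nat.sub] in Hb, Hbe.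
    apply (open_side_not_vertex X l0 Hwf HP1 Hmin _ _ _ Hk Hr); exists b; split; congruence. }
  split; trivial.
  now apply (exit_unique X l0 Hwf HP1 Hmin L HL 2 k r).
Qed.

(** The sides by which the connection leaves and re-enters the polygon are glued to the two sides at
    a corner of the neighbour. As that angle is not acute, their directions differ by at most a
    right angle, as [zigzag_core] requires. *)
Lemma back_and_forth : (3 <= p)%nat -> ppoly L 2 = ppoly L 0 -> corner X L 1 = true ->
  sqrt 2 * l0 <= norm (pdir L 0) + norm (pdir L 1) \/
  sqrt 2 * l0 <= norm (pdir L 1) + norm (pdir L 2) \/
  ((3 < p)%nat /\ sqrt 2 * l0 <= norm (pdir L 1) + norm (pdir L 2) + norm (pdir L 3)).
Proof.
  intros Hp HP20 Hc.
  pose proof (min_side_pos X l0 Hwf Hmin) as Hl.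
  apply corner_spec in Hc as (_ & H1 & Hc).
  destruct (exit_kout X Hwf L HL 0 ltac:(lia)) as ((Hi & Hk0) & Hs0 & HB0 & _).
  destruct (exit_kout X Hwf L HL 1 H1) as ((_ & Hk1) & Hs1 & HB1 & _).
  destruct (entry_kin X Hwf L HL 2 ltac:(lia) ltac:(lia)) as ((_ & Hk2) & Hs2 & HA2).
  pose proof (entry_edge X Hwf L HL 0 ltac:(lia)) as He1; pose proof (entry_edge X Hwf L HL 1 H1) as He2.
  assert (Esin1 : sin_ X L 1 = 1 - sout X L 0) by reflexivity.
  assert (Esin2 : sin_ X L 2 = 1 - sout X L 1) by reflexivity.
  pose proof (plam_pos X L HL 0 ltac:(lia)) as l0p; pose proof (plam_pos X L HL 1 ltac:(lia)) as l1p;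
    pose proof (plam_pos X L HL 2 ltac:(lia)) as l2p.
  set (lam := plam L 0 / plam L 1); set (mu := plam L 2 / plam L 1).
  assert (Hlam : 0 < lam) by now apply Rdiv_lt_0_compat.
  assert (Hmu : 0 < mu) by now apply Rdiv_lt_0_compat.
  assert (Hd0 : pdir L 0 = vscale lam (pdir L 1)).
  { rewrite (pdir_plam X L HL 0), (pdir_plam X L HL 1) by lia.
    unfold lam, vscale; cbn [fst snd]; f_equal; field; lra. }
  assert (Hd2 : pdir L 2 = vscale mu (pdir L 1)).
  { rewrite (pdir_plam X L HL 2), (pdir_plam X L HL 1) by lia.
    unfold mu, vscale; cbn [fst snd]; f_equal; field; lra. }
  destruct (start_vertex X L HL) as (a & Ha & HA0).
  assert (Hend : (exists b, (b < len (ppoly L 0))%nat /\ pB L 2 = vtx (PG (ppoly L 0)) b) \/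
     (exists k r, valid_side X (ppoly L 0) k /\ 0 < r < 1 /\ pB L 2 = side_pt X (ppoly L 0) k r)).
  { destruct (Nat.eq_dec p 3) as [E|].
    - left; destruct (end_vertex X L HL) as (b & Hb & Hbe); rewrite E in Hb, Hbe; cbn [Nat.sub] in Hb, Hbe.
      rewrite HP20 in Hb, Hbe; now exists b.
    - right; destruct (exit_kout X Hwf L HL 2 ltac:(lia)) as (Hk & Hs & HB & _).
      rewrite HP20 in Hk, HB; now exists (kout X L 2), (sout X L 2). }
  assert (Hsum2 : norm (vadd (pdir L 1) (vscale mu (pdir L 1))) = norm (pdir L 1) + norm (pdir L 2)).
  { replace (vadd (pdir L 1) (vscale mu (pdir L 1))) with (vscale (1 + mu) (pdir L 1)) by veq.
    rewrite Hd2, !norm_scale by lra; ring. }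
  pose proof (two_pieces_far X l0 Hwf HP1 Hmin L HL Hns 1 H1) as H12.
  rewrite HP20 in He2, Hk2, HA2.
  set (i := ppoly L 0) in *; set (V := vtx (PG i)) in *; set (n := len i) in *.
  pose proof (Hcyc i Hi) as HV; fold V n in HV.
  set (e := kout X L 0) in *; set (f := kin X L 2) in *.
  destruct Hc as [Hc|Hc].
  - destruct (cornerA_eq X l0 Hwf HP1 Hmin L HL 1 ltac:(lia) H1 Hc) as (_ & Hd1 & Hdot & Hcr).
    destruct (index_offset (PG i) e f Hk0 Hk2) as (r & Hr & Ef).
    (* Numbered from the exit side [e]: piece 0 ends on side 0 and piece 2 begins on side [r]. *)
    set (W := fun m => V (e + m)%nat).
    assert (HW : obtuse_cycle n l0 W) by apply (oc_shift n l0 V e HV).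
    assert (EW0 : edge W 0 = edge V e) by (unfold W; rewrite edge_shift; f_equal; lia).
    assert (EWr : edge W r = edge V f).
    { unfold W; rewrite edge_shift, Ef; symmetry; apply edge_vtx_mod. }
    assert (Wr : W r = V f /\ W (S r) = V (S f)).
    { unfold W; rewrite Nat.add_succ_r, Ef; split; symmetry; [apply vtx_mod|apply (vtx_mod_S (PG i))]. }
    assert (Eg : pdir L 1 = vscale (-1) (vadd (vscale (sout X L 0) (edge W 0)) (vscale (1 - sin_ X L 2) (edge W r)))).
    { rewrite EW0, EWr, Hd1, He1, Esin1, He2, Esin2; veq. }
    rewrite He1 in Hdot, Hcr.
    assert (Hf' : edge V f = vscale (-1) (edge (vtx (PG (ppoly L 1))) (kout X L 1))) by exact He2.
    assert (Hcr' : 0 < cross (edge W 0) (edge W r))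
      by (rewrite EW0, EWr, Hf'; vunf; lra).
    assert (Hdot' : 0 <= dot (edge W 0) (edge W r))
      by (rewrite EW0, EWr, Hf'; vunf; lra).
    assert (Hr1 : (1 <= r)%nat).
    { destruct r; [|lia]; exfalso; assert (cross (edge W 0) (edge W 0) = 0) by vring; lra. }
    set (g := vadd (vscale (sout X L 0) (edge W 0)) (vscale (1 - sin_ X L 2) (edge W r))) in *.
    assert (Hx : seg_pt (W 0%nat) (W 1%nat) (sout X L 0) = pB L 0).
    { rewrite HB0; unfold W, side_pt; rewrite Nat.add_0_r, Nat.add_1_r; reflexivity. }
    assert (Hy : seg_pt (W r) (W (S r)) (sin_ X L 2) = pA L 2).
    { rewrite HA2; destruct Wr as [-> ->]; reflexivity. }
    assert (Ng : norm g = norm (pdir L 1)) by (rewrite Eg; symmetry; apply norm_opp).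
    assert (Nlg : norm (vscale lam g) = norm (pdir L 0)).
    { rewrite Hd0, !norm_scale, Ng by lra; reflexivity. }
    assert (Nmg : norm (vscale mu g) = norm (pdir L 2)).
    { rewrite Hd2, !norm_scale, Ng by lra; reflexivity. }
    assert (Hz : vsub (pA L 2) (vscale mu g) = pB L 2).
    { assert (H : pB L 2 = vadd (pA L 2) (pdir L 2)) by (rewrite pdir_eq; veq).
      rewrite H, Hd2, Eg; veq. }
    assert (Hback : forall m, exists j, W j = V m).
    { intros m; exists (m + n * e - e)%nat; unfold W.
      rewrite <- (oc_period_mul _ _ _ HV e m); f_equal; nia. }
    destruct (Hback a) as (j & Hj).
    destruct (zigzag_core n l0 W HW r (sout X L 0) (sin_ X L 2) lam mu j ltac:(lia) Hcr' Hdot' Hs0 Hs2 Hlam Hmu)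
      as [H|[H|(m & s3 & Hs3 & Hm & Hv & Hsq)]]; fold g;
        try fold g in H; try fold g in Hm; try fold g in Hsq.
    + rewrite Hj, Hx, <- HA0.
      assert (H : pA L 0 = vsub (pB L 0) (pdir L 0)) by (rewrite pdir_eq; veq).
      rewrite H, Hd0, Eg; veq.
    + rewrite Hy, Hz; destruct Hend as [(b & Hb & HB)|(k & rr & Hk & Hrr & HB)].
      * left; destruct (Hback b) as (j' & Hj'); exists j'; rewrite Hj'; now symmetry.
      * right; exists (k + n * e - e)%nat, rr; split; trivial; rewrite HB; unfold side_pt, W.
        f_equal.
        -- change (vtx (PG i) k) with (V k); rewrite <- (oc_period_mul _ _ _ HV e k); f_equal; nia.
        -- change (vtx (PG i) (S k)) with (V (S k)); rewrite <- (oc_period_mul _ _ _ HV e (S k)); f_equal; nia.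
    + left; rewrite Nlg, Ng in H; exact H.
    + right; left; rewrite Nmg, Ng in H; exact H.
    + right; right.
      rewrite Hy, Hz in Hm.
      set (k := ((e + m) mod n)%nat).
      assert (Hkn : (k < n)%nat) by (apply Nat.mod_upper_bound; lia).
      assert (HBk : pB L 2 = side_pt X i k s3).
      { rewrite <- Hm; unfold side_pt, k, n; rewrite (vtx_mod_S (PG i)), vtx_mod; unfold W; now rewrite Nat.add_succ_r. }
      destruct (third_piece_exit k s3 ltac:(lia)) as (H3 & Ek & Es); trivial.
      { rewrite HP20; split; trivial. }
      { now rewrite HP20. }
      split; trivial.
      apply (corner_third 2 ltac:(lia) ltac:(lia) ((1 - s3) * norm (edge W m))); try lra.
      * right; rewrite <- Ek, <- Es, HP20; split.
        -- unfold cornerB; rewrite HP20; fold i n f; rewrite <- Ek.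
           apply (vtx_inj l0 (PG i) HV); [apply Nat.mod_upper_bound; lia|trivial|].
           unfold n; rewrite vtx_mod; unfold k, n; rewrite (vtx_mod_S (PG i)); fold V.
           destruct Wr as [Wr _]; unfold W in Hv, Wr; rewrite Nat.add_succ_r in Hv; congruence.
        -- f_equal; f_equal; unfold W; rewrite edge_shift; symmetry; apply edge_vtx_mod.
      * eapply Rle_trans; [exact Hsq|]; right.
        rewrite <- norm_sqr; f_equal.
        -- rewrite <- Hsum2, Eg; unfold norm; f_equal; vring.
        -- rewrite <- Hsum2, Eg; unfold norm; f_equal; vring.
  - destruct (cornerB_eq X l0 Hwf HP1 Hmin L HL 1 ltac:(lia) H1 Hc) as (_ & Hd1 & Hdot & Hcr).
    destruct (index_offset (PG i) f e Hk2 Hk0) as (r & Hr & Ee); fold n in Hr, Ee.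
    (* A turn in the other direction is reduced to the former case by a reflection that runs through
       side [e] from [V (S e)] to [V e]; all parameters become their complements. *)
    set (W := reversed n V (S e)).
    assert (HW : obtuse_cycle n l0 W) by apply (oc_reversed n l0 V HV).
    assert (Hmod : exists d, (f + r = e + d * n)%nat).
    { exists ((f + r) / n)%nat; rewrite Ee; pose proof (Nat.div_mod (f + r) n ltac:(lia)); lia. }
    destruct Hmod as (d & Hmod).
    assert (EW0 : edge W 0 = vscale (-1) (mirror (edge V e)))
      by (apply (edge_reversed n l0 V HV (S e) 0 e 0); lia).
    assert (EWr : edge W r = vscale (-1) (mirror (edge V f)))
      by (apply (edge_reversed n l0 V HV (S e) r f d); lia).
    assert (W0 : W 0%nat = mirror (V (S e))) by (apply (reversed_eq n l0 V HV _ _ _ 0); lia).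
    assert (W1 : W 1%nat = mirror (V e)) by (apply (reversed_eq n l0 V HV _ _ _ 0); lia).
    assert (Wr : W r = mirror (V (S f))) by (apply (reversed_eq n l0 V HV _ _ _ d); lia).
    assert (WSr : W (S r) = mirror (V f)) by (apply (reversed_eq n l0 V HV _ _ _ d); lia).
    assert (Eg : mirror (pdir L 1) =
      vscale (-1) (vadd (vscale (1 - sout X L 0) (edge W 0)) (vscale (1 - (1 - sin_ X L 2)) (edge W r)))).
    { rewrite EW0, EWr, Hd1, He1, Esin1, He2, Esin2; unfold mirror; veq. }
    rewrite He1 in Hdot, Hcr.
    assert (Hf' : edge V f = vscale (-1) (edge (vtx (PG (ppoly L 1))) (kout X L 1))) by exact He2.
    assert (Hcr' : 0 < cross (edge W 0) (edge W r))
      by (rewrite EW0, EWr, Hf'; unfold mirror; vunf; lra).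
    assert (Hdot' : 0 <= dot (edge W 0) (edge W r))
      by (rewrite EW0, EWr, Hf'; unfold mirror; vunf; lra).
    assert (Hr1 : (1 <= r)%nat).
    { destruct r; [|lia]; exfalso; assert (cross (edge W 0) (edge W 0) = 0) by vring; lra. }
    set (g := vadd (vscale (1 - sout X L 0) (edge W 0)) (vscale (1 - (1 - sin_ X L 2)) (edge W r))) in *.
    assert (Hx : seg_pt (W 0%nat) (W 1%nat) (1 - sout X L 0) = mirror (pB L 0)).
    { rewrite HB0, W0, W1; unfold side_pt, mirror; fold V; veq. }
    assert (Hy : seg_pt (W r) (W (S r)) (1 - sin_ X L 2) = mirror (pA L 2)).
    { rewrite HA2, Wr, WSr; unfold side_pt, mirror; fold V; veq. }
    assert (Ng : norm g = norm (pdir L 1)).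
    { rewrite <- norm_mirror, <- (norm_mirror (pdir L 1)), Eg, norm_opp, !norm_mirror; reflexivity. }
    assert (Nlg : norm (vscale lam g) = norm (pdir L 0)).
    { rewrite Hd0, !norm_scale, Ng by lra; reflexivity. }
    assert (Nmg : norm (vscale mu g) = norm (pdir L 2)).
    { rewrite Hd2, !norm_scale, Ng by lra; reflexivity. }
    assert (Hz : vsub (mirror (pA L 2)) (vscale mu g) = mirror (pB L 2)).
    { assert (H : pB L 2 = vadd (pA L 2) (pdir L 2)) by (rewrite pdir_eq; veq).
      rewrite H, mirror_vadd, Hd2, mirror_vscale, Eg; veq. }
    assert (Hback : forall m, exists j, W j = mirror (V m)).
    { intros m; exists (S e + m * n - m)%nat; apply (reversed_eq n l0 V HV _ _ _ m); nia. }
    destruct (Hback a) as (j & Hj).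
    destruct (zigzag_core n l0 W HW r (1 - sout X L 0) (1 - sin_ X L 2) lam mu j ltac:(lia) Hcr' Hdot'
       ltac:(lra) ltac:(lra) Hlam Hmu)
      as [H|[H|(m & s3 & Hs3 & Hm & Hv & Hsq)]]; fold g;
        try fold g in H; try fold g in Hm; try fold g in Hsq.
    + rewrite Hj, Hx, <- HA0.
      assert (H : pA L 0 = vsub (pB L 0) (pdir L 0)) by (rewrite pdir_eq; veq).
      rewrite H, mirror_vsub, Hd0, mirror_vscale, Eg; veq.
    + rewrite Hy, Hz; destruct Hend as [(b & Hb & HB)|(k & rr & Hk & Hrr & HB)].
      * left; destruct (Hback b) as (j' & Hj'); exists j'; rewrite Hj', HB; reflexivity.
      * right; exists (S e + S k * n - S k)%nat, (1 - rr); split; [lra|].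
        assert (E1 : W (S e + S k * n - S k)%nat = mirror (V (S k)))
          by (apply (reversed_eq n l0 V HV (S e) _ _ (S k)); nia).
        assert (E2 : W (S (S e + S k * n - S k)) = mirror (V k))
          by (apply (reversed_eq n l0 V HV (S e) _ _ (S k)); nia).
        rewrite E1, E2, HB; unfold side_pt, mirror; fold V; veq.
    + left; rewrite Nlg, Ng in H; exact H.
    + right; left; rewrite Nmg, Ng in H; exact H.
    + right; right.
      rewrite Hy, Hz in Hm.
      assert (Hk : exists k0 d0, (S m + k0 = S e + d0 * n)%nat) by (exists (S e + (S m) * n - S m)%nat, (S m); nia).
      destruct Hk as (k0 & d0 & Hk0').
      set (k := (k0 mod n)%nat).
      assert (Hkn : (k < n)%nat) by (apply Nat.mod_upper_bound; lia).
      assert (HBk : pB L 2 = side_pt X i k (1 - s3)).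
      { assert (Hmm : mirror (pB L 2) = mirror (side_pt X i k (1 - s3))).
        { assert (E1 : W m = mirror (V (S k0))) by (apply (reversed_eq n l0 V HV (S e) _ _ d0); lia).
          assert (E2 : W (S m) = mirror (V k0)) by (apply (reversed_eq n l0 V HV (S e) _ _ d0); lia).
          rewrite <- Hm, E1, E2; unfold side_pt, k, n; rewrite (vtx_mod_S (PG i)), vtx_mod; unfold mirror; fold V; veq. }
        assert (E1 := f_equal fst Hmm); assert (E2 := f_equal snd Hmm); unfold mirror in E1, E2; cbn [fst snd] in E1, E2.
        apply pt_eq; lra. }
      destruct (third_piece_exit k (1 - s3) ltac:(lia)) as (H3 & Ek & Es); trivial.
      { rewrite HP20; split; trivial. }
      { lra. }
      { now rewrite HP20. }
      split; trivial.
      apply (corner_third 2 ltac:(lia) ltac:(lia) ((1 - s3) * norm (edge W m))); try lra.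
      * left; rewrite <- Ek, <- Es, HP20; split.
        -- unfold cornerA; rewrite HP20; fold i n f; rewrite <- Ek.
           apply (vtx_inj l0 (PG i) HV); [apply Nat.mod_upper_bound; lia|trivial|].
           unfold n; rewrite vtx_mod; unfold k, n; rewrite vtx_mod; fold V.
           assert (Hmm : mirror (V (S f)) = mirror (V k0)).
           { rewrite <- Wr, <- Hv; apply (reversed_eq n l0 V HV (S e) (S m) k0 d0); lia. }
           assert (E1 := f_equal fst Hmm); assert (E2 := f_equal snd Hmm); unfold mirror in E1, E2; cbn [fst snd] in E1, E2.
           apply pt_eq; lra.
        -- f_equal; unfold W; rewrite (edge_reversed n l0 V HV (S e) m k0 d0) by lia.
           rewrite norm_opp, norm_mirror; f_equal; symmetry; apply edge_vtx_mod.
      * eapply Rle_trans; [exact Hsq|]; right.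
        assert (Hgg : dot (vadd g (vscale mu g)) (vadd g (vscale mu g)) =
          norm (vadd (pdir L 1) (vscale mu (pdir L 1))) * norm (vadd (pdir L 1) (vscale mu (pdir L 1)))).
        { rewrite norm_sqr, <- (dot_mirror (vadd (pdir L 1) _)), mirror_vadd, mirror_vscale, Eg; vring. }
        rewrite Hgg, Hsum2; reflexivity.
Qed.

End Zigzag.

Lemma itinerary_gt_one p P w C (HI : itinerary p P w C) : 1 < psum w p.
Proof.
  pose proof (it_pos _ _ _ _ HI) as H0.
  destruct (Nat.eq_dec p 1) as [E|E].
  - pose proof (it_single _ _ _ _ HI E); rewrite E; simpl; lra.
  - pose proof (it_pair _ _ _ _ HI 0%nat ltac:(lia)) as H1.
    assert (H2 : psum w 2 <= psum w p).
    { destruct (Nat.eq_dec p 2) as [->|]; [lra|].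
      left; apply (psum_mono w p (it_w _ _ _ _ HI)); lia. }
    simpl in H2; lra.
Qed.

(** Intersection points are listed up to gluing, and they are counted through their codes. Different
    positions of [ps] never share a code, so chosen codes form a list without repetition of the same
    length. *)
Lemma choose_codes {A B : Type} (d : A) (b0 : B) (R : A -> B -> Prop) (ps : list A) :
  (forall x, In x ps -> exists y, R x y) ->
  (forall t u, (t < length ps)%nat -> (u < length ps)%nat -> t <> u ->
     forall y, ~ (R (nth t ps d) y /\ R (nth u ps d) y)) ->
  exists l, NoDup l /\ length l = length ps /\ forall y, In y l -> exists x, In x ps /\ R x y.
Proof.
  intros Hex Hinj.
  set (f := fun x => epsilon (inhabits b0) (R x)).
  assert (Hf : forall x, In x ps -> R x (f x)) by (intros x Hx; now apply epsilon_spec, Hex).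
  exists (map f ps); split; [|split].
  - apply (NoDup_nth _ (f d)); intros t u Ht Hu E; rewrite length_map in *.
    rewrite !map_nth in E.
    destruct (Nat.eq_dec t u) as [|Hne]; trivial; exfalso.
    apply (Hinj t u Ht Hu Hne (f (nth t ps d))); split; [|rewrite E]; apply Hf; now apply nth_In.
  - apply length_map.
  - intros y Hy; apply in_map_iff in Hy as (x & <- & Hx); exists x; split; trivial; now apply Hf.
Qed.

Section TwoNonside.
Variables (X : surface) (l0 : R).
Hypothesis Hwf : wf_surface X.
Hypothesis HP1 : P1 X.
Hypothesis HP2 : P2 X.
Hypothesis Hmin : is_min_side_length X l0.

(** The pieces with even index are independent and number [h + 1]. The gain of [sqrt 2 - 1] is found
    on the first two, three or four pieces, and the others are counted by [independent_suffix]. A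
    single piece has no room for this, so [h = 0] is left as a hypothesis. *)
Lemma zigzag_bound L (HL : is_saddle_connection X L) (Hn : nonside X L) h : length L = (2 * h + 1)%nat ->
  (forall t, (t < length L)%nat -> Nat.even t = true -> ppoly L t = ppoly L 0) ->
  (h = 0%nat -> sqrt 2 * l0 <= sc_length L) ->
  INR h + sqrt 2 <= psum (fun t => norm (pdir L t) / l0) (length L).
Proof.
  intros Hp Hev H0.
  pose proof (min_side_pos X l0 Hwf Hmin) as Hl.
  pose proof (nonside_itinerary X l0 Hwf HP1 HP2 Hmin L HL Hn) as HI.
  assert (Hdiv : forall a c, c * l0 <= a -> c <= a / l0).
  { intros a c H; apply Rmult_le_reg_r with l0; trivial.
    replace (a / l0 * l0) with a by (field; lra); trivial. }
  destruct h as [|h].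
  { rewrite psum_lengths; simpl INR; rewrite Rplus_0_l; apply Hdiv; now apply H0. }
  set (w := fun t => norm (pdir L t) / l0) in *.
  set (p := length L) in *.
  assert (Hindep : independent p Nat.even).
  { intros t _ E1 E2; rewrite Nat.even_succ, <- Nat.negb_even, E1 in E2; discriminate. }
  assert (Hsuf : forall m, (m <= p)%nat -> INR (S (S h)) - INR (cnt Nat.even m) <= psum w p - psum w m).
  { intros m Hm; destruct (independent_suffix p _ w _ HI Nat.even Hindep (p - m) m ltac:(lia)) as [H _].
    replace (cnt Nat.even p) with (S (S h)) in H by (rewrite Hp; symmetry; apply cnt_even); exact H. }
  pose proof (it_long _ _ _ _ HI 0%nat ltac:(lia) (it_first _ _ _ _ HI)) as Hw0.
  pose proof (Hsuf 2%nat ltac:(lia)) as S2; pose proof (Hsuf 3%nat ltac:(lia)) as S3.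
  simpl cnt in S2, S3; simpl psum in S2, S3; rewrite !S_INR in *; simpl INR in *.
  assert (Hs2 : sqrt 2 * sqrt 2 = 2) by (apply sqrt_sqrt; lra).
  assert (Hs2' : sqrt 2 < 2) by (nra).
  destruct (corner X L 1) eqn:Ec.
  - assert (Hadd : forall a b, a / l0 + b / l0 = (a + b) / l0) by (intros; field; lra).
    destruct (back_and_forth X l0 Hwf HP1 Hmin L HL Hn ltac:(lia) (Hev 2%nat ltac:(lia) eq_refl) Ec)
      as [H|[H|[H3 H]]].
    + apply Hdiv in H; rewrite <- Hadd in H; fold (w 0%nat) (w 1%nat) in H; lra.
    + apply Hdiv in H; rewrite <- Hadd in H; fold (w 1%nat) (w 2%nat) in H; lra.
    + pose proof (Hsuf 4%nat ltac:(lia)) as S4.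
      simpl cnt in S4; simpl psum in S4; rewrite !S_INR in *; simpl INR in *.
      apply Hdiv in H; rewrite <- !Hadd in H; fold (w 1%nat) (w 2%nat) (w 3%nat) in H; lra.
  - pose proof (it_long _ _ _ _ HI 1%nat ltac:(lia) Ec); lra.
Qed.

Lemma nonside_nonside La Lb n :
  is_saddle_connection X La -> is_saddle_connection X Lb -> nonside X La -> nonside X Lb ->
  inter_count X La Lb n ->
  (length La = 1%nat -> sqrt 2 * l0 <= sc_length La) -> (length Lb = 1%nat -> sqrt 2 * l0 <= sc_length Lb) ->
  INR n + 1 < sc_length La / l0 * (sc_length Lb / l0) \/
  (length La = 1%nat /\ length Lb = 1%nat /\ (n <= 1)%nat).
Proof.
  intros HLa HLb Hna Hnb Hic Hsa Hsb.
  pose proof (nonside_itinerary X l0 Hwf HP1 HP2 Hmin La HLa Hna) as HA.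
  pose proof (nonside_itinerary X l0 Hwf HP1 HP2 Hmin Lb HLb Hnb) as HB.
  rewrite <- !psum_lengths.
  assert (H0 : n = 0%nat -> INR n + 1 < psum (fun t => norm (pdir La t) / l0) (length La)
                       * psum (fun t => norm (pdir Lb t) / l0) (length Lb)).
  { intros ->; pose proof (itinerary_gt_one _ _ _ _ HA); pose proof (itinerary_gt_one _ _ _ _ HB).
    simpl; nra. }
  destruct (classic (sc_eq X La Lb)) as [Heq|Hne].
  { destruct Hic as [[_ ->]|[Hne _]]; [left; now apply H0|contradiction]. }
  destruct (Req_dec (cross (pdir La 0) (pdir Lb 0)) 0) as [Hpar|Hpar].
  { left; apply H0.
    exact (parallel_no_common X l0 Hwf HP1 Hmin La Lb HLa HLb Hna Hnb n Hpar Hne Hic). }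
  destruct Hic as [[He _]|[_ (ps & Hlen & Hps & Hdist & _)]]; [contradiction|].
  destruct (choose_codes (A := xpt) (0%nat, (0, 0)) (0%nat, 0%nat) (charged X La Lb) ps) as (cr & Hnd & Hlc & Hcr).
  { intros x Hx; destruct (Hps x Hx) as (H1 & H2 & H3).
    now apply (charged_exists X l0 Hwf HP1 Hmin). }
  { intros t u Ht Hu Htu y [H1 H2]; rewrite Hlen in Ht, Hu; apply (Hdist t u Ht Hu Htu).
    now apply (charged_inj X Hwf HP2 La Lb HLa _ _ y Hpar). }
  rewrite <- Hlen, <- Hlc.
  refine (crossings_bound _ _ _ _ _ _ _ _ HA HB (extra_pair X La Lb) _ _ cr Hnd _ _ _).
  - intros t u Ht (E1 & E2 & E3 & E4); repeat split; trivial.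
    destruct E4 as [[-> _]|[-> _]]; [now left|now right].
  - intros t u u' _; now apply (extra_pair_unique X l0 Hwf HP1 Hmin La Lb HLb Hnb).
  - intros t u Hin; destruct (Hcr _ Hin) as (x & _ & (t' & s & _ & _ & _ & E1 & E2 & E3 & E4)).
    cbn [fst snd] in *; repeat split; trivial.
    destruct E4 as [[E4 _]|[E4 _]]; [now left|now right].
  - intros h Hh Hev; apply (zigzag_bound La HLa Hna h Hh Hev); intros ->; apply Hsa; exact Hh.
  - intros h Hh Hev; apply (zigzag_bound Lb HLb Hnb h Hh Hev); intros ->; apply Hsb; exact Hh.
Qed.

End TwoNonside.

(** * Short diagonals *)

Section Slabs.
Variables (q : nat) (U : nat -> bool) (c gA gB : nat -> R) (K : R).
Hypothesis Hq : (0 < q)%nat.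
Hypothesis HU : forall t, (S t < q)%nat -> U t = true -> U (S t) = true -> False.
Hypothesis Hc : forall t, (t < q)%nat -> 0 < c t.
Hypothesis HcU : forall t, (t < q)%nat -> U t = true -> 0 < gA t /\ 0 < gB t /\ gA t + gB t <= c t.
Hypothesis Hfirst : (U 0%nat = true -> K < gA 0%nat) /\ (U 0%nat = false -> K < c 0%nat).
Hypothesis Hlast : (U (q - 1)%nat = true -> K < gB (q - 1)%nat) /\ (U (q - 1)%nat = false -> K < c (q - 1)%nat).
Hypothesis Hpair : forall t, (S t < q)%nat -> K < c t + c (S t).
Hypothesis Hmid : forall t, (S (S t) < q)%nat -> U t = true -> U (S (S t)) = true ->
  K < gB t + c (S t) + gA (S (S t)).

(** In a crossing piece, [gA] and [gB] are the parts of the weight before and after the diagonal.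
    Each interval before, between or after crossings weighs more than [K], and there is one interval
    more than crossings. In the second part the last interval is still open, and pieces that do not
    cross have already filled it. *)
Lemma slab_prefix m :
  ((m < q)%nat -> U m = true -> K * (INR (cnt U m) + 1) < psum c m + gA m) /\
  ((1 <= m)%nat -> (m <= q)%nat -> U (m - 1)%nat = false -> (m = 1%nat \/ U (m - 2)%nat = false) ->
     K * (INR (cnt U m) + 1) < psum c m).
Proof.
  induction m as [m IH] using (well_founded_induction lt_wf); split.
  - intros Hm Em; destruct m as [|[|m]].
    + simpl; pose proof (proj1 Hfirst Em); lra.
    + assert (E0 : U 0%nat = false)
        by (destruct (U 0%nat) eqn:E0; trivial; exfalso; exact (HU 0%nat Hm E0 Em)).
      simpl; rewrite E0; simpl; pose proof (proj2 Hfirst E0); destruct (HcU 1%nat Hm Em); lra.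
    + assert (E1 : U (S m) = false)
        by (destruct (U (S m)) eqn:E1; trivial; exfalso; exact (HU (S m) Hm E1 Em)).
      destruct (HcU (S (S m)) Hm Em) as (G1 & _).
      destruct (U m) eqn:E0.
      * destruct (IH m ltac:(lia)) as [J _]; specialize (J ltac:(lia) E0).
        pose proof (Hmid m Hm E0 Em); destruct (HcU m ltac:(lia) E0) as (_ & _ & G2).
        cbn [cnt psum]; rewrite E1, E0, Nat.add_0_r, Nat.add_1_r, S_INR; lra.
      * assert (J : K * (INR (cnt U (S (S m))) + 1) < psum c (S (S m))); [|lra].
        cbn [cnt psum]; rewrite E1, E0, !Nat.add_0_r.
        destruct m as [|m].
        -- simpl; pose proof (proj2 Hfirst E0); pose proof (Hc 1%nat ltac:(lia)); lra.
        -- destruct (U m) eqn:E2.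
           ++ destruct (IH m ltac:(lia)) as [J _]; specialize (J ltac:(lia) E2).
              destruct (HcU m ltac:(lia) E2) as (_ & G2 & G3); pose proof (Hpair (S m) ltac:(lia)).
              cbn [cnt psum]; rewrite E2, Nat.add_1_r, S_INR; lra.
           ++ destruct (IH (S (S m)) ltac:(lia)) as [_ J].
              replace (S (S m) - 1)%nat with (S m) in J by lia; replace (S (S m) - 2)%nat with m in J by lia.
              specialize (J ltac:(lia) ltac:(lia) E0 (or_intror E2)).
              cbn [cnt psum] in *; rewrite E0, E2, !Nat.add_0_r in *; pose proof (Hc (S (S m)) ltac:(lia)); lra.
  - intros H1 Hm E1 E0; destruct m as [|[|m]]; [lia| |].
    + simpl in *; rewrite E1; simpl; pose proof (proj2 Hfirst E1); lra.
    + destruct E0 as [E0|E0]; [discriminate|].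
      replace (S (S m) - 1)%nat with (S m) in E1 by lia; replace (S (S m) - 2)%nat with m in E0 by lia.
      cbn [cnt psum]; rewrite E1, E0, !Nat.add_0_r.
      destruct m as [|m].
      * simpl; pose proof (proj2 Hfirst E0); pose proof (Hc 1%nat ltac:(lia)); lra.
      * destruct (U m) eqn:E2.
        -- destruct (IH m ltac:(lia)) as [J _]; specialize (J ltac:(lia) E2).
           destruct (HcU m ltac:(lia) E2) as (_ & G2 & G3); pose proof (Hpair (S m) ltac:(lia)).
           cbn [cnt psum]; rewrite E2, Nat.add_1_r, S_INR; lra.
        -- destruct (IH (S (S m)) ltac:(lia)) as [_ J].
           replace (S (S m) - 1)%nat with (S m) in J by lia; replace (S (S m) - 2)%nat with m in J by lia.
           specialize (J ltac:(lia) ltac:(lia) E0 (or_intror E2)).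
           cbn [cnt psum] in *; rewrite E0, E2, !Nat.add_0_r in *; pose proof (Hc (S (S m)) ltac:(lia)); lra.
Qed.

Lemma slab_count : K * (INR (cnt U q) + 1) < psum c q.
Proof.
  destruct (U (q - 1)%nat) eqn:E1.
  - destruct (slab_prefix (q - 1)) as [J _]; specialize (J ltac:(lia) E1).
    destruct (HcU (q - 1)%nat ltac:(lia) E1) as (_ & _ & G).
    replace q with (S (q - 1)) by lia; cbn [cnt psum]; rewrite E1, Nat.add_1_r, S_INR; lra.
  - destruct (Nat.eq_dec q 1) as [Eq|Eq].
    + rewrite Eq in *; simpl in *; rewrite E1; simpl; lra.
    + destruct (U (q - 2)%nat) eqn:E0.
      * destruct (slab_prefix (q - 2)) as [J _]; specialize (J ltac:(lia) E0).
        destruct (HcU (q - 2)%nat ltac:(lia) E0) as (_ & G1 & G).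
        replace q with (S (S (q - 2))) by lia; cbn [cnt psum].
        replace (S (q - 2)) with (q - 1)%nat by lia.
        rewrite E1, E0, Nat.add_0_r, Nat.add_1_r, S_INR; lra.
      * destruct (slab_prefix q) as [_ J]; apply J; trivial; try lia; now right.
Qed.

End Slabs.

(** * Heights over a short diagonal *)

Section ShortDiagonal.
Variables (X : surface) (l0 : R).
Hypothesis Hwf : wf_surface X.
Hypothesis HP1 : P1 X.
Hypothesis HP2 : P2 X.
Hypothesis Hmin : is_min_side_length X l0.
Notation PG i := (polyg X i).
Notation len i := (length (polyg X i)).
Let Hcyc := polygon_cycle X l0 Hwf HP1 Hmin.

Variables (i a r : nat).
Hypothesis Hi : (i < npoly X)%nat.
Notation V := (vtx (PG i)).
Notation n := (len i).
Hypothesis Hr : (2 <= r)%nat.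
Hypothesis Hrn : (r + 2 <= n)%nat.
Let D := vsub (V (a + r)%nat) (V a).
Hypothesis Hshort : short_sqr l0 V D.

(** The height over the diagonal, with a factor [norm D]. *)
Definition side_of_diag (w : pt) : R := cross (vsub w (V a)) D.

Lemma diag_arc_left j : (0 < j)%nat -> (j < r)%nat -> l0 * l0 < side_of_diag (V (a + j)%nat).
Proof.
  intros H1 H2; pose proof (Hcyc i Hi) as HV.
  pose proof (thin_between n l0 _ (oc_shift n l0 V a HV) r Hr Hrn) as H.
  cbv beta in H; rewrite Nat.add_0_r in H; specialize (H (short_shift _ _ _ _ Hshort) j H1 H2).
  exact H.
Qed.

Lemma diag_arc_right j : (r < j)%nat -> (j < n)%nat -> side_of_diag (V (a + j)%nat) < - (l0 * l0).
Proof.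
  intros H1 H2; pose proof (Hcyc i Hi) as HV.
  pose proof (thin_between n l0 _ (oc_shift n l0 V (a + r) HV) (n - r) ltac:(lia) ltac:(lia)) as H.
  cbv beta in H; rewrite Nat.add_0_r in H.
  replace (a + r + (n - r))%nat with (a + n)%nat in H by lia.
  rewrite (oc_period _ _ _ HV) in H.
  assert (Hs : short_sqr l0 V (vsub (V a) (V (a + r)%nat))).
  { destruct Hshort as [Hs|[Hs Ho]]; [left|right; split; trivial];
      replace (dot (vsub (V a) (V (a + r)%nat)) (vsub (V a) (V (a + r)%nat))) with (dot D D)
        by (unfold D; vring); trivial. }
  specialize (H (short_shift _ _ _ _ Hs) (j - r)%nat ltac:(lia) ltac:(lia)).
  replace (a + r + (j - r))%nat with (a + j)%nat in H by lia.
  unfold side_of_diag, D, orient in *; vunf; lra.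
Qed.

Lemma side_of_diag_ends : side_of_diag (V a) = 0 /\ side_of_diag (V (a + r)%nat) = 0.
Proof. unfold side_of_diag, D; split; vring. Qed.

Lemma vertex_side_of_diag m : (V m = V a \/ V m = V (a + r)%nat) \/
  l0 * l0 < side_of_diag (V m) \/ side_of_diag (V m) < - (l0 * l0).
Proof.
  destruct (oc_repr n l0 V (Hcyc i Hi) a m) as (j & Hj & -> & _).
  destruct (Nat.eq_dec j 0) as [->|]; [left; left; f_equal; lia|].
  destruct (Nat.eq_dec j r) as [->|]; [left; now right|right].
  destruct (le_lt_dec j r).
  - left; apply diag_arc_left; lia.
  - right; apply diag_arc_right; lia.
Qed.

Lemma edge_side_of_diag m : (0 <= side_of_diag (V m) /\ 0 <= side_of_diag (V (S m))) \/
  (side_of_diag (V m) <= 0 /\ side_of_diag (V (S m)) <= 0).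
Proof.
  pose proof (Hcyc i Hi) as HV; pose proof (min_side_pos X l0 Hwf Hmin) as Hl.
  assert (HK : 0 < l0 * l0) by nra.
  destruct side_of_diag_ends as [S1 S2].
  destruct (oc_repr n l0 V HV a m) as (j & Hj & -> & ->).
  rewrite <- Nat.add_succ_r.
  assert (HL : forall j, (j <= r)%nat -> 0 <= side_of_diag (V (a + j)%nat)).
  { intros k Hk; destruct (Nat.eq_dec k 0) as [->|]; [rewrite Nat.add_0_r; lra|].
    destruct (Nat.eq_dec k r) as [->|]; [lra|].
    pose proof (diag_arc_left k ltac:(lia) ltac:(lia)); lra. }
  assert (HR : forall j, (r <= j)%nat -> (j <= n)%nat -> side_of_diag (V (a + j)%nat) <= 0).
  { intros k Hk Hkn; destruct (Nat.eq_dec k n) as [->|]; [rewrite (oc_period _ _ _ HV); lra|].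
    destruct (Nat.eq_dec k r) as [->|]; [lra|].
    pose proof (diag_arc_right k ltac:(lia) ltac:(lia)); lra. }
  destruct (le_lt_dec (S j) r).
  - left; split; apply HL; lia.
  - right; split; apply HR; lia.
Qed.

(** The arc from [V e] to [V (S f)] stays within a right angle, so the square of its chord is at
    least the sum of the squares of its first two edges. Such a chord cannot be the short
    diagonal. *)
Lemma cone_chain_not_short e f : 0 < cross (edge V e) (edge V f) -> 0 <= dot (edge V e) (edge V f) ->
  (V e = V a \/ V e = V (a + r)%nat) -> (V (S f) = V a \/ V (S f) = V (a + r)%nat) -> False.
Proof.
  intros Hcr Hdt He Hf; pose proof (Hcyc i Hi) as HV.
  destruct (oc_repr n l0 V HV e f) as (d & Hd & Ef & ESf).
  set (W := fun m => V (e + m)%nat).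
  assert (HW : obtuse_cycle n l0 W) by apply (oc_shift n l0 V e HV).
  assert (EW0 : edge W 0 = edge V e) by (unfold W; rewrite edge_shift; f_equal; lia).
  assert (EWd : edge W d = edge V f) by (unfold W; rewrite edge_shift; unfold edge; congruence).
  rewrite <- EW0, <- EWd in Hcr, Hdt.
  assert (Hd1 : (1 <= d)%nat).
  { destruct d; [|lia]; exfalso; assert (cross (edge W 0) (edge W 0) = 0) by vring; lra. }
  assert (HWS : W (S d) = V (S f)) by (unfold W; rewrite Nat.add_succ_r; congruence).
  assert (HW0 : W 0%nat = V e) by (unfold W; f_equal; lia).
  assert (Hlong : ~ short_sqr l0 V (vsub (V (S f)) (V e))).
  { rewrite <- HWS, <- HW0.
    assert (Hsum : vsub (W (S d)) (W 0%nat) = vadd (vadd (edge W 0) (edge W 1)) (vsub (W (S d)) (W 2%nat)))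
      by (unfold edge; veq).
    assert (C0 := cone_edge n l0 W HW d ltac:(lia) Hcr 0 ltac:(lia)).
    assert (C1 := cone_edge n l0 W HW d ltac:(lia) Hcr 1 ltac:(lia)).
    assert (C2 := cone_chain n l0 W HW d ltac:(lia) Hcr 2 (S d) ltac:(lia) ltac:(lia)).
    rewrite Hsum; set (T := vsub (W (S d)) (W 2%nat)) in *.
    pose proof (oc_len _ _ _ HW 0%nat); pose proof (oc_len _ _ _ HW 1%nat); pose proof (dot_nonneg T).
    pose proof (cone_dot W d Hcr Hdt _ _ C0 C2); pose proof (cone_dot W d Hcr Hdt _ _ C1 C2).
    pose proof (oc_dot _ _ _ HW 0%nat).
    assert (Hexp : dot (vadd (vadd (edge W 0) (edge W 1)) T) (vadd (vadd (edge W 0) (edge W 1)) T)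
      = dot (edge W 0) (edge W 0) + dot (edge W 1) (edge W 1) + dot T T + 2 * dot (edge W 0) (edge W 1)
        + 2 * dot (edge W 0) T + 2 * dot (edge W 1) T) by vring.
    unfold short_sqr; rewrite Hexp; intros [Hs|[Hs Ho]]; [lra|].
    pose proof (Ho e) as Hoe.
    assert (EW1 : edge W 1 = edge V (S e)) by (unfold W; rewrite edge_shift; f_equal; lia).
    rewrite <- EW0, <- EW1 in Hoe; lra. }
  assert (Hne : V (S f) <> V e).
  { intros E.
    assert (Hz : cross (edge V e) (edge V f) <= 0).
    { assert (H : edge V f = vscale (-1) (vsub (V f) (V e))) by (unfold edge; rewrite E; veq).
      pose proof (convex_ge n l0 V HV e f) as Hge. rewrite H; vunf; lra. }
    rewrite EW0, EWd in Hcr; lra. }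
  apply Hlong.
  assert (Hsym : short_sqr l0 V (vsub (V a) (V (a + r)%nat))).
  { destruct Hshort as [Hs|[Hs Ho]]; [left|right; split; trivial];
      replace (dot (vsub (V a) (V (a + r)%nat)) (vsub (V a) (V (a + r)%nat))) with (dot D D)
        by (unfold D; vring); trivial. }
  destruct He as [He|He], Hf as [Hf|Hf]; try congruence; rewrite He, Hf; trivial.
Qed.

End ShortDiagonal.

Section ShortDiagonalBound.
Variables (X : surface) (l0 : R).
Hypothesis Hwf : wf_surface X.
Hypothesis HP1 : P1 X.
Hypothesis HP2 : P2 X.
Hypothesis Hmin : is_min_side_length X l0.
Notation PG i := (polyg X i).
Notation len i := (length (polyg X i)).
Let Hcyc := polygon_cycle X l0 Hwf HP1 Hmin.

Lemma single_piece_diagonal La (HLa : is_saddle_connection X La) (Hna : nonside X La) :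
  length La = 1%nat -> exists a r, (a < len (ppoly La 0))%nat /\ (2 <= r)%nat /\ (r + 2 <= len (ppoly La 0))%nat /\
    pA La 0 = vtx (PG (ppoly La 0)) a /\ pB La 0 = vtx (PG (ppoly La 0)) (a + r) /\
    sc_length La = norm (vsub (vtx (PG (ppoly La 0)) (a + r)) (vtx (PG (ppoly La 0)) a)).
Proof.
  intros Hp.
  pose proof (ppoly_valid X La HLa 0 ltac:(lia)) as Hi; pose proof (Hcyc _ Hi) as HV.
  destruct (start_vertex X La HLa) as (a & Ha & HA); destruct (end_vertex X La HLa) as (c & Hc & HB).
  rewrite Hp in Hc, HB; cbn [Nat.sub] in Hc, HB.
  destruct (index_offset (PG (ppoly La 0)) a c Ha Hc) as (r & Hr & Ec).
  set (n := len (ppoly La 0)) in *.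
  assert (HVr : vtx (PG (ppoly La 0)) c = vtx (PG (ppoly La 0)) (a + r)) by (rewrite Ec; apply vtx_mod).
  assert (Hbad : forall k, (k < n)%nat -> height (PG (ppoly La 0)) k (pA La 0) = 0 ->
            height (PG (ppoly La 0)) k (pB La 0) = 0 -> False).
  { intros k Hk H1 H2; apply (Hna 0%nat ltac:(lia)); exists k; now repeat split. }
  exists a, r; split; [trivial|].
  assert (Hlen : sc_length La = norm (vsub (vtx (PG (ppoly La 0)) (a + r)) (vtx (PG (ppoly La 0)) a))).
  { rewrite sc_length_psum, Hp; simpl; rewrite Rplus_0_l, pdir_eq, HA, HB, HVr; reflexivity. }
  assert (H2 : (2 <= r)%nat).
  { destruct r as [|[|r]]; [| |lia]; exfalso; apply (Hbad a Ha).
    - rewrite HA; apply height_same_vertex.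
    - rewrite HB, HVr, Nat.add_0_r; apply height_same_vertex.
    - rewrite HA; apply height_same_vertex.
    - rewrite HB, HVr, Nat.add_1_r; unfold height, edge; vring. }
  assert (H3 : (r + 2 <= n)%nat).
  { destruct (le_lt_dec (r + 2) n); trivial; exfalso; apply (Hbad c Hc).
    - rewrite HA; replace (vtx (PG (ppoly La 0)) a) with (vtx (PG (ppoly La 0)) (S c)).
      + unfold height, edge; vring.
      + rewrite Ec; unfold n; rewrite (vtx_mod_S (PG (ppoly La 0))).
        replace (S (a + r)) with (a + n)%nat by lia; apply (oc_period _ _ _ HV).
    - rewrite HB; apply height_same_vertex. }
  repeat split; trivial; now rewrite HB.
Qed.

Section Fixed.
Variables La Lb : list piece.
Hypothesis HLa : is_saddle_connection X La.
Hypothesis HLb : is_saddle_connection X Lb.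
Hypothesis Hna : nonside X La.
Hypothesis Hnb : nonside X Lb.
Hypothesis Hp : length La = 1%nat.
Hypothesis Hshort : sc_length La < sqrt 2 * l0 \/ (sc_length La <= sqrt 2 * l0 /\ all_strictly_obtuse X).
Hypothesis Hpar : cross (pdir La 0) (pdir Lb 0) <> 0.
Notation q := (length Lb).
Let i := ppoly La 0.
Notation V := (vtx (PG i)).
Variables a r : nat.
Hypothesis Hr : (2 <= r)%nat.
Hypothesis Hrn : (r + 2 <= len i)%nat.
Hypothesis HA : pA La 0 = V a.
Hypothesis HB : pB La 0 = V (a + r)%nat.
Hypothesis Hlen : sc_length La = norm (vsub (V (a + r)%nat) (V a)).
Let D := vsub (V (a + r)%nat) (V a).
Let G0 := side_of_diag X i a r.

Let Hi : (i < npoly X)%nat.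
Proof. apply (ppoly_valid X La HLa); rewrite Hp; apply Nat.lt_0_1. Qed.

Lemma fixed_short : short_sqr l0 V D.
Proof.
  pose proof (norm_nonneg D) as Hn.
  assert (Hs2 : sqrt 2 * sqrt 2 = 2) by (apply sqrt_sqrt; lra).
  rewrite Hlen in Hshort; fold D in Hshort.
  unfold short_sqr; rewrite <- norm_sqr.
  replace (2 * (l0 * l0)) with ((sqrt 2 * l0) * (sqrt 2 * l0))
    by (replace (sqrt 2 * l0 * (sqrt 2 * l0)) with (sqrt 2 * sqrt 2 * (l0 * l0)) by ring; now rewrite Hs2).
  destruct Hshort as [Hs|[Hs Ho]]; [left; nra|right; split; [nra|]].
  now apply (strictly_obtuse_polygon X l0).
Qed.

(** The sign makes [G] increase along [b], in whichever direction [b] crosses the diagonal. *)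
Let eps : R := if Rlt_dec 0 (cross (pdir Lb 0) D) then 1 else -1.
Let G w := eps * G0 w.

Lemma eps_cases : (eps = 1 \/ eps = -1) /\ 0 < eps * cross (pdir Lb 0) D.
Proof.
  assert (Hne : cross (pdir Lb 0) D <> 0).
  { intros E; apply Hpar. rewrite (pdir_eq La 0), HA, HB; fold D. vunf; lra. }
  unfold eps; destruct (Rlt_dec 0 (cross (pdir Lb 0) D)); split; try lra; auto.
Qed.

Lemma G_diff v w : G v - G w = eps * cross (vsub v w) D.
Proof. unfold G, G0, side_of_diag; fold D; generalize D as d; intros; vring. Qed.

Lemma G_seg v w s : G (seg_pt v w s) = (1 - s) * G v + s * G w.
Proof. unfold G, G0, side_of_diag; generalize D as d; intros; vring. Qed.

Lemma eps_cross_le v : eps * cross v D <= norm D * norm v.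
Proof.
  destruct eps_cases as [[->| ->] _].
  - rewrite Rmult_1_l, Rmult_comm; apply cross_le_norms.
  - replace (-1 * cross v D) with (cross D v) by vring; apply cross_le_norms.
Qed.

Lemma G_vertex m : (V m = V a \/ V m = V (a + r)%nat) \/ l0 * l0 < G (V m) \/ G (V m) < - (l0 * l0).
Proof.
  pose proof (vertex_side_of_diag X l0 Hwf HP1 Hmin i a r Hi Hr Hrn fixed_short m) as H.
  fold G0 in H; unfold G; destruct eps_cases as [[->| ->] _]; destruct H as [H|[H|H]]; auto;
    right; [left|right|right|left]; lra.
Qed.

Lemma G_ends m : V m = V a \/ V m = V (a + r)%nat -> G (V m) = 0.
Proof.
  destruct (side_of_diag_ends X i a r) as [S1 S2].
  unfold G, G0; intros [->| ->]; rewrite ?S1, ?S2; ring.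
Qed.

Lemma G_edge m : (0 <= G (V m) /\ 0 <= G (V (S m))) \/ (G (V m) <= 0 /\ G (V (S m)) <= 0).
Proof.
  pose proof (edge_side_of_diag X l0 Hwf HP1 Hmin i a r Hi Hr Hrn fixed_short m) as H.
  fold G0 in H; unfold G; destruct eps_cases as [[->| ->] _]; destruct H as [[H1 H2]|[H1 H2]];
    [left|right|right|left]; split; lra.
Qed.

Definition crosses_diag (u : nat) : Prop := ppoly Lb u = i /\ exists s s', 0 < s < 1 /\ 0 <= s' <= 1 /\
  ppt La 0 s = ppt Lb u s'.
Definition crosses_diagb (u : nat) : bool :=
  if excluded_middle_informative (crosses_diag u) then true else false.

Lemma crosses_diagb_spec u : crosses_diagb u = true <-> crosses_diag u.
Proof. unfold crosses_diagb; destruct (excluded_middle_informative _); split; intros; trivial; congruence. Qed.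

Lemma G_on_diag s : G (ppt La 0 s) = 0.
Proof. unfold ppt; rewrite HA, HB, G_seg, !G_ends; [ring|now right|now left]. Qed.

(** A point strictly inside the diagonal is interior to the polygon, hence not an end of the piece
    of [b], and [G] increases strictly along that piece. *)
Lemma crosses_sides u : (u < q)%nat -> crosses_diag u -> G (pA Lb u) < 0 /\ 0 < G (pB Lb u).
Proof.
  intros Hu (HP & s & s' & Hs & Hs' & Hz).
  pose proof (G_on_diag s) as Hg; rewrite Hz in Hg; unfold ppt in Hg; rewrite G_seg in Hg.
  assert (Hint : forall w, piece_end Lb u w -> ppt La 0 s <> w).
  { intros w Hw E; destruct (piece_end_height X Hwf Lb HLb u w Hu Hw) as (k & Hk & Hkz).
    rewrite HP in Hk, Hkz.
    pose proof (interior_height_pos X l0 Hwf HP1 Hmin La HLa Hna 0 k s ltac:(lia) Hk Hs) as Hpos.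
    fold i in Hpos; rewrite E in Hpos; lra. }
  assert (H0 : s' <> 0).
  { intros ->; apply (Hint (pA Lb u)); [now left|]; rewrite Hz; apply seg_0. }
  assert (H1 : s' <> 1).
  { intros ->; apply (Hint (pB Lb u)); [now right|]; rewrite Hz; apply seg_1. }
  pose proof (G_diff (pB Lb u) (pA Lb u)) as Hd; rewrite <- pdir_eq in Hd.
  rewrite (pdir_plam X Lb HLb u Hu) in Hd; pose proof (plam_pos X Lb HLb u Hu) as Hl.
  assert (Hd' : 0 < G (pB Lb u) - G (pA Lb u)).
  { rewrite Hd; replace (eps * cross (vscale (plam Lb u) (pdir Lb 0)) D)
      with (plam Lb u * (eps * cross (pdir Lb 0) D)) by vring.
    apply Rmult_lt_0_compat; trivial; apply eps_cases. }
  split; nra.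
Qed.

Lemma diag_norm_gt : l0 < norm D.
Proof.
  unfold D; rewrite <- Hlen, sc_length_psum, Hp; simpl; rewrite Rplus_0_l.
  assert (Hc : corner X La 0 = false) by reflexivity.
  apply (proj1 (proj2 (piece_far X l0 Hwf HP1 Hmin La HLa Hna 0 ltac:(lia) Hc))); exact Hp.
Qed.

(** Only a corner piece in between can be too short. Its displacement, written with the sides [e]
    and [f] of exit and return, replaces the values of [G] at the exit and return points by those at
    two vertices. One of these is not an end of the diagonal, by [cone_chain_not_short], so the
    difference exceeds [l0 * l0]. *)
Lemma crosses_gap u : (S (S u) < q)%nat -> crosses_diag u -> crosses_diag (S (S u)) ->
  l0 * l0 < G (pB Lb u) + norm D * norm (pdir Lb (S u)) + - G (pA Lb (S (S u))).
Proof.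
  intros Hu C0 C2.
  pose proof (min_side_pos X l0 Hwf Hmin) as Hl; pose proof diag_norm_gt as HD.
  destruct (crosses_sides u ltac:(lia) C0) as [_ GB]; destruct (crosses_sides (S (S u)) Hu C2) as [GA _].
  destruct (corner X Lb (S u)) eqn:Ec.
  2:{ destruct (piece_far X l0 Hwf HP1 Hmin Lb HLb Hnb (S u) ltac:(lia) Ec) as [H1 _]; nra. }
  apply corner_spec in Ec as (_ & _ & Ec).
  destruct (exit_kout X Hwf Lb HLb u ltac:(lia)) as ((_ & Hk0) & Hs0 & HB0 & _).
  destruct (entry_kin X Hwf Lb HLb (S (S u)) ltac:(lia) Hu) as ((_ & Hk2) & Hs2 & HA2).
  pose proof (entry_edge X Hwf Lb HLb u ltac:(lia)) as He1.
  pose proof (entry_edge X Hwf Lb HLb (S u) Hu) as He2.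
  assert (Esin1 : sin_ X Lb (S u) = 1 - sout X Lb u) by (unfold sin_; now replace (S u - 1)%nat with u by lia).
  assert (Esin2 : sin_ X Lb (S (S u)) = 1 - sout X Lb (S u))
    by (unfold sin_; now replace (S (S u) - 1)%nat with (S u) by lia).
  destruct C0 as [P0 _], C2 as [P2' _].
  rewrite P0 in *; rewrite P2' in *.
  set (e := kout X Lb u) in *; set (f := kin X Lb (S (S u))) in *.
  rewrite HB0 in GB |- *; rewrite HA2 in GA |- *; unfold side_pt in *; rewrite G_seg in GA, GB; rewrite !G_seg.
  assert (Ge : 0 <= G (V e) /\ 0 <= G (V (S e))) by (destruct (G_edge e) as [H|H]; trivial; nra).
  assert (Gf : G (V f) <= 0 /\ G (V (S f)) <= 0) by (destruct (G_edge f) as [H|H]; trivial; nra).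
  pose proof (eps_cross_le (pdir Lb (S u))) as Hle.
  assert (Hdiff : forall k, eps * cross (edge V k) D = G (V (S k)) - G (V k))
    by (intros k; rewrite G_diff; reflexivity).
  assert (Hnv : forall k m, 0 <= G (V k) -> G (V m) <= 0 ->
     ~ ((V k = V a \/ V k = V (a + r)%nat) /\ (V m = V a \/ V m = V (a + r)%nat)) ->
     l0 * l0 < G (V k) - G (V m)).
  { intros k m H1 H2 Hno; destruct (G_vertex k) as [Ek|Ek]; [|nra].
    destruct (G_vertex m) as [Em|Em]; [exfalso; now apply Hno|nra]. }
  assert (Hf' : edge V f = vscale (-1) (edge (vtx (PG (ppoly Lb (S u)))) (kout X Lb (S u)))) by exact He2.
  destruct Ec as [Hc|Hc].
  - destruct (cornerA_eq X l0 Hwf HP1 Hmin Lb HLb (S u) ltac:(lia) ltac:(lia) Hc) as (_ & Hd1 & Hdot & Hcr).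
    rewrite He1 in Hd1, Hdot, Hcr.
    assert (Hlt : l0 * l0 < G (V e) - G (V (S f))).
    { apply Hnv; try apply Ge; try apply Gf; intros [E1 E2].
      apply (cone_chain_not_short X l0 Hwf HP1 Hmin i a r Hi Hr Hrn fixed_short e f); trivial; rewrite Hf'; vunf; lra. }
    assert (Hsum : eps * cross (pdir Lb (S u)) D
      = - (sout X Lb u * (G (V (S e)) - G (V e)) + (1 - sin_ X Lb (S (S u))) * (G (V (S f)) - G (V f)))).
    { rewrite <- !Hdiff, Hd1, Hf', Esin1, Esin2; vring. }
    rewrite Hsum in Hle; lra.
  - destruct (cornerB_eq X l0 Hwf HP1 Hmin Lb HLb (S u) ltac:(lia) ltac:(lia) Hc) as (_ & Hd1 & Hdot & Hcr).
    rewrite He1 in Hd1, Hdot, Hcr.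
    assert (Hlt : l0 * l0 < G (V (S e)) - G (V f)).
    { apply Hnv; try apply Ge; try apply Gf; intros [E1 E2].
      apply (cone_chain_not_short X l0 Hwf HP1 Hmin i a r Hi Hr Hrn fixed_short f e); trivial; rewrite Hf'; vunf; lra. }
    assert (Hsum : eps * cross (pdir Lb (S u)) D
      = (1 - sout X Lb u) * (G (V (S e)) - G (V e)) + sin_ X Lb (S (S u)) * (G (V (S f)) - G (V f))).
    { rewrite <- !Hdiff, Hd1, Hf', Esin1, Esin2; vring. }
    rewrite Hsum in Hle; lra.
Qed.

(** The weight [norm D * norm (pdir Lb t)] bounds the increase of [G] along piece [t]. If [b]
    crosses in its first or last piece, its end there is a vertex off the diagonal, where [G] is
    beyond [l0 * l0] in absolute value; otherwise that piece has enough weight. *)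
Lemma crossings_of_diag : l0 * l0 * (INR (cnt crosses_diagb q) + 1) < norm D * sc_length Lb.
Proof.
  pose proof (min_side_pos X l0 Hwf Hmin) as Hl; pose proof diag_norm_gt as HD.
  assert (Hpsum : norm D * sc_length Lb = psum (fun t => norm D * norm (pdir Lb t)) q).
  { rewrite sc_length_psum, Rmult_comm, <- psum_scale; apply psum_ext; intros; ring. }
  pose proof (sc_pos X Lb HLb) as Hq.
  assert (Hcl : forall t, t = 0%nat \/ t = (q - 1)%nat -> l0 * l0 < norm D * norm (pdir Lb t)).
  { intros t Ht.
    assert (Hc : corner X Lb t = false).
    { destruct (corner X Lb t) eqn:E; trivial; apply corner_spec in E; lia. }
    destruct (piece_far X l0 Hwf HP1 Hmin Lb HLb Hnb t ltac:(lia) Hc) as [H1 _]; nra. }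
  rewrite Hpsum; apply (slab_count q crosses_diagb _ (fun u => - G (pA Lb u)) (fun u => G (pB Lb u))); trivial.
  - intros t Ht E1 E2; apply crosses_diagb_spec in E1 as [E1 _]; apply crosses_diagb_spec in E2 as [E2 _].
    apply (next_polygon X Hwf HP2 Lb HLb t Ht); congruence.
  - intros t Ht; apply Rmult_lt_0_compat; [lra|now apply (pdir_norm_pos X Lb HLb)].
  - intros t Ht E; apply crosses_diagb_spec in E; destruct (crosses_sides t Ht E) as [H1 H2].
    split; [lra|split; [lra|]].
    pose proof (eps_cross_le (pdir Lb t)) as Hle; rewrite pdir_eq in Hle at 1; rewrite <- G_diff in Hle; lra.
  - split; intros E; [|apply Hcl; now left].
    apply crosses_diagb_spec in E; destruct (crosses_sides 0 Hq E) as [H1 _]; destruct E as [EP _].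
    destruct (start_vertex X Lb HLb) as (b & Hb & Hbe); rewrite EP in Hbe; rewrite Hbe in *.
    destruct (G_vertex b) as [Hv|[Hv|Hv]]; [rewrite (G_ends b Hv) in H1; lra|nra|lra].
  - split; intros E; [|apply Hcl; now right].
    apply crosses_diagb_spec in E; destruct (crosses_sides (q - 1) ltac:(lia) E) as [_ H1]; destruct E as [EP _].
    destruct (end_vertex X Lb HLb) as (b & Hb & Hbe); rewrite EP in Hbe; rewrite Hbe in *.
    destruct (G_vertex b) as [Hv|[Hv|Hv]]; [rewrite (G_ends b Hv) in H1; lra|lra|nra].
  - intros t Ht; pose proof (two_pieces_far X l0 Hwf HP1 Hmin Lb HLb Hnb t Ht); nra.
  - intros t Ht E0 E2; apply crosses_diagb_spec in E0; apply crosses_diagb_spec in E2.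
    now apply crosses_gap.
Qed.

Lemma inter_le_crossings n : ~ sc_eq X La Lb -> inter_count X La Lb n -> (n <= cnt crosses_diagb q)%nat.
Proof.
  clear a r Hr Hrn HA HB Hlen D G0 eps G; intros Hne [[He _]|[_ (ps & Hlps & Hps & Hdist & _)]]; [contradiction|].
  set (Q := fun (x : xpt) (u : nat) => (u < q)%nat /\ ppoly Lb u = i /\ exists s s', 0 < s < 1 /\ 0 <= s' <= 1 /\
     ppt La 0 s = ppt Lb u s' /\ same_pt X x (i, ppt La 0 s)).
  destruct (choose_codes (A := xpt) (0%nat, (0, 0)) 0%nat Q ps) as (us & Hnd & Hlu & Hus).
  - intros x Hx; destruct (Hps x Hx) as (Hxa & Hxb & Hsx).
    destruct (common_point X l0 Hwf HP1 Hmin La Lb HLb Hnb x Hsx Hxa Hxb)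
      as (t & u & s & s' & Ht & Hu & Hs & Hs' & HP & Hz & Hx' & Hnv).
    assert (t = 0%nat) as -> by lia.
    exists u; split; [trivial|split; [now symmetry|]]; exists s, s'; split; [|now repeat split].
    destruct (Req_dec s 0) as [->|N0].
    { exfalso; apply Hnv; unfold ppt; rewrite seg_0.
      destruct (start_vertex X La HLa) as (b & Hb & Hbe); now exists b. }
    destruct (Req_dec s 1) as [->|N1]; [|lra].
    exfalso; apply Hnv; unfold ppt; rewrite seg_1.
    destruct (end_vertex X La HLa) as (b & Hb & Hbe); rewrite Hp in Hb, Hbe; now exists b.
  - intros t u Ht Hu Htu y [(Hy & _ & s1 & s1' & I1 & I1' & E1 & S1) (_ & _ & s2 & s2' & I2 & I2' & E2 & S2)].
    rewrite Hlps in Ht, Hu; apply (Hdist t u Ht Hu Htu).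
    assert (Hs : s1 = s2).
    { assert (Hz : (s1 - s2) * cross (pdir La 0) (pdir Lb 0) = 0).
      { pose proof (pdir_plam X Lb HLb y Hy) as Hd; pose proof (plam_pos X Lb HLb y Hy) as Hl.
        assert (Hc : (s1 - s2) * cross (pdir La 0) (pdir Lb y) = 0).
        { replace ((s1 - s2) * cross (pdir La 0) (pdir Lb y))
            with (cross (vsub (ppt La 0 s1) (ppt La 0 s2)) (pdir Lb y)) by (rewrite !pdir_eq; unfold ppt; vring).
          rewrite E1, E2, pdir_eq; unfold ppt; vring. }
        rewrite Hd in Hc.
        replace ((s1 - s2) * cross (pdir La 0) (vscale (plam Lb y) (pdir Lb 0)))
          with (plam Lb y * ((s1 - s2) * cross (pdir La 0) (pdir Lb 0))) in Hc by vring.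
        apply Rmult_integral in Hc as [Hc|Hc]; lra. }
      apply Rmult_integral in Hz as [Hz|Hz]; [lra|contradiction]. }
    subst s2; eapply rst_trans; [exact S1|apply rst_sym; exact S2].
  - rewrite <- Hlps, <- Hlu, <- cnt_filter; apply NoDup_incl_length; trivial.
    intros u Hu; destruct (Hus u Hu) as (x & _ & H1 & H2 & s & s' & I1 & I2 & E & _).
    apply filter_In; split; [apply in_seq; lia|].
    apply crosses_diagb_spec; split; trivial; now exists s, s'.
Qed.

End Fixed.

Lemma short_diagonal_bound La Lb n :
  is_saddle_connection X La -> is_saddle_connection X Lb -> nonside X La -> nonside X Lb ->
  inter_count X La Lb n -> length La = 1%nat ->
  sc_length La < sqrt 2 * l0 \/ (sc_length La <= sqrt 2 * l0 /\ all_strictly_obtuse X) ->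
  INR n + 1 < sc_length La / l0 * (sc_length Lb / l0).
Proof.
  intros HLa HLb Hna Hnb Hic Hp Hs.
  pose proof (min_side_pos X l0 Hwf Hmin) as Hl.
  pose proof (nonside_itinerary X l0 Hwf HP1 HP2 Hmin La HLa Hna) as HA.
  pose proof (nonside_itinerary X l0 Hwf HP1 HP2 Hmin Lb HLb Hnb) as HB.
  apply itinerary_gt_one in HA; apply itinerary_gt_one in HB; rewrite psum_lengths in HA, HB.
  assert (H0 : n = 0%nat -> INR n + 1 < sc_length La / l0 * (sc_length Lb / l0)) by (intros ->; simpl; nra).
  destruct (classic (sc_eq X La Lb)) as [Heq|Hne].
  { destruct Hic as [[_ ->]|[Hne _]]; [now apply H0|contradiction]. }
  destruct (Req_dec (cross (pdir La 0) (pdir Lb 0)) 0) as [Hpar|Hpar].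
  { apply H0; exact (parallel_no_common X l0 Hwf HP1 Hmin La Lb HLa HLb Hna Hnb n Hpar Hne Hic). }
  destruct (single_piece_diagonal La HLa Hna Hp) as (a & r & _ & Hr & Hrn & EA & EB & Hlen).
  pose proof (crossings_of_diag La Lb HLa HLb Hna Hnb Hp Hs Hpar a r Hr Hrn EA EB Hlen) as Hcount.
  pose proof (inter_le_crossings La Lb HLa HLb Hnb Hp Hpar n Hne Hic) as Hle.
  apply le_INR in Hle.
  rewrite <- Hlen in Hcount.
  replace (sc_length La / l0 * (sc_length Lb / l0)) with (sc_length La * sc_length Lb / (l0 * l0)) by (field; lra).
  apply Rmult_lt_reg_r with (l0 * l0); [nra|].
  replace (sc_length La * sc_length Lb / (l0 * l0) * (l0 * l0)) with (sc_length La * sc_length Lb) by (field; lra).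
  nra.
Qed.

End ShortDiagonalBound.

(** * Crossing a side *)

Lemma inter_count_sym X La Lb n : inter_count X La Lb n -> inter_count X Lb La n.
Proof.
  assert (Hsym : forall L1 L2, sc_eq X L1 L2 -> sc_eq X L2 L1) by (intros L1 L2 H x; symmetry; apply H).
  intros [[He Hn]|[Hne (ps & Hl & Hps & Hd & Hall)]]; [left; auto|right; split; [auto|]].
  exists ps; repeat split; try apply Hps; trivial.
  intros x H1 H2; now apply Hall.
Qed.

Section SideNonside.
Variables (X : surface) (l0 : R).
Hypothesis Hwf : wf_surface X.
Hypothesis HP1 : P1 X.
Hypothesis HP2 : P2 X.
Hypothesis Hmin : is_min_side_length X l0.

Lemma side_side La Lb i k j m n : covers_side X La i k -> covers_side X Lb j m ->
  inter_count X La Lb n -> n = 0%nat.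
Proof.
  intros Ha Hb [[_ Hn]|[Hne (ps & Hl & Hps & _)]]; trivial.
  destruct ps as [|x ps]; [now rewrite <- Hl|]; exfalso; apply Hne.
  apply (covers_side_eq X l0 Hwf HP1 Hmin La Lb i k j m Ha Hb); exists x; apply Hps; now left.
Qed.

Lemma glue_back i k : valid_side X i k ->
  gpoly X (gpoly X i k) (gside X i k) = i /\ gside X (gpoly X i k) (gside X i k) = k.
Proof. intros H; unfold gpoly at 1, gside at 2; now rewrite (glue_glue X Hwf i k H). Qed.

Variable L : list piece.
Hypothesis HL : is_saddle_connection X L.
Hypothesis Hns : nonside X L.
Notation q := (length L).

(** A passage is attached to the piece [u] that begins with it, so index 0 never counts. As the side
    has two copies, it is seen either as the entry of [u] or as the exit of [u - 1]. *)
Definition passes_side (i k u : nat) : Prop :=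
  (0 < u)%nat /\ ((ppoly L u = i /\ kin X L u = k) \/ (ppoly L (u - 1) = i /\ kout X L (u - 1) = k)).

Definition passes_sideb (i k u : nat) : bool :=
  if excluded_middle_informative (passes_side i k u) then true else false.

Lemma passes_sideb_spec i k u : passes_sideb i k u = true <-> passes_side i k u.
Proof. unfold passes_sideb; destruct (excluded_middle_informative _); split; intros; trivial; congruence. Qed.

Lemma kin_kout_neq t : (0 < t)%nat -> (S t < q)%nat -> kin X L t <> kout X L t.
Proof.
  intros H0 Ht E; apply (Hns t ltac:(lia)); exists (kout X L t).
  destruct (exit_kout X Hwf L HL t Ht) as ((_ & Hk) & _ & HB & _).
  destruct (entry_kin X Hwf L HL t H0 ltac:(lia)) as (_ & _ & HA).
  rewrite E in HA; split; [trivial|]; rewrite HA, HB; split; apply height_side_pt.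
Qed.

Lemma entry_glue t : (S t < q)%nat ->
  ppoly L (S t) = gpoly X (ppoly L t) (kout X L t) /\ kin X L (S t) = gside X (ppoly L t) (kout X L t) /\
  ppoly L t = gpoly X (ppoly L (S t)) (kin X L (S t)) /\ kout X L t = gside X (ppoly L (S t)) (kin X L (S t)).
Proof.
  intros Ht; destruct (exit_kout X Hwf L HL t Ht) as (Hk & _ & _ & HP & _).
  assert (HK : kin X L (S t) = gside X (ppoly L t) (kout X L t))
    by (unfold kin; now replace (S t - 1)%nat with t by lia).
  destruct (glue_back _ _ Hk) as [G1 G2].
  rewrite HK, HP; repeat split; congruence.
Qed.

(** In two of the four combinations consecutive pieces would lie in the same polygon, in the other
    two a piece would enter and leave by the same side. *)
Lemma passes_side_independent i k : independent q (passes_sideb i k).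
Proof.
  intros u Hu E1 E2; apply passes_sideb_spec in E1 as [Hu0 E1]; apply passes_sideb_spec in E2 as [_ E2].
  replace (S u - 1)%nat with u in E2 by lia.
  destruct u as [|u]; [lia|]; replace (S u - 1)%nat with u in E1 by lia.
  pose proof (next_polygon X Hwf HP2 L HL u ltac:(lia)) as N1.
  pose proof (next_polygon X Hwf HP2 L HL (S u) Hu) as N2.
  pose proof (kin_kout_neq (S u) ltac:(lia) Hu) as Nk.
  destruct (entry_glue u ltac:(lia)) as (_ & G2 & _ & _).
  destruct (entry_glue (S u) Hu) as (_ & _ & G3 & G4).
  destruct E1 as [[E1 E1']|[E1 E1']], E2 as [[E2 E2']|[E2 E2']]; try congruence.
Qed.

Lemma common_point_passes La i k x : covers_side X La i k -> ~ singular X x ->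
  sc_mem X La x -> sc_mem X L x ->
  exists u, (u < q)%nat /\ passes_side i k u /\ same_pt X x (ppoly L u, pA L u).
Proof.
  intros (Hv & _ & Hcov) Hsx Hxa (u & s' & Hu & Hs' & Hx').
  change (same_pt X x (ppoly L u, ppt L u s')) in Hx'.
  apply Hcov in Hxa as (s & Hs & Hx).
  assert (Hnv : ~ is_vertex X i (side_pt X i k s)).
  { intros H; apply Hsx; eexists; split; [exact Hx|exact H]. }
  assert (Hnv' : ~ is_vertex X (ppoly L u) (ppt L u s')).
  { intros H; apply Hsx; eexists; split; [exact Hx'|exact H]. }
  pose proof (side_pt_end X i k s Hv Hs Hnv) as Hs1.
  assert (Hj : exists m r, valid_side X (ppoly L u) m /\ 0 < r < 1 /\ ppt L u s' = side_pt X (ppoly L u) m r /\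
      ((ppoly L u = i /\ m = k) \/ (gpoly X (ppoly L u) m = i /\ gside X (ppoly L u) m = k))).
  { assert (Hsame : same_pt X (i, side_pt X i k s) (ppoly L u, ppt L u s'))
      by (eapply rst_trans; [apply rst_sym; exact Hx|exact Hx']).
    destruct (same_pt_class X l0 Hwf HP1 Hmin (i, side_pt X i k s) _ Hnv Hsame) as [E|(k' & s1 & Hk' & _ & E1 & E)].
    - assert (F1 := f_equal fst E); assert (F2 := f_equal snd E); cbn [fst snd] in F1, F2.
      exists k, s; rewrite F1, F2; split; [trivial|split; [trivial|split; [trivial|left; now split]]].
    - cbn [fst snd] in *.
      destruct (side_pt_unique X l0 Hwf HP1 Hmin i k k' s s1 Hv Hk' Hs1 E1) as [<- <-].
      assert (F1 := f_equal fst E); assert (F2 := f_equal snd E); cbn [fst snd] in F1, F2.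
      exists (gside X i k), (1 - s); rewrite F1, F2; destruct (glue_back _ _ Hv) as [G1 G2].
      split; [now apply (glue_valid X)|split; [lra|split; [trivial|right; now split]]]. }
  destruct Hj as (m & r & Hm & Hr & Hz & Hcase).
  assert (Hend : s' = 0 \/ s' = 1).
  { destruct (Req_dec s' 0); [now left|]; destruct (Req_dec s' 1); [now right|exfalso].
    pose proof (interior_height_pos X l0 Hwf HP1 Hmin L HL Hns u m s' Hu (proj2 Hm) ltac:(lra)) as Hpos.
    rewrite Hz, height_side_pt in Hpos; lra. }
  destruct Hend as [->| ->]; unfold ppt in Hz, Hnv', Hx'; rewrite ?seg_0, ?seg_1 in Hz, Hnv', Hx'.
  - assert (Hu0 : (0 < u)%nat).
    { destruct u; [exfalso|lia]; apply Hnv'.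
      destruct (start_vertex X L HL) as (a & Ha & HA); exists a; now split. }
    exists u; split; [trivial|split; [|trivial]]; split; [trivial|].
    destruct (entry_kin X Hwf L HL u Hu0 Hu) as (Hk & _ & HA); rewrite HA in Hz.
    symmetry in Hz; destruct (side_pt_unique X l0 Hwf HP1 Hmin _ _ _ _ _ Hm Hk Hr Hz) as [-> _].
    destruct Hcase as [[C1 C2]|[C1 C2]]; [now left|right].
    destruct u as [|u]; [lia|]; destruct (entry_glue u Hu) as (_ & _ & G3 & G4).
    replace (S u - 1)%nat with u by lia; split; congruence.
  - assert (Hu1 : (S u < q)%nat).
    { destruct (Nat.eq_dec (S u) q) as [E|]; [exfalso|lia]; apply Hnv'.
      destruct (end_vertex X L HL) as (b & Hb & HB); replace (q - 1)%nat with u in Hb, HB by lia.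
      exists b; now split. }
    destruct (exit_unique X l0 Hwf HP1 Hmin L HL u m r Hu1 Hm Hz) as [-> _].
    destruct (exit_kout X Hwf L HL u Hu1) as (Hk & Hs2 & HB & HP & HA).
    exists (S u); split; [trivial|split].
    + split; [lia|]; replace (S u - 1)%nat with u by lia.
      destruct Hcase as [[C1 C2]|[C1 C2]]; [right; now split|left].
      destruct (entry_glue u Hu1) as (G1 & G2 & _); split; congruence.
    + eapply rst_trans; [exact Hx'|]; rewrite HB, HP, HA.
      apply (glued_side_same_pt X Hwf _ _ _ Hk); lra.
Qed.

(** The passages form an independent set without the index 0, so [independent_miss_first] gives the
    bound and its exceptional case. *)
Lemma side_nonside La i k n : covers_side X La i k -> inter_count X La L n ->
  INR n + 1 < sc_length L / l0 \/ (n = 1%nat /\ q = 2%nat /\ sc_length L = 2 * l0 /\ norm (pdir L 0) = l0).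
Proof.
  intros Hcov Hic.
  pose proof (min_side_pos X l0 Hwf Hmin) as Hl.
  pose proof (nonside_itinerary X l0 Hwf HP1 HP2 Hmin L HL Hns) as HI.
  pose proof (itinerary_gt_one _ _ _ _ HI) as Hgt; rewrite psum_lengths in Hgt.
  destruct n as [|n]; [left; simpl; lra|].
  destruct Hic as [[_ Hn]|[_ (ps & Hlps & Hps & Hdist & _)]]; [lia|].
  assert (Hcnt : (S n <= cnt (passes_sideb i k) q)%nat).
  { destruct (choose_codes (A := xpt) (0%nat, (0, 0)) 0%nat
      (fun x u => (u < q)%nat /\ passes_side i k u /\ same_pt X x (ppoly L u, pA L u)) ps)
      as (us & Hnd & Hlu & Hus).
    - intros x Hx; destruct (Hps x Hx) as (Hxa & Hxb & Hsx); now apply (common_point_passes La).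
    - intros t u Ht Hu Htu y [(_ & _ & S1) (_ & _ & S2)]; rewrite Hlps in Ht, Hu.
      apply (Hdist t u Ht Hu Htu); eapply rst_trans; [exact S1|apply rst_sym; exact S2].
    - rewrite <- Hlps, <- Hlu, <- cnt_filter; apply NoDup_incl_length; trivial.
      intros u Hu; destruct (Hus u Hu) as (x & _ & H1 & H2 & _).
      apply filter_In; split; [apply in_seq; lia|now apply passes_sideb_spec]. }
  assert (HU0 : passes_sideb i k 0 = false).
  { destruct (passes_sideb i k 0) eqn:E; trivial; apply passes_sideb_spec in E as [H _]; lia. }
  pose proof (le_INR _ _ Hcnt) as HR.
  destruct (independent_miss_first _ _ _ _ HI _ (passes_side_independent i k) HU0)
    as [H|(H1 & H2 & H3 & H4 & H5)]; rewrite psum_lengths in *; [left; lra|right].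
  assert (Hdiv : forall a, a / l0 * l0 = a) by (intros; field; lra).
  rewrite H2 in *; simpl INR in H5; repeat split; trivial; [lia| |].
  - rewrite <- (Hdiv (sc_length L)), <- H5; ring.
  - rewrite <- (Hdiv (norm (pdir L 0))), H3; ring.
Qed.

(** The midpoint of a piece is interior to its polygon and so has no other copy. *)
Lemma interior_poly_img t j : (t < q)%nat -> poly_img X j (ppoly L t, ppt L t (1 / 2)) -> j = ppoly L t.
Proof.
  intros Ht (z & _ & Hz).
  assert (Hpos : forall k, (k < length (polyg X (ppoly L t)))%nat -> 0 < height (polyg X (ppoly L t)) k (ppt L t (1 / 2)))
    by (intros k Hk; apply (interior_height_pos X l0 Hwf HP1 Hmin); trivial; lra).
  assert (Hnv : ~ is_vertex X (ppoly L t) (ppt L t (1 / 2))).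
  { intros (a & Ha & E); specialize (Hpos a Ha); rewrite E, height_same_vertex in Hpos; lra. }
  destruct (same_pt_class X l0 Hwf HP1 Hmin (ppoly L t, ppt L t (1 / 2)) _ Hnv Hz) as [E|(k & s & Hk & _ & E & _)].
  - now apply (f_equal fst) in E.
  - cbn [fst snd] in *; specialize (Hpos k (proj2 Hk)); rewrite E, height_side_pt in Hpos; lra.
Qed.

Lemma two_pieces_two_polys : q = 2%nat -> in_exactly_two_polys X L.
Proof.
  intros Hq; split.
  - exists (ppoly L 0), (ppoly L 1); split; [apply (ppoly_valid X L HL); lia|].
    split; [apply (ppoly_valid X L HL); lia|].
    split; [pose proof (next_polygon X Hwf HP2 L HL 0 ltac:(lia)); congruence|].
    intros x (t & s & Ht & Hs & Hx).
    assert (Hp : poly_img X (ppoly L t) x).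
    { exists (ppt L t s); split; [now apply (ppt_in_poly X l0 Hwf HP1 Hmin)|exact Hx]. }
    destruct t as [|[|t]]; [now left|now right|lia].
  - intros (j & _ & Hj).
    assert (Hpc : forall t, (t < q)%nat -> j = ppoly L t).
    { intros t Ht; apply interior_poly_img; trivial; apply Hj.
      exists t, (1 / 2); split; [trivial|split; [lra|apply rst_refl]]. }
    apply (next_polygon X Hwf HP2 L HL 0 ltac:(lia)); rewrite <- !Hpc; trivial; lia.
Qed.

End SideNonside.

(** * Equality *)

Lemma covers_side_is_side X L i k : covers_side X L i k -> is_side X L.
Proof. intros (Hv & _ & H); exists i, k; split; [exact Hv|exact H]. Qed.

Lemma sc_length_pos X L : is_saddle_connection X L -> 0 < sc_length L.
Proof.
  intros HL; rewrite sc_length_psum.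
  exact (psum_mono _ (length L) (pdir_norm_pos X L HL) 0 (length L) (sc_pos X L HL) (le_n _)).
Qed.

Section Equality.
Variables (X : surface) (l0 : R).
Hypothesis Hwf : wf_surface X.
Hypothesis HP1 : P1 X.
Hypothesis HP2 : P2 X.
Hypothesis Hmin : is_min_side_length X l0.

Let Hl := min_side_pos X l0 Hwf Hmin.

Lemma single_piece_is_diagonal L : is_saddle_connection X L -> nonside X L -> length L = 1%nat ->
  is_diagonal X L.
Proof.
  intros HL Hn Hp.
  destruct (single_piece_diagonal X l0 Hwf HP1 Hmin L HL Hn Hp) as (a & r & Ha & Hr & Hrn & HA & HB & _).
  set (i := ppoly L 0) in *; set (n := length (polyg X i)) in *.
  assert (Hmod : forall m, (m < n)%nat \/ (n <= m < n + n)%nat ->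
     (m mod n)%nat = m \/ (m mod n + n)%nat = m).
  { intros m [Hm|Hm]; [left; now apply Nat.mod_small|right].
    replace m with (m - n + 1 * n)%nat at 1 by lia; rewrite Nat.Div0.mod_add, Nat.mod_small; lia. }
  assert (Hlt : forall m, (m mod n < n)%nat) by (intros m; apply Nat.mod_upper_bound; lia).
  pose proof (Hmod (a + r)%nat ltac:(lia)) as H1; pose proof (Hlt (a + r)%nat) as H1'.
  pose proof (Hmod (S a) ltac:(lia)) as H2.
  set (b := ((a + r) mod n)%nat) in *.
  pose proof (Hmod (S b) ltac:(lia)) as H3.
  exists i, a, b; fold n.
  split; [apply (ppoly_valid X L HL); lia|]; repeat split; trivial; try lia.
  - intros (t & s & Ht & Hs & Hx); assert (t = 0%nat) as -> by lia.
    exists s; split; trivial; unfold b, n; rewrite vtx_mod, <- HA, <- HB; exact Hx.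
  - unfold b, n; rewrite vtx_mod, <- HA, <- HB; intros (s & Hs & Hx).
    exists 0%nat, s; split; [lia|split; [trivial|exact Hx]].
Qed.

Definition normalized_bound (a b : list piece) : R := sc_length a / l0 * (sc_length b / l0).

Lemma normalized_bound_sym a b : normalized_bound a b = normalized_bound b a.
Proof. apply Rmult_comm. Qed.

Lemma normalized_bound_eq x y a b : sc_length a = x * l0 -> sc_length b = y * l0 -> normalized_bound a b = x * y.
Proof. intros Ha Hb; unfold normalized_bound; rewrite Ha, Hb; field; lra. Qed.

Lemma covers_side_length L i k : covers_side X L i k -> l0 <= sc_length L.
Proof. intros (Hv & -> & _); now apply Hmin. Qed.

Lemma ratio_ge x : l0 <= x -> 1 <= x / l0 /\ (x <> l0 -> 1 < x / l0).
Proof.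
  intros Hx; assert (Hd : x / l0 * l0 = x) by (field; lra); split; [nra|intros Hne].
  nra.
Qed.

Lemma side_nonside_cases a b n i k :
  is_saddle_connection X b -> inter_count X a b n -> covers_side X a i k -> nonside X b ->
  INR n + 1 < normalized_bound a b \/
  (sc_length a = l0 /\ sc_length b = 2 * l0 /\ in_exactly_two_polys X b /\ n = 1%nat /\ ~ all_strictly_obtuse X).
Proof.
  intros Hb Hic Hcov Hns; pose proof (covers_side_length a i k Hcov) as Ha.
  destruct (ratio_ge _ Ha) as [R1 R2]; pose proof (pos_INR n); unfold normalized_bound.
  destruct (side_nonside X l0 Hwf HP1 HP2 Hmin b Hb Hns a i k n Hcov Hic) as [H1|(Hn & Hq & Hlb & Hw)]; [left; nra|].
  destruct (Req_dec (sc_length a) l0) as [E|E].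
  - right; repeat split; trivial; [now apply (two_pieces_two_polys X l0)..|].
    (* With strictly obtuse angles the first piece, which joins a vertex to a point inside a side,
       would be longer than [l0]. *)
    intros Ho; destruct (piece_far X l0 Hwf HP1 Hmin b Hb Hns 0 ltac:(lia) eq_refl) as (_ & _ & H3).
    specialize (H3 Ho (or_introl eq_refl)); lra.
  - left; specialize (R2 E); rewrite Hlb, Hn; simpl; replace (2 * l0 / l0) with 2 by (field; lra); lra.
Qed.

(** Diagonals shorter than [sqrt 2 * l0] are dealt with beforehand, so the exceptional case of
    [nonside_nonside] has lengths at least [sqrt 2 * l0] and at most one crossing; equality leaves
    nothing but case (b). If all angles are strictly obtuse, [short_diagonal_bound] covers the
    length [sqrt 2 * l0] as well. *)
Lemma nonside_nonside_cases a b n :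
  is_saddle_connection X a -> is_saddle_connection X b -> inter_count X a b n -> nonside X a -> nonside X b ->
  INR n + 1 < normalized_bound a b \/
  (is_diagonal X a /\ is_diagonal X b /\ sc_length a = sqrt 2 * l0 /\ sc_length b = sqrt 2 * l0 /\ n = 1%nat /\
   ~ all_strictly_obtuse X).
Proof.
  intros Ha Hb Hic Hna Hnb; unfold normalized_bound.
  pose proof (short_diagonal_bound X l0 Hwf HP1 HP2 Hmin a b n Ha Hb Hna Hnb Hic) as Sa.
  pose proof (short_diagonal_bound X l0 Hwf HP1 HP2 Hmin b a n Hb Ha Hnb Hna (inter_count_sym X a b n Hic)) as Sb.
  rewrite (Rmult_comm (sc_length b / l0)) in Sb.
  destruct (classic (length a = 1%nat /\ sc_length a < sqrt 2 * l0)) as [[E1 E2]|Ea]; [left; now apply Sa; auto|].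
  destruct (classic (length b = 1%nat /\ sc_length b < sqrt 2 * l0)) as [[E1 E2]|Eb]; [left; now apply Sb; auto|].
  assert (La : length a = 1%nat -> sqrt 2 * l0 <= sc_length a) by (intros E; apply Rnot_lt_le; tauto).
  assert (Lb : length b = 1%nat -> sqrt 2 * l0 <= sc_length b) by (intros E; apply Rnot_lt_le; tauto).
  destruct (nonside_nonside X l0 Hwf HP1 HP2 Hmin a b n Ha Hb Hna Hnb Hic La Lb) as [H|(Pa & Pb & Hn)]; [now left|].
  specialize (La Pa); specialize (Lb Pb).
  assert (Hdiv : forall x, x / l0 * l0 = x) by (intros; field; lra).
  assert (Hge : forall x, sqrt 2 * l0 <= x -> sqrt 2 <= x / l0 /\ (x <> sqrt 2 * l0 -> sqrt 2 < x / l0)).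
  { intros x Hx; pose proof (Hdiv x); split; [nra|intros Hne; nra]. }
  destruct (Hge _ La) as [A1 A2]; destruct (Hge _ Lb) as [B1 B2].
  assert (Hs2 : sqrt 2 * sqrt 2 = 2) by (apply sqrt_sqrt; lra).
  assert (Hs : 0 < sqrt 2) by (apply sqrt_lt_R0; lra).
  apply le_INR in Hn as HR; simpl in HR.
  destruct (Req_dec (sc_length a) (sqrt 2 * l0)) as [Fa|Fa]; [|left; specialize (A2 Fa); nra].
  destruct (Req_dec (sc_length b) (sqrt 2 * l0)) as [Fb|Fb]; [|left; specialize (B2 Fb); nra].
  destruct (Nat.eq_dec n 1) as [->|Hn1].
  - destruct (classic (all_strictly_obtuse X)) as [Ho|Ho].
    + left; apply Sa; trivial; right; split; [lra|trivial].
    + right; repeat split; trivial; now apply single_piece_is_diagonal.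
  - left; assert (n = 0%nat) as -> by lia; simpl; nra.
Qed.

Lemma equality_cases a b n :
  is_saddle_connection X a -> is_saddle_connection X b -> inter_count X a b n ->
  INR n + 1 < normalized_bound a b \/
  (is_side X a /\ is_side X b /\ sc_length a = l0 /\ sc_length b = l0 /\ n = 0%nat) \/
  (~ all_strictly_obtuse X /\ n = 1%nat /\
   ((is_diagonal X a /\ is_diagonal X b /\ sc_length a = sqrt 2 * l0 /\ sc_length b = sqrt 2 * l0) \/
    (is_side X a /\ sc_length a = l0 /\ sc_length b = 2 * l0 /\ in_exactly_two_polys X b) \/
    (is_side X b /\ sc_length b = l0 /\ sc_length a = 2 * l0 /\ in_exactly_two_polys X a))).
Proof.
  intros Ha Hb Hic.
  assert (Hkind : forall L, is_saddle_connection X L -> (exists i k, covers_side X L i k) \/ nonside X L).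
  { intros L HL; destruct (side_or_nonside X l0 Hwf HP1 Hmin L HL) as [H|H]; [left|now right].
    exists (ppoly L 0); now apply (side_connection X l0). }
  destruct (Hkind a Ha) as [(i & k & Ca)|Na], (Hkind b Hb) as [(j & m & Cb)|Nb].
  - pose proof (side_side X l0 Hwf HP1 Hmin a b i k j m n Ca Cb Hic) as ->.
    destruct (ratio_ge _ (covers_side_length a i k Ca)) as [A1 A2].
    destruct (ratio_ge _ (covers_side_length b j m Cb)) as [B1 B2].
    unfold normalized_bound; simpl.
    destruct (Req_dec (sc_length a) l0) as [Ea|Ea]; [|left; specialize (A2 Ea); nra].
    destruct (Req_dec (sc_length b) l0) as [Eb|Eb]; [|left; specialize (B2 Eb); nra].
    right; left; repeat split; trivial; eapply covers_side_is_side; eassumption.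
  - destruct (side_nonside_cases a b n i k Hb Hic Ca Nb) as [H|(H1 & H2 & H3 & H4 & H5)]; [now left|].
    right; right; split; [trivial|split; [trivial|right; left]].
    repeat split; trivial; [now apply (covers_side_is_side X a i k)|apply H3..].
  - apply inter_count_sym in Hic.
    destruct (side_nonside_cases b a n j m Ha Hic Cb Na) as [H|(H1 & H2 & H3 & H4 & H5)];
      [left; now rewrite normalized_bound_sym|].
    right; right; split; [trivial|split; [trivial|right; right]].
    repeat split; trivial; [now apply (covers_side_is_side X b j m)|apply H3..].
  - destruct (nonside_nonside_cases a b n Ha Hb Hic Na Nb) as [H|(H1 & H2 & H3 & H4 & H5 & H6)]; [now left|].
    right; right; repeat split; trivial; now left.
Qed.

Lemma normalized_bound_frac a b n : is_saddle_connection X a -> is_saddle_connection X b ->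
  ((INR n + 1) / (sc_length a * sc_length b) <= 1 / l0 ^ 2 <-> INR n + 1 <= normalized_bound a b) /\
  ((INR n + 1) / (sc_length a * sc_length b) = 1 / l0 ^ 2 <-> INR n + 1 = normalized_bound a b).
Proof.
  intros Ha Hb; pose proof (sc_length_pos X a Ha); pose proof (sc_length_pos X b Hb).
  assert (Hab : 0 < sc_length a * sc_length b) by nra.
  set (c := sc_length a * sc_length b) in *.
  set (m := (INR n + 1) / c); assert (E1 : INR n + 1 = m * c) by (unfold m; field; lra).
  assert (E2 : normalized_bound a b = 1 / l0 ^ 2 * c) by (unfold normalized_bound, c; field; lra).
  clearbody m; rewrite E2, E1.
  split; split; intros H'.
  - apply Rmult_le_compat_r; lra.
  - now apply Rmult_le_reg_r in H'.
  - now rewrite H'.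
  - apply Rmult_eq_reg_r in H'; lra.
Qed.

End Equality.
Theorem mainTheorem2 (X : surface) (l0 : R) (a b : list piece) (n : nat) :
  wf_surface X -> P1 X -> P2 X -> is_min_side_length X l0 ->
  is_saddle_connection X a -> is_saddle_connection X b ->
  inter_count X a b n ->
  (INR n + 1) / (sc_length a * sc_length b) <= 1 / l0 ^ 2 /\
  (all_strictly_obtuse X ->
     ((INR n + 1) / (sc_length a * sc_length b) = 1 / l0 ^ 2 <->
      is_side X a /\ is_side X b /\ sc_length a = l0 /\ sc_length b = l0)) /\
  (some_right X ->
     ((INR n + 1) / (sc_length a * sc_length b) = 1 / l0 ^ 2 <->
      (* (a) *)
      ((is_side X a \/ is_diagonal X a) /\ (is_side X b \/ is_diagonal X b) /\
        sc_length a = l0 /\ sc_length b = l0) \/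
      (* (b) *)
      (is_diagonal X a /\ is_diagonal X b /\
        sc_length a = sqrt 2 * l0 /\ sc_length b = sqrt 2 * l0 /\ n = 1%nat) \/
      (* (c) *)
      ((is_side X a \/ is_diagonal X a) /\ sc_length a = l0 /\
        sc_length b = 2 * l0 /\ in_exactly_two_polys X b /\ n = 1%nat) \/
      ((is_side X b \/ is_diagonal X b) /\ sc_length b = l0 /\
        sc_length a = 2 * l0 /\ in_exactly_two_polys X a /\ n = 1%nat))).
Proof.
  intros Hwf HP1 HP2 Hmin Ha Hb Hic.
  pose proof (min_side_pos X l0 Hwf Hmin) as Hl.
  destruct (normalized_bound_frac X l0 Hwf Hmin a b n Ha Hb) as [Hle Heq]; rewrite Hle, Heq.
  pose proof (normalized_bound_eq X l0 Hwf Hmin) as HM.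
  assert (Hs2 : sqrt 2 * sqrt 2 = 2) by (apply sqrt_sqrt; lra).
  assert (M1 : sc_length a = l0 -> sc_length b = l0 -> normalized_bound l0 a b = 1)
    by (intros E1 E2; rewrite (HM 1 1); lra).
  assert (M2 : sc_length a = sqrt 2 * l0 -> sc_length b = sqrt 2 * l0 -> normalized_bound l0 a b = 2)
    by (intros E1 E2; rewrite (HM (sqrt 2) (sqrt 2)); trivial).
  assert (M3 : sc_length a = l0 -> sc_length b = 2 * l0 -> normalized_bound l0 a b = 2)
    by (intros E1 E2; rewrite (HM 1 2); lra).
  assert (M4 : sc_length b = l0 -> sc_length a = 2 * l0 -> normalized_bound l0 a b = 2)
    by (intros E1 E2; rewrite (HM 2 1); lra).
  pose proof (equality_cases X l0 Hwf HP1 HP2 Hmin a b n Ha Hb Hic) as Hcases.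
  assert (Hmain : INR n + 1 <= normalized_bound l0 a b).
  { destruct Hcases as [H|[(_ & _ & E1 & E2 & ->)|(_ & -> & [(_ & _ & E1 & E2)|[(_ & E1 & E2 & _)|(_ & E1 & E2 & _)]])]];
      [lra|rewrite M1|rewrite M2|rewrite M3|rewrite M4]; trivial; simpl; lra. }
  (* For two lengths [l0] the inequality just proved reads [INR n + 1 <= 1], which forces [n = 0]
     and hence equality. *)
  assert (Hmin1 : sc_length a = l0 -> sc_length b = l0 -> INR n + 1 = normalized_bound l0 a b).
  { intros E1 E2; rewrite (M1 E1 E2) in *; pose proof (pos_INR n); lra. }
  split; [exact Hmain|split].
  - intros Ho; split; [intros E|now intros (_ & _ & E1 & E2); apply Hmin1].
    destruct Hcases as [H|[(H1 & H2 & E1 & E2 & _)|(Hno & _)]]; [lra|auto|contradiction].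
  - intros _; split.
    + intros E; destruct Hcases as [H|[(H1 & H2 & E1 & E2 & _)|(_ & -> &
        [(H1 & H2 & E1 & E2)|[(H1 & E1 & E2 & H2)|(H1 & E1 & E2 & H2)]])]];
        [lra|left; auto|right; left; auto 6|right; right; left; auto 6|right; right; right; auto 6].
    + intros [(_ & _ & E1 & E2)|[(_ & _ & E1 & E2 & ->)|[(_ & E1 & E2 & _ & ->)|(_ & E1 & E2 & _ & ->)]]];
        [now apply Hmin1|rewrite M2|rewrite M3|rewrite M4]; trivial; simpl; lra.
Qed.
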